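(* Let $d\ge 1$ and $0<\alpha<2$. Let $p_t^{(\alpha)}$ be the transition density of the symmetric $\alpha$-stable process on $\mathbb{R}^d$, let $H_0=-\Delta^{\alpha/2}$ and $H=-\Delta^{\alpha/2}+V$, and let $Tr(e^{-tH}-e^{-tH_0})$ be the trace difference defined in the context. Suppose $V\in L^\infty(\mathbb{R}^d)\cap L^1(\mathbb{R}^d)$ is real-valued and uniformly Hölder continuous of order $\gamma$, i.e. there is a constant $M\in(0,\infty)$ such that $|V(x)-V(y)|\le M|x-y|^\gamma$ for all $x,y\in\mathbb{R}^d$, where $0<\gamma<\alpha\wedge 1$ if $0<\alpha\le 1$, and $0<\gamma\le 1$ if $1<\alpha<2$. Then for all $t>0$, $$\left|Tr(e^{-tH}-e^{-tH_0})+p_t^{(\alpha)}(0)\,t\int_{\mathbb{R}^d}V(x)\,dx-p_t^{(\alpha)}(0)\,\tfrac12t^2\int_{\mathbb{R}^d}|V(x)|^2dx\right|\le C_{\alpha,\gamma,d}\,\|V\|_1\,p_t^{(\alpha)}(0)\left(\|V\|_\infty^2e^{t\|V\|_\infty}t^3+t^{\gamma/\alpha+2}\right),$$ where the constant $C_{\alpha,\gamma,d}$ depends only on $\alpha$, $\gamma$ and $d$. In particular, $$Tr(e^{-tH}-e^{-tH_0})=p_t^{(\alpha)}(0)\left(-t\int_{\mathbb{R}^d}V(x)\,dx+\tfrac12t^2\int_{\mathbb{R}^d}|V(x)|^2dx+\mathcal{O}(t^{\gamma/\alpha+2})\right)\quad\text{as } t\downarrow0.$$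
   Context: $a\wedge b=\min\{a,b\}$. $X_t$ is the symmetric $\alpha$-stable process in $\mathbb{R}^d$: the Lévy process with $E^0(e^{i\xi\cdot X_t})=e^{-t|\xi|^\alpha}$, with transition density $p_t^{(\alpha)}(x,y)=p_t^{(\alpha)}(x-y)$, where $$p_t^{(\alpha)}(x)=\frac{1}{(2\pi)^d}\int_{\mathbb{R}^d}e^{-ix\cdot\xi}e^{-t|\xi|^\alpha}\,d\xi .$$ $\Delta^{\alpha/2}$ is the infinitesimal generator of $X_t$, i.e. $\widehat{\Delta^{\alpha/2}f}(\xi)=-|\xi|^\alpha\widehat f(\xi)$. $H_0=-\Delta^{\alpha/2}$, so that $e^{-tH_0}$ is the semigroup with kernel $p_t^{(\alpha)}(x,y)$; $H=H_0+V$ with $V\in L^\infty(\mathbb{R}^d)$ real-valued, and $e^{-tH}$ is the semigroup whose kernel is given by the Feynman–Kac formula $$p_t^H(x,y)=p_t^{(\alpha)}(x,y)\,E^t_{x,y}\left(e^{-\int_0^tV(X_s)\,ds}\right).$$ Here $E^t_{x,y}$ is expectation with respect to the stable bridge started at $x$ and conditioned to be at $y$ at time $t$, i.e. the process with right-continuous paths with left limits whose finite-dimensional densities at times $0<s_1<\dots<s_k<t$ are $\frac{1}{p_t^{(\alpha)}(x,y)}\prod_{j=0}^{k}p^{(\alpha)}_{s_{j+1}-s_j}(y_{j+1}-y_j)$ with $s_0=0$, $s_{k+1}=t$, $y_0=x$, $y_{k+1}=y$. The trace difference is defined by $$Tr(e^{-tH}-e^{-tH_0})=\int_{\mathbb{R}^d}\left(p_t^H(x,x)-p_t^{(\alpha)}(x,x)\right)dx=p_t^{(\alpha)}(0)\int_{\mathbb{R}^d}E^t_{x,x}\left(e^{-\int_0^tV(X_s)\,ds}-1\right)dx,$$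 which is absolutely convergent for $V\in L^\infty(\mathbb{R}^d)\cap L^1(\mathbb{R}^d)$. $\|\cdot\|_1$ and $\|\cdot\|_\infty$ are the norms of $L^1(\mathbb{R}^d)$ and $L^\infty(\mathbb{R}^d)$.
   Formalization: The last error term is M t^{γ/α+2} instead of t^{γ/α+2}, where M is the Hölder constant of V; with C depending only on α, γ, d the printed bound without M fails, by scaling V to r^{-α}V(x/r) and t to r^α t with r→0. *)

(* Defs.v *)
From HB Require Import structures.
From mathcomp Require Import all_boot all_order all_algebra.
From mathcomp Require Import all_classical all_reals all_analysis.
From mathcomp.real_closed Require Import complex.

Set Implicit Arguments.
Unset Strict Implicit.
Unset Printing Implicit Defensive.

Import Order.TTheory GRing.Theory Num.Theory.
Import numFieldNormedType.Exports.

Local Open Scope classical_set_scope.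
Local Open Scope ring_scope.

Lemma sigma_finite_product_measure1 (R : realType) d1 d2
    (T1 : measurableType d1) (T2 : measurableType d2)
    (m1 : {sigma_finite_measure set T1 -> \bar R})
    (m2 : {sigma_finite_measure set T2 -> \bar R}) :
  sigma_finite setT (m1 \x m2)%E.
Proof.
have /sigma_finiteP[F [TF ndF Foo]] := sigma_finiteT m1.
have /sigma_finiteP[G [TG ndG Goo]] := sigma_finiteT m2.
exists (fun n => F n `*` G n).
  rewrite -setXTT TF TG predeqE => -[x y]; split.
    move=> [/= [n _ Fnx] [k _ Gky]]; exists (maxn n k) => //; split.
    - by move: x Fnx; exact/subsetPset/ndF/leq_maxl.
    - by move: y Gky; exact/subsetPset/ndG/leq_maxr.
  by move=> [n _ []/= ? ?]; split; exists n.
move=> k; have [? ?] := Foo k; have [? ?] := Goo k.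
split; first exact: measurableX.
by rewrite product_measure1E// lte_mul_pinfty// ge0_fin_numE.
Qed.

Section pushforward_iso.
Context (R : realType) d1 d2 (T1 : measurableType d1) (T2 : measurableType d2).
Variable mu : {measure set T1 -> \bar R}.
Hypothesis mu_sigma_finite : sigma_finite setT mu.
Variables (f : T1 -> T2) (g : T2 -> T1).
Hypotheses (mf : measurable_fun setT f) (mg : measurable_fun setT g).
Hypothesis fK : cancel f g.

Let nu : set T2 -> \bar R := pushforward mu f.

Let nu0 : nu set0 = 0%E.
Proof. by rewrite /nu /pushforward preimage_set0 measure0. Qed.

Let nu_ge0 A : (0 <= nu A)%E.
Proof. exact: measure_ge0. Qed.

Let nu_sigma_additive : semi_sigma_additive nu.
Proof.
move=> F mF tF mUF; rewrite /nu /pushforward preimage_bigcup.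
apply: measure_semi_sigma_additive.
- by move=> n; rewrite -[X in measurable X]setTI; exact: mf.
- apply/trivIsetP => /= i j _ _ ij; rewrite -preimage_setI.
  by move/trivIsetP : tF => /(_ _ _ _ _ ij) ->//; rewrite preimage_set0.
- by rewrite -preimage_bigcup -[X in measurable X]setTI; exact: mf.
Qed.

Let nu_sigma_finite : sigma_finite setT nu.
Proof.
have [F TF Foo] := mu_sigma_finite.
exists (fun n => g @^-1` F n).
  apply/seteqP; split=> // y _.
  have : (\bigcup_i F i) (g y) by rewrite -TF.
  by move=> [n _ Fn]; exists n.
move=> n; have [mF Fn] := Foo n.
split; first by rewrite -[_ @^-1` _]setTI; exact: mg.
rewrite /nu /pushforward (_ : f @^-1` _ = F n)//.
by apply/seteqP; split=> x /=; rewrite fK.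
Qed.

HB.instance Definition _ := isMeasure.Build _ _ _ nu
  nu0 nu_ge0 nu_sigma_additive.

HB.instance Definition _ := Measure_isSigmaFinite.Build _ _ _ nu
  nu_sigma_finite.

Definition pushforward_iso : {sigma_finite_measure set T2 -> \bar R} := nu.

Lemma pushforward_isoE : pushforward_iso = pushforward mu f :> (_ -> _).
Proof. by []. Qed.

End pushforward_iso.

Section tuple_measure.
Context (R : realType) d (T : measurableType d).
Variable mu : {sigma_finite_measure set T -> \bar R}.

Definition tuple_cons n (p : T * n.-tuple T) : n.+1.-tuple T :=
  [tuple of p.1 :: p.2].

Definition tuple_uncons n (z : n.+1.-tuple T) : T * n.-tuple T :=
  (thead z, [tuple of behead z]).

Lemma tuple_consK n : cancel (@tuple_cons n) (@tuple_uncons n).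
Proof.
by move=> [x z]; rewrite /tuple_uncons theadE; congr pair; exact/val_inj.
Qed.

Lemma measurable_tuple_cons n : measurable_fun setT (@tuple_cons n).
Proof. exact: measurable_cons. Qed.

Lemma measurable_tuple_uncons n : measurable_fun setT (@tuple_uncons n).
Proof.
apply/measurable_fun_pairP; split; first exact: measurable_tnth.
exact: measurable_behead.
Qed.

(* The n-fold product of mu on n.-tuple T; on 0.-tuple T it is the unit mass. *)
Fixpoint tuple_measure n : {sigma_finite_measure set (n.-tuple T) -> \bar R} :=
  match n with
  | 0 => \d_([tuple] : 0.-tuple T)
  | n'.+1 => pushforward_iso
      (sigma_finite_product_measure1 mu (tuple_measure n'))
      (@measurable_tuple_cons n') (@measurable_tuple_uncons n')
      (@tuple_consK n')
  end.

End tuple_measure.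

Section measurable_rV.
Context (R : realType) (n : nat).

Let coord (i : 'I_n) (v : 'rV[R]_n) : measurableTypeR R := v ord0 i.

Let rV_set0 : g_sigma_preimage coord set0.
Proof. exact: sigma_algebra0. Qed.

Let rV_setC A : g_sigma_preimage coord A -> g_sigma_preimage coord (~` A).
Proof. exact: sigma_algebraC. Qed.

Let rV_bigcup (F : _^nat) : (forall i, g_sigma_preimage coord (F i)) ->
  g_sigma_preimage coord (\bigcup_i (F i)).
Proof. exact: sigma_algebra_bigcup. Qed.

(* The Borel sigma-algebra of R^n, as the one generated by the coordinates. *)
HB.instance Definition _ := @isMeasurable.Build default_measure_display
  'rV[R]_n (g_sigma_preimage coord) rV_set0 rV_setC rV_bigcup.

Definition rV_of_tuple (x : n.-tuple (measurableTypeR R)) : 'rV[R]_n :=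
  \row_i tnth x i.

Definition tuple_of_rV (v : 'rV[R]_n) : n.-tuple (measurableTypeR R) :=
  [tuple (v ord0 i : measurableTypeR R) | i < n].

Lemma rV_of_tupleK : cancel rV_of_tuple tuple_of_rV.
Proof. by move=> x; apply: eq_from_tnth => i; rewrite tnth_mktuple mxE. Qed.

Lemma measurable_coord (i : 'I_n) : measurable_fun setT (coord i).
Proof.
move=> _ Y mY; rewrite setTI; apply: sub_sigma_algebra => /=.
rewrite -bigcup_seq/=; exists i => /=; first by rewrite mem_index_enum.
by exists Y => //; rewrite setTI.
Qed.

Lemma measurable_rV_of_tuple : measurable_fun setT rV_of_tuple.
Proof.
apply: (@measurability _ _ _ _ _ _
  (\big[setU/set0]_(i < n) preimage_set_system setT (coord i) measurable)) => //.
move=> _ [A + <-]; rewrite -bigcup_seq => -[i _ [B mB <-]].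
rewrite !setTI -comp_preimage.
rewrite (_ : coord i \o _ = @tnth n (measurableTypeR R) ^~ i); last first.
  by apply/funext => x; rewrite /= /coord mxE.
by rewrite -[_ @^-1` _]setTI; exact: measurable_tnth.
Qed.

Lemma measurable_tuple_of_rV : measurable_fun setT tuple_of_rV.
Proof.
apply/measurable_fun_tnthP => i.
rewrite (_ : _ \o _ = coord i); first exact: measurable_coord.
by apply/funext => v /=; rewrite tnth_mktuple.
Qed.

Definition lebesgue_rV : {sigma_finite_measure set 'rV[R]_n -> \bar R} :=
  pushforward_iso (sigma_finiteT (tuple_measure (@lebesgue_measure R) n))
    measurable_rV_of_tuple measurable_tuple_of_rV rV_of_tupleK.

End measurable_rV.
Arguments lebesgue_rV : clear implicits.

Section euclidean.
Context (R : realType) (d : nat).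
Implicit Types x y : 'rV[R]_d.

Definition dotmul x y : R := \sum_(i < d) x ord0 i * y ord0 i.

(* `|x| on 'rV[R]_d is the sup norm *)
Definition enorm x : R := Num.sqrt (dotmul x x).

End euclidean.

Section complex_integral.
Context (R : realType).
Local Open Scope complex_scope.

Definition expiC (theta : R) : R[i] := cos theta +i* sin theta.

Definition Cintegral d (T : measurableType d)
    (mu : {measure set T -> \bar R}) (f : T -> R[i]) : R[i] :=
  (\int[mu]_x complex.Re (f x)) +i* (\int[mu]_x complex.Im (f x)).

End complex_integral.

Definition cadlag_on (R : realType) (E : topologicalType) (t : R) (f : R -> E) :
    Prop :=
  (forall s, 0 <= s < t -> f u @[u --> s^'+] --> f s) /\
  (forall s, 0 < s <= t -> exists l : E, f u @[u --> s^'-] --> l).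

Section stable.
Context (R : realType) (d : nat) (alpha : R).
Implicit Types (t : R) (x y : 'rV[R]_d).

(* The Fourier integral is real, so Re only changes its type. *)
Definition stable_density t x : R :=
  ((2 * pi) ^+ d)^-1 * complex.Re (Cintegral (lebesgue_rV R d) (fun xi =>
    expiC (- dotmul x xi) * (expR (- (t * enorm xi `^ alpha)))%:C%C)).

Definition stable_kernel t x y : R := stable_density t (x - y).

(* With s_0 = 0, s_(k+1) = t, y_0 = x, y_(k+1) = y, the product over
   0 <= j <= k of p_(s_(j+1) - s_j) (y_(j+1) - y_j), over p_t(x, y). *)
Definition bridge_density t x y k (s : k.-tuple R) (z : k.-tuple 'rV[R]_d) : R :=
  let s_ := nth 0 (0 :: rcons s t) in
  let y_ := nth 0 (x :: rcons z y) in
  (stable_kernel t x y)^-1 *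
  \prod_(j < k.+1) stable_density (s_ j.+1 - s_ j) (y_ j.+1 - y_ j).

Definition is_stable_bridge d' (Omega : measurableType d')
    (P : probability Omega R) (X : R -> Omega -> 'rV[R]_d) t x y : Prop :=
  [/\ forall s, 0 <= s <= t -> measurable_fun setT (X s),
      forall w, cadlag_on t (X ^~ w),
      {ae P, forall w, X 0 w = x /\ X t w = y} &
      forall k (s : k.-tuple R), path <%R 0 (rcons s t) ->
        forall A : set (k.-tuple 'rV[R]_d), measurable A ->
        P [set w | A [tuple X (tnth s i) w | i < k]] =
        (\int[tuple_measure (lebesgue_rV R d) k]_(z in A)
          (bridge_density t x y s z)%:E)%E].

(* X is a common path process on Omega; under P t x y it is the bridge of
   length t from x to y, so that 'E_(P t x y) is E^t_(x,y). *)
Section feynman_kac.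
Context d' (Omega : measurableType d').
Variables (P : R -> 'rV[R]_d -> 'rV[R]_d -> probability Omega R)
  (X : R -> Omega -> 'rV[R]_d) (V : 'rV[R]_d -> R).

Definition schrodinger_kernel t x y : R :=
  stable_kernel t x y *
  fine 'E_(P t x y)[fun w =>
    expR (- \int[lebesgue_measure]_(s in `[0, t]) V (X s w))].

Definition trace_difference t : R :=
  \int[lebesgue_rV R d]_x
    (schrodinger_kernel t x x - stable_kernel t x x).

End feynman_kac.

End stable.

(* Main.v *)
Require Import Defs.
From HB Require Import structures.
From mathcomp Require Import all_boot all_order all_algebra.
From mathcomp Require Import all_classical all_reals all_analysis.
From mathcomp Require Import measurable_realfun ess_sup_inf.
From mathcomp Require Import ring lra.

Set Implicit Arguments.
Unset Strict Implicit.
Unset Printing Implicit Defensive.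

Import Order.TTheory GRing.Theory Num.Theory.
Import numFieldNormedType.Exports.

Local Open Scope classical_set_scope.
Local Open Scope ring_scope.

(* With A = int_0^t V(X_s) ds, a second order expansion of e^{-A} bounds
   E(e^{-A}) - 1 + E(A) - E(A^2)/2 for the loop at x by t^2 N^2 e^{tN} E(int_0^t |V(X_s)| ds),
   and A^2 differs from t int_0^t V(X_s)^2 ds by half of the double integral over [0,t]^2 of
   (V(X_u) - V(X_s))^2.  After integration in x the law of X_s under the loop becomes
   Lebesgue measure, which gives the main terms, while the square of the increment is at most
   M |X_u - X_s|^gamma (|V(X_u)| + |V(X_s)|); its integral in x is, by Chapman-Kolmogorov,
   at most 2 ||V||_1 M times the mean of |z|^gamma for the loop of length t at time |u - s|,
   a moment of order t^(gamma/alpha).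

   No pointwise decay of the density is needed for this moment.  Bounding the kernel at the
   larger of the times r, t - r by p_{t/2}(0) leaves a moment of the other kernel p_s, which
   a dyadic decomposition reduces to tails of p_s on |z| >= rho.  Such a tail is read off
   from int (1 - p_r(z)/p_r(0)) p_s(z) dz <= 1 - p_{r+s}(0)/p_r(0) <= (d/alpha) s/r
   at r = rho^alpha, since 1 - p_r/p_r(0) is bounded below on |z| >= rho by scaling. *)

(** Everything needed about the density is extracted from the existence of the bridges. The law with
    no intermediate time forces p_t(x) to be nonzero for all t > 0 and x, which yields integrability
    of exp(-t|xi|^alpha) and then positivity; the law with one intermediate time yields
    Chapman-Kolmogorov. The constant has to be named before the bridges are given, so it is built
    from an explicit integral, [density_gap], whose positivity is proved only afterwards. The
    Hoelder constant M stays as a linear factor of t^(gamma/alpha + 2), which keeps the constant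
    independent of V.

    The measures P t x x form an arbitrary family in x, so expectations under them do not come with
    measurability in x. They are replaced by formulas in the density ([time_marginal],
    [increment_bound]), measurable by Tonelli, and the trace integrand is enclosed between
    integrable functions. Inequalities are kept between sums of nonnegative terms in [0, +oo] as
    long as possible, because the bound on the increments may be infinite at some x. *)

Lemma measurable_fun_Rintegral (R : realType) d1 d2 (T1 : measurableType d1)
    (T2 : measurableType d2) (m : {sigma_finite_measure set T2 -> \bar R})
    (f : T1 * T2 -> R) : measurable_fun setT f ->
  measurable_fun setT (fun x => \int[m]_y f (x, y)).
Proof.
move=> /measurable_EFinP mf; apply: (measurableT_comp (fine_measurable _)) => //.
(* The integral is by definition the difference of the integrals of the two parts, each measurable
   in x by Tonelli; this covers non-integrable sections as well. *)
rewrite (_ : (fun x => _) = (fun x => \int[m]_y (EFin \o f)^\+ (x, y) -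
    \int[m]_y (EFin \o f)^\- (x, y))%E); last first.
  apply: funext => x; rewrite integralE.
  by congr (_ - _)%E; apply: eq_integral => y _; rewrite ?funeposE ?funenegE.
apply: emeasurable_funB.
- exact: (measurable_fun_fubini_tonelli_F (m2 := m) (EFin \o f)^\+%E
    (measurable_funepos mf) (funepos_ge0 _)).
- exact: (measurable_fun_fubini_tonelli_F (m2 := m) (EFin \o f)^\-%E
    (measurable_funeneg mf) (funeneg_ge0 _)).
Qed.

(** * Integration over tuples and over row vectors *)

Lemma ge0_integral_tuple_cons (R : realType) dd (T : measurableType dd)
    (mu : {sigma_finite_measure set T -> \bar R}) n
    (f : n.+1.-tuple T -> \bar R) :
  measurable_fun setT f -> (forall x, (0 <= f x)%E) ->
  (\int[tuple_measure mu n.+1]_z f z =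
   \int[mu]_x \int[tuple_measure mu n]_z f [tuple of x :: z])%E.
Proof.
move=> mf f0.
rewrite ge0_integral_pushforward//=; last exact: measurable_tuple_cons.
rewrite preimage_setT.
rewrite (@fubini_tonelli1 _ _ _ _ _ mu (tuple_measure mu n))//=.
by apply: measurableT_comp => //; exact: measurable_tuple_cons.
Qed.

Lemma ge0_integral_tuple1 (R : realType) dd (T : measurableType dd)
    (mu : {sigma_finite_measure set T -> \bar R}) (f : 1.-tuple T -> \bar R) :
  measurable_fun setT f -> (forall x, (0 <= f x)%E) ->
  (\int[tuple_measure mu 1]_z f z = \int[mu]_x f [tuple x])%E.
Proof.
move=> mf f0; rewrite ge0_integral_tuple_cons//; apply: eq_integral => x _.
rewrite integral_dirac//= ?diracT ?mul1e; last first.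
  by apply: (measurableT_comp mf); exact: (@measurable_cons _ _ _ T (cst x) _ id).
by congr f; apply/val_inj.
Qed.

Lemma ge0_integral_tuple2 (R : realType) dd (T : measurableType dd)
    (mu : {sigma_finite_measure set T -> \bar R}) (f : 2.-tuple T -> \bar R) :
  measurable_fun setT f -> (forall x, (0 <= f x)%E) ->
  (\int[tuple_measure mu 2]_z f z = \int[mu]_x \int[mu]_y f [tuple x; y])%E.
Proof.
move=> mf f0; rewrite ge0_integral_tuple_cons//; apply: eq_integral => x _.
rewrite ge0_integral_tuple1//.
by apply: (measurableT_comp mf); exact: (@measurable_cons _ _ _ T (cst x) _ id).
Qed.

Section lebesgue_rV_theory.
Context {R : realType}.
Local Notation mu1 := (@lebesgue_measure R).
Local Notation TR := (measurableTypeR R).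

(** The image of Lebesgue measure under x -> a x + b, multiplied by a, agrees with Lebesgue measure
    on half-open intervals, hence everywhere by uniqueness. *)
Lemma ge0_integral_affine (a b : R) (f : TR -> \bar R) : 0 < a ->
  measurable_fun [set: TR] f -> (forall x, (0 <= f x)%E) ->
  (\int[mu1]_x f (a * x + b)%R = (a^-1)%:E * \int[mu1]_x f x)%E.
Proof.
move=> a0 mf f0.
pose phi : TR -> TR := fun x => a * x + b.
have mphi : measurable_fun [set: TR] phi.
  by apply: measurable_funD => //; exact: measurable_funM.
have a0' : (0 <= a)%R by exact: ltW.
pose nu := pushforward mu1 phi.
have E : (\int[mu1]_x f x = a%:E * \int[nu]_x f x)%E.
  rewrite -(ge0_integral_mscale nu _ (NngNum a0'))//.
  apply: eq_measure_integral => A mA _.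
  apply: lebesgue_measure_unique => // _ [[u v]] _ <-.
  change (mu1 `]u, v] = a%:E * mu1 (phi @^-1` `]u, v]))%E.
  rewrite (_ : phi @^-1` _ = `](u - b) / a, (v - b) / a]%classic).
    rewrite !lebesgue_measure_itv/= !lte_fin ltr_pM2r ?invr_gt0//.
    rewrite ltrD2r; case: ifPn => _; last by rewrite mule0.
    by rewrite -!EFinB -EFinM; congr EFin; field; rewrite gt_eqF.
  apply/seteqP; split => x; rewrite /phi/= !in_itv/=.
    by rewrite ltr_pdivrMr// ler_pdivlMr// ltrBlDr lerBrDr [x * a]mulrC.
  by rewrite ltr_pdivrMr// ler_pdivlMr// ltrBlDr lerBrDr [x * a]mulrC.
rewrite E muleA -EFinM mulVf ?gt_eqF// mul1e.
by rewrite /nu ge0_integral_pushforward.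
Qed.

(** Induction on n: by Tonelli each coordinate contributes one factor 1/a from
    [ge0_integral_affine]. *)
Lemma ge0_integral_tuple_affine n (a : R) (b : n.-tuple R)
    (f : n.-tuple TR -> \bar R) : 0 < a ->
  measurable_fun setT f -> (forall x, (0 <= f x)%E) ->
  (\int[tuple_measure mu1 n]_z f [tuple (a * tnth z i + tnth b i)%R | i < n] =
   (a ^- n)%:E * \int[tuple_measure mu1 n]_z f z)%E.
Proof.
move=> a0; elim: n b f => [|n IH] b f mf f0.
  rewrite expr0 invr1 mul1e; apply: eq_integral => z _; congr f.
  by rewrite [LHS]tuple0 [RHS]tuple0.
have maff m (c : m.-tuple R) : measurable_fun [set: m.-tuple TR]
    (fun z => [tuple (a * tnth z i + tnth c i : TR) | i < m]).
  apply/measurable_fun_tnthP => i.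
  rewrite (_ : _ \o _ = (fun z => a * tnth z i + tnth c i)); last first.
    by apply: funext => z /=; rewrite tnth_mktuple.
  apply: measurable_funD => //; apply: measurable_funM => //.
  exact: measurable_tnth.
rewrite ge0_integral_tuple_cons//;
  last exact: (measurableT_comp mf (maff _ _)).
rewrite [in RHS]ge0_integral_tuple_cons//.
case/tupleP: b => b0 b.
have E x (z : n.-tuple TR) :
    [tuple a * tnth [tuple of x :: z] i + tnth [tuple of b0 :: b] i | i < n.+1]
    = [tuple of a * x + b0 :: [tuple a * tnth z i + tnth b i | i < n]].
  apply: eq_from_tnth => i; rewrite tnth_mktuple.
  by have [j ->|->] := unliftP ord0 i; rewrite ?tnthS ?tnth0 ?tnth_mktuple.
have mfc : measurable_fun [set: TR * n.-tuple TR]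
    (fun w => f [tuple of w.1 :: w.2]).
  by apply: (measurableT_comp mf); exact: measurable_tuple_cons.
under eq_integral => x _.
  under eq_integral do rewrite E.
  rewrite (IH b (fun z => f [tuple of (a * x + b0)%R :: z]))//; last first.
    apply: (measurableT_comp mf).
    exact: (@measurable_cons _ _ _ TR (cst (a * x + b0)) _ id).
  over.
pose g (x : TR) := (\int[tuple_measure mu1 n]_z f [tuple of x :: z])%E.
have mg : measurable_fun [set: TR] g.
  exact: (measurable_fun_fubini_tonelli_F (m2 := tuple_measure mu1 n) _ mfc).
have g0 x : (0 <= g x)%E by exact: integral_ge0.
rewrite ge0_integralZl//; last 3 first.
- have maff1 : measurable_fun [set: TR] (fun x : TR => a * x + b0 : TR).
    by apply: measurable_funD => //; exact: measurable_funM.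
  exact: (measurableT_comp mg maff1).
- by move=> x _; exact: integral_ge0.
- by rewrite lee_fin invr_ge0 exprn_ge0// ltW.
by rewrite (ge0_integral_affine b0 a0 mg g0) muleA -EFinM -invfM -exprSr.
Qed.

Lemma measurable_fun_rV d (T : measurableType d) n (f : T -> 'rV[R]_n) :
  (forall i, measurable_fun setT (fun x => f x ord0 i)) ->
  measurable_fun setT f.
Proof.
move=> mf.
rewrite (_ : f = (@rV_of_tuple R n) \o
    (fun x => [tuple (f x ord0 i : TR) | i < n])); last first.
  by apply: funext => x; apply/rowP => i; rewrite mxE tnth_mktuple.
apply: (measurableT_comp (@measurable_rV_of_tuple R n)).
apply/measurable_fun_tnthP => i.
rewrite (_ : _ \o _ = fun x => f x ord0 i); first exact: mf.
by apply: funext => x /=; rewrite tnth_mktuple.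
Qed.

Lemma measurable_rV_affine n (a : R) (b : 'rV[R]_n) :
  measurable_fun setT (fun x : 'rV[R]_n => a *: x + b).
Proof.
apply: measurable_fun_rV => i.
rewrite (_ : (fun x => _) = (fun x : 'rV[R]_n => a * x ord0 i + b ord0 i)).
  apply: measurable_funD => //; apply: measurable_funM => //.
  exact: measurable_coord.
by apply: funext => x; rewrite !mxE.
Qed.

Lemma ge0_integral_rV_affine n (a : R) (b : 'rV[R]_n) (f : 'rV[R]_n -> \bar R) :
  0 < a -> measurable_fun setT f -> (forall x, (0 <= f x)%E) ->
  (\int[lebesgue_rV R n]_x f (a *: x + b)%R =
   (a ^- n)%:E * \int[lebesgue_rV R n]_x f x)%E.
Proof.
move=> a0 mf f0.
have maff := measurable_rV_affine a b.
rewrite ge0_integral_pushforward//=; [|exact: measurable_rV_of_tuple|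
  exact: measurableT_comp].
rewrite ge0_integral_pushforward//=; last exact: measurable_rV_of_tuple.
rewrite preimage_setT -(ge0_integral_tuple_affine (tuple_of_rV b))//.
  apply: eq_integral => z _ /=; congr f; apply/rowP => i.
  by rewrite !mxE !tnth_mktuple.
by apply: measurableT_comp => //; exact: measurable_rV_of_tuple.
Qed.

Lemma ge0_integral_rVD n (b : 'rV[R]_n) (f : 'rV[R]_n -> \bar R) :
  measurable_fun setT f -> (forall x, (0 <= f x)%E) ->
  (\int[lebesgue_rV R n]_x f (x + b)%R = \int[lebesgue_rV R n]_x f x)%E.
Proof.
move=> mf f0; have := ge0_integral_rV_affine b (@ltr01 R) mf f0.
rewrite expr1n invr1 mul1e => <-; apply: eq_integral => x _.
by rewrite scale1r.
Qed.

Lemma Rintegral_rV_affine n (a : R) (b : 'rV[R]_n) (f : 'rV[R]_n -> R) :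
  0 < a -> (lebesgue_rV R n).-integrable setT (EFin \o f) ->
  \int[lebesgue_rV R n]_x f (a *: x + b) = a ^- n * \int[lebesgue_rV R n]_x f x.
Proof.
move=> a0 intf; have mf := measurable_int _ intf.
rewrite /Rintegral -[a ^- n]/(fine (a ^- n)%:E) -fineM//; last first.
  exact: (integrable_fin_num _ intf).
congr fine; rewrite integralE [in RHS]integralE muleBr//; last first.
  exact: integrable_add_def.
rewrite -(ge0_integral_rV_affine b a0 (measurable_funepos mf) (funepos_ge0 _)).
rewrite -(ge0_integral_rV_affine b a0 (measurable_funeneg mf) (funeneg_ge0 _)).
by congr (_ - _)%E; apply: eq_integral => x _; rewrite ?funeposE ?funenegE.
Qed.

Lemma integrable_rV_affine n (a : R) (b : 'rV[R]_n) (f : 'rV[R]_n -> R) :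
  0 < a -> (lebesgue_rV R n).-integrable setT (EFin \o f) ->
  (lebesgue_rV R n).-integrable setT (EFin \o (fun x => f (a *: x + b))).
Proof.
move=> a0 /integrableP[mf foo]; apply/integrableP; split.
  exact: (measurableT_comp mf (measurable_rV_affine a b)).
rewrite (@ge0_integral_rV_affine _ a b (abse \o (EFin \o f)))//=; last first.
  exact: measurableT_comp.
by rewrite lte_mul_pinfty// lee_fin invr_ge0 exprn_ge0// ltW.
Qed.

Lemma lebesgue_rV_box_gt0 n (x : 'rV[R]_n) (r : R) : 0 < r ->
  (0 < lebesgue_rV R n [set y : 'rV[R]_n | forall i, (`|y ord0 i - x ord0 i| < r)%R])%E.
Proof.
move=> r0.
(* Measurability of the box is carried through the induction because the product formula for a
   rectangle asks for it. *)
suff H m (u : m.-tuple R) : exists2 A : set (m.-tuple TR), measurable A &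
    (0 < tuple_measure mu1 m A)%E /\
    A = [set z | forall i, `|tnth z i - tnth u i| < r].
  have [A mA [A0 AE]] := H _ (tuple_of_rV x).
  rewrite pushforward_isoE /pushforward (_ : _ @^-1` _ = A)// AE.
  apply/seteqP; split => z /= zP i; have := zP i;
    by rewrite mxE tnth_mktuple.
elim: m u => [|m IH] u.
  exists setT => //; split; first by rewrite /= diracE in_setT lte_fin ltr01.
  by apply/seteqP; split => // z _ [].
case/tupleP: u => u0 u; have [A mA [A0 AE]] := IH u.
pose I : set TR := `]u0 - r, u0 + r[%classic.
have mI : measurable I by exact: measurable_itv.
exists (@tuple_uncons _ TR m @^-1` (I `*` A)).
  rewrite -[_ @^-1` _]setTI; apply: measurable_tuple_uncons => //.
  exact: measurableX.
split.
  change (0 < (mu1 \x tuple_measure mu1 m)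
    (@tuple_cons _ TR m @^-1` (@tuple_uncons _ TR m @^-1`
      (I `*` A))))%E.
  rewrite (_ : _ @^-1` _ = I `*` A); last first.
    rewrite -comp_preimage (_ : _ \o _ = id) ?preimage_id//.
    by apply: funext => z; exact: tuple_consK.
  rewrite product_measure1E//= mule_gt0//.
  rewrite lebesgue_measure_itv/= lte_fin ifT; last by lra.
  by rewrite -EFinB lte_fin; lra.
rewrite AE; apply/seteqP; split => z; rewrite /I/=.
  move=> [z0 zP] i; have [j ->|->] := unliftP ord0 i.
    have := zP j; rewrite [in tnth z _](tuple_eta z) !tnthS.
    by [].
  rewrite [in tnth z _](tuple_eta z) !tnth0; move: z0; rewrite /= in_itv/=.
  by rewrite ltr_norml => /andP[? ?]; apply/andP; split; lra.
move=> zP; split.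
  have := zP ord0; rewrite [in tnth z _](tuple_eta z) !tnth0 in_itv/=.
  by rewrite ltr_norml => /andP[? ?]; apply/andP; split; lra.
move=> i; have := zP (lift ord0 i).
by rewrite [in tnth z _](tuple_eta z) !tnthS.
Qed.

Lemma measurable_rV_box n (x : 'rV[R]_n) (r : R) :
  measurable [set y : 'rV[R]_n | forall i, `|y ord0 i - x ord0 i| < r].
Proof.
rewrite (_ : mkset _ = \bigcap_(i in [set: 'I_n])
  [set y : 'rV[R]_n | `|y ord0 i - x ord0 i| < r]); last first.
  by apply/seteqP; split => y yP i; [move=> _; exact: yP|exact: (yP i I)].
apply: fin_bigcap_measurable => // i _.
rewrite (_ : mkset _ = (fun y : 'rV[R]_n => y ord0 i) @^-1`
    `]x ord0 i - r, x ord0 i + r[); last first.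
  apply/seteqP; split => y /=; rewrite in_itv/= ltr_norml.
    by move=> /andP[? ?]; apply/andP; split; lra.
  by move=> /andP[? ?]; apply/andP; split; lra.
rewrite -[X in measurable X]setTI.
exact: (@measurable_coord R n i).
Qed.

Lemma lebesgue_rV_setT_gt0 n : (0 < lebesgue_rV R n setT)%E.
Proof.
apply: lt_le_trans (lebesgue_rV_box_gt0 (0 : 'rV[R]_n) (@ltr01 R)) _.
by apply: le_measure; rewrite ?inE//; exact: measurable_rV_box.
Qed.

End lebesgue_rV_theory.

(** * Euclidean inner product and norm *)

Section dotmul_theory.
Context {R : realType} {n : nat}.
Implicit Types (x y z : 'rV[R]_n) (a : R).

Lemma dotmulC x y : dotmul x y = dotmul y x.
Proof. by apply: eq_bigr => i _; rewrite mulrC. Qed.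

Lemma dotmulDr x y z : dotmul x (y + z) = dotmul x y + dotmul x z.
Proof. by rewrite -big_split; apply: eq_bigr => i _; rewrite mxE mulrDr. Qed.

Lemma dotmulZr a x y : dotmul x (a *: y) = a * dotmul x y.
Proof. by rewrite mulr_sumr; apply: eq_bigr => i _; rewrite mxE mulrCA. Qed.

Lemma dotmulZl a x y : dotmul (a *: x) y = a * dotmul x y.
Proof. by rewrite dotmulC dotmulZr dotmulC. Qed.

Lemma dotmulNl x y : dotmul (- x) y = - dotmul x y.
Proof. by rewrite -scaleN1r dotmulZl mulN1r. Qed.

Lemma dotmul0l y : dotmul 0 y = 0.
Proof. by rewrite -(scale0r 0) dotmulZl mul0r. Qed.

Lemma dotmul_ge0 x : 0 <= dotmul x x.
Proof. by apply: sumr_ge0 => i _; rewrite -expr2 sqr_ge0. Qed.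

Lemma enorm_ge0 x : 0 <= enorm x. Proof. exact: sqrtr_ge0. Qed.

Lemma enorm_sqr x : enorm x ^+ 2 = dotmul x x.
Proof. by rewrite sqr_sqrtr// dotmul_ge0. Qed.

Lemma enorm0 : enorm (0 : 'rV[R]_n) = 0.
Proof. by rewrite /enorm dotmul0l sqrtr0. Qed.

Lemma enormZ a x : enorm (a *: x) = `|a| * enorm x.
Proof.
rewrite /enorm dotmulZl dotmulZr mulrA -expr2 sqrtrM ?sqr_ge0//.
by rewrite sqrtr_sqr.
Qed.

Lemma enormN x : enorm (- x) = enorm x.
Proof. by rewrite -scaleN1r enormZ normrN1 mul1r. Qed.

(** Stands in for the triangle inequality: 2ab <= a^2 + b^2 in each coordinate suffices, without
    Cauchy-Schwarz. [gap_minorant] is built on this right-hand side. *)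
Lemma enormD_le x y : enorm (x + y) <= Num.sqrt (2 * enorm x ^+ 2 + 2 * enorm y ^+ 2).
Proof.
rewrite ler_sqrt !enorm_sqr; last first.
  by rewrite addr_ge0// mulr_ge0// dotmul_ge0.
rewrite !mulr_sumr -big_split/=; apply: ler_sum => i _; rewrite !mxE.
by have := sqr_ge0 (x ord0 i - y ord0 i); nra.
Qed.

Lemma enorm_le_sum x : enorm x <= \sum_i `|x ord0 i|.
Proof.
rewrite -(@ler_pXn2r _ 2)// ?nnegrE ?enorm_ge0//; last exact: sumr_ge0.
rewrite enorm_sqr expr2 mulr_suml; apply: ler_sum => i _.
rewrite -[leLHS]ger0_norm -?expr2 ?sqr_ge0// expr2 normrM ler_wpM2l//.
by rewrite (bigD1 i)//= lerDl sumr_ge0.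
Qed.

Lemma measurable_dotmul :
  measurable_fun setT (fun xy : 'rV[R]_n * 'rV[R]_n => dotmul xy.1 xy.2).
Proof.
apply: measurable_sum => i; apply: measurable_funM.
  by apply: (measurableT_comp (@measurable_coord R n i)).
by apply: (measurableT_comp (@measurable_coord R n i)).
Qed.

Lemma measurable_enorm : measurable_fun setT (@enorm R n).
Proof.
apply: (measurableT_comp (continuous_measurable_fun (@sqrt_continuous R))).
have mxx : measurable_fun setT (fun x : 'rV[R]_n => (x, x)).
  exact: measurable_fun_pair.
exact: (measurableT_comp measurable_dotmul mxx).
Qed.

Lemma measurable_funD_rV dd (T : measurableType dd) (f g : T -> 'rV[R]_n) :
  measurable_fun setT f -> measurable_fun setT g ->
  measurable_fun setT (f \+ g).
Proof.
move=> mf mg; apply: measurable_fun_rV => i.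
rewrite (_ : (fun u => _) = (fun u => f u ord0 i + g u ord0 i)); last first.
  by apply: funext => u; rewrite mxE.
apply: measurable_funD.
  exact: (measurableT_comp (@measurable_coord R n i)).
exact: (measurableT_comp (@measurable_coord R n i)).
Qed.

Lemma measurable_funZ_rV dd (T : measurableType dd) a (f : T -> 'rV[R]_n) :
  measurable_fun setT f -> measurable_fun setT (fun u => a *: f u).
Proof.
move=> mf; apply: measurable_fun_rV => i.
rewrite (_ : (fun u => _) = (fun u => a * f u ord0 i)); last first.
  by apply: funext => u; rewrite mxE.
apply: measurable_funM => //.
exact: (measurableT_comp (@measurable_coord R n i)).
Qed.

Lemma measurable_funB_rV dd (T : measurableType dd) (f g : T -> 'rV[R]_n) :
  measurable_fun setT f -> measurable_fun setT g ->
  measurable_fun setT (f \- g).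
Proof.
move=> mf mg; rewrite (_ : _ \- _ = f \+ (fun u => (-1) *: g u)).
  by apply: measurable_funD_rV => //; exact: measurable_funZ_rV.
by apply: funext => u; rewrite /= scaleN1r.
Qed.

End dotmul_theory.

(** * The stable density: integrability, positivity, monotonicity at the origin, scaling *)

Section stable_density_basics.
Context {R : realType} {d : nat} (alpha : R).
Local Notation mu := (lebesgue_rV R d).
Local Notation p := (@stable_density R d alpha).
Implicit Types (t s : R) (x y z xi : 'rV[R]_d).

(** The characteristic function of the process at time t. *)
Definition stable_symbol t xi : R := expR (- (t * enorm xi `^ alpha)).
Local Notation w := stable_symbol.

Lemma stable_densityE t x : p t x =
  ((2 * pi) ^+ d)^-1 * \int[mu]_xi (cos (dotmul x xi) * w t xi).
Proof.
rewrite /stable_density /Cintegral /=; congr (_ * _).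
by apply: eq_Rintegral => xi _; rewrite /= cosN mulr0 subr0.
Qed.

Lemma measurable_stable_symbol2 :
  measurable_fun setT (fun q : R * 'rV[R]_d => w q.1 q.2).
Proof.
apply: measurableT_comp; first exact: measurable_expR.
apply: measurableT_comp; first exact: oppr_measurable.
apply: measurable_funM; first exact: measurable_fst.
apply: (measurableT_comp (measurable_powR _)).
by apply: (measurableT_comp measurable_enorm).
Qed.

Lemma measurable_stable_symbol t : measurable_fun setT (w t).
Proof. exact: (measurableT_comp measurable_stable_symbol2 (measurable_pair1 t)). Qed.

Lemma measurable_cos_dotmul x :
  measurable_fun setT (fun xi => cos (dotmul x xi)).
Proof.
apply: measurableT_comp.
  exact: (continuous_measurable_fun (@continuous_cos R)).
exact: (measurableT_comp measurable_dotmul (measurable_pair1 x)).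
Qed.

Lemma stable_symbol_ge0 t xi : 0 <= w t xi. Proof. exact: expR_ge0. Qed.

(** A divergent integral has the value +oo, which [fine] sends to 0, so [p t 0] would vanish. This
    turns nonvanishing of the density into integrability. *)
Lemma stable_symbol0_neq0_integrable t : p t 0 != 0 ->
  mu.-integrable setT (EFin \o w t).
Proof.
move=> p0; apply/integrableP; split.
  by apply/measurable_EFinP; exact: measurable_stable_symbol.
apply: contraNT p0; rewrite -leNgt leye_eq => /eqP ioo.
rewrite stable_densityE /Rintegral.
under eq_integral do rewrite dotmul0l cos0 mul1r.
rewrite (_ : integral _ _ _ = +oo%E) ?mulr0// -ioo.
by apply: eq_integral => xi _; rewrite /= ger0_norm ?stable_symbol_ge0.
Qed.

Lemma measurable_stable_density :
  measurable_fun setT (fun q : R * 'rV[R]_d => p q.1 q.2).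
Proof.
rewrite (_ : (fun q => _) = (fun q : R * 'rV[R]_d => ((2 * pi) ^+ d)^-1 *
    \int[mu]_xi (cos (dotmul q.2 xi) * w q.1 xi))); last first.
  by apply: funext => q; rewrite stable_densityE.
apply: measurable_funM => //.
pose f (r : (R * 'rV[R]_d) * 'rV[R]_d) : R :=
  cos (dotmul r.1.2 r.2) * w r.1.1 r.2.
suff mf : measurable_fun setT f by exact: (measurable_fun_Rintegral mu mf).
apply: measurable_funM.
  apply: (measurableT_comp (continuous_measurable_fun (@continuous_cos R))).
  have m1 : measurable_fun setT
    (fun r : (R * 'rV[R]_d) * 'rV[R]_d => (r.1.2, r.2)).
    by apply: measurable_fun_pair => //; exact: (measurableT_comp measurable_snd).
  exact: (measurableT_comp measurable_dotmul m1).
have m1 : measurable_fun setT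
  (fun r : (R * 'rV[R]_d) * 'rV[R]_d => (r.1.1, r.2)).
  by apply: measurable_fun_pair => //; exact: (measurableT_comp measurable_fst).
exact: (measurableT_comp measurable_stable_symbol2 m1).
Qed.

Lemma measurable_stable_density1 t : measurable_fun setT (p t).
Proof. exact: (measurableT_comp measurable_stable_density (measurable_pair1 t)). Qed.

Lemma stable_densityN t x : p t (- x) = p t x.
Proof.
rewrite !stable_densityE; congr (_ * _); apply: eq_Rintegral => xi _.
by rewrite dotmulNl cosN.
Qed.

Hypothesis density_neq0 : forall t x, 0 < t -> p t x != 0.

Lemma integrable_stable_symbol t : 0 < t -> mu.-integrable setT (EFin \o w t).
Proof. by move=> t0; apply/stable_symbol0_neq0_integrable/density_neq0. Qed.

Lemma integrable_cos_stable_symbol t x : 0 < t ->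
  mu.-integrable setT (EFin \o (fun xi => cos (dotmul x xi) * w t xi)).
Proof.
move=> t0; apply: (le_integrable _ _ _ (integrable_stable_symbol t0)) => //.
  apply/measurable_EFinP; apply: measurable_funM; first exact: measurable_cos_dotmul.
  exact: measurable_stable_symbol.
move=> xi _; rewrite lee_fin normrM ler_piMl//.
by rewrite ler_norml cos_geN1 cos_le1.
Qed.

Let c0_gt0 : 0 < ((2 * pi) ^+ d)^-1 :> R.
Proof. by rewrite invr_gt0 exprn_gt0// mulr_gt0// pi_gt0. Qed.

Lemma stable_density0E t : p t 0 = ((2 * pi) ^+ d)^-1 * \int[mu]_xi w t xi.
Proof.
rewrite stable_densityE; congr (_ * _); apply: eq_Rintegral => xi _.
by rewrite dotmul0l cos0 mul1r.
Qed.

Lemma stable_density_le0 t x : 0 < t -> p t x <= p t 0.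
Proof.
move=> t0; rewrite stable_densityE stable_density0E ler_wpM2l ?(ltW c0_gt0)//.
apply: le_Rintegral => //; [exact: integrable_cos_stable_symbol|
  exact: integrable_stable_symbol|].
by move=> xi _; rewrite ler_piMl ?stable_symbol_ge0 ?cos_le1.
Qed.

Lemma stable_density0_gt0 t : 0 < t -> 0 < p t 0.
Proof.
move=> t0; rewrite lt_neqAle eq_sym density_neq0//= stable_density0E.
by rewrite mulr_ge0 ?(ltW c0_gt0)// Rintegral_ge0// => xi _; exact: stable_symbol_ge0.
Qed.

Lemma le_stable_density0 s t : 0 < s -> s <= t -> p t 0 <= p s 0.
Proof.
move=> s0 st; rewrite !stable_density0E ler_wpM2l ?(ltW c0_gt0)//.
apply: le_Rintegral => //; [apply: integrable_stable_symbol|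
  exact: integrable_stable_symbol|].
  exact: lt_le_trans st.
by move=> xi _; rewrite ler_expR lerN2 ler_wpM2r ?powR_ge0.
Qed.

(** Dominated convergence with the symbol as majorant. Rays are enough for the two uses: the
    intermediate value theorem between 0 and x, and the limit of p_1(r x) as r tends to 0. *)
Lemma continuous_stable_density_ray t x : 0 < t ->
  continuous (fun r : R => p t (r *: x) : R).
Proof.
move=> t0 r.
rewrite (_ : (fun r => _) = (fun r => ((2 * pi) ^+ d)^-1 *
  \int[mu]_xi (cos (r * dotmul x xi) * w t xi))); last first.
  apply: funext => u; rewrite stable_densityE; congr (_ * _).
  by apply: eq_Rintegral => xi _; rewrite dotmulZl.
apply: cvgM; first exact: cvg_cst.
have rI : r \in (`]r - 1, r + 1[%classic : set R).
  by rewrite inE/= in_itv/=; apply/andP; split; lra.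
apply: (@continuity_under_integral R _ _ mu
  (fun u xi => cos (u * dotmul x xi) * w t xi) setT _ (r - 1) (r + 1)
  _ _ (w t)) => //.
- move=> u _.
  rewrite (_ : _ \o _ = EFin \o (fun xi => cos (dotmul (u *: x) xi) * w t xi)).
    exact: integrable_cos_stable_symbol.
  by apply: funext => xi /=; rewrite dotmulZl.
- apply: aeW => xi _ u _.
  apply: cvgM; last exact: cvg_cst.
  apply: continuous_comp; last exact: continuous_cos.
  by apply: cvgM; [exact: cvg_id|exact: cvg_cst].
- exact: integrable_stable_symbol.
- move=> u _; apply: aeW => xi _.
  rewrite normrM (ger0_norm (stable_symbol_ge0 _ _)).
  by rewrite ler_piMl ?stable_symbol_ge0// ler_norml cos_geN1 cos_le1.
Qed.

(** The density is positive at the origin and continuous on the segment from 0 to x, so a value <= 0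
    at x would force a zero on the way. *)
Lemma stable_density_gt0 t x : 0 < t -> 0 < p t x.
Proof.
move=> t0; rewrite ltNge; apply/negP => px0.
have [] := @IVT R (fun r => p t (r *: x)) 0 1 0 ler01.
- by apply: continuous_subspaceT; exact: continuous_stable_density_ray.
- rewrite scale0r scale1r ge_min le_max px0 orbT/=.
  by rewrite (ltW (stable_density0_gt0 t0)).
- by move=> r _ /eqP; apply/negP/density_neq0.
Qed.

(** Substitution xi -> a xi in the Fourier integral. *)
Lemma stable_density_scale t a x : 0 < t -> 0 < a ->
  p (a `^ alpha * t) (a *: x) = a ^- d * p t x.
Proof.
move=> t0 a0; rewrite !stable_densityE mulrCA; congr (_ * _).
rewrite -(Rintegral_rV_affine 0 a0 (integrable_cos_stable_symbol x t0)).
apply: eq_Rintegral => xi _ /=.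
rewrite [a *: xi + 0]addr0 dotmulZl dotmulZr.
rewrite /stable_symbol enormZ (ger0_norm (ltW a0)) powRM ?enorm_ge0 ?(ltW a0)//.
by rewrite (mulrCA t) (mulrA _ t).
Qed.

End stable_density_basics.

(** * A uniform drop of the density outside the unit ball *)

Section stable_density_gap.
Context {R : realType} {d : nat} (alpha : R).
Hypothesis alpha_gt0 : 0 < alpha.
Local Notation mu := (lebesgue_rV R d).
Local Notation p := (@stable_density R d alpha).
Local Notation w := (@stable_symbol R d alpha).
Implicit Types (t s : R) (x y z xi : 'rV[R]_d).
Hypothesis density_neq0 : forall t x, 0 < t -> p t x != 0.

(** A zero integral would make f vanish almost everywhere, hence make the whole space a null set. *)
Lemma Rintegral_rV_gt0 (f : 'rV[R]_d -> R) : mu.-integrable setT (EFin \o f) ->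
  (forall x, 0 < f x) -> 0 < \int[mu]_x f x.
Proof.
move=> intf f0; have If0 : 0 <= \int[mu]_x f x.
  by apply: Rintegral_ge0 => x _; exact: ltW.
rewrite lt_neqAle If0 andbT eq_sym; apply/negP => /eqP I0.
have : ae_eq mu setT (EFin \o f) (cst 0%E).
  apply/(ae_eq_integral_abs _ measurableT (measurable_int _ intf)).
  rewrite -[RHS]/(0%:E) -I0 /Rintegral fineK ?(integrable_fin_num _ intf)//.
  by apply: eq_integral => x _; rewrite /= ger0_norm// ltW.
move=> [N [mN N0 NP]].
suff NT : N = setT by have := @lebesgue_rV_setT_gt0 R d; rewrite -NT N0 ltxx.
apply/seteqP; split=> // x _; apply: NP => /(_ I) [] /eqP.
by rewrite gt_eqF.
Qed.

(** Lies below the symbol of time 1 at [xi] and at all translates of [xi] by vectors of norm at most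
    pi; it does not involve the point x at which the drop is measured. *)
Definition gap_minorant xi : R :=
  expR (- (Num.sqrt (2 * enorm xi ^+ 2 + 2 * pi ^+ 2) `^ alpha)).

(** A lower bound for 1 - p_1(x)/p_1(0) on |x| >= 1. It is a closed expression in alpha and d, so it
    can enter a constant fixed before any process is given. *)
Definition density_gap : R :=
  ((2 * pi) ^+ d)^-1 * (\int[mu]_xi gap_minorant xi) / p 1 0.

Lemma gap_minorant_le xi y : enorm y <= pi -> gap_minorant xi <= w 1 (xi + y).
Proof.
move=> ypi; rewrite ler_expR lerN2 mul1r ge0_ler_powR ?nnegrE ?sqrtr_ge0 ?(ltW alpha_gt0)//.
apply: (le_trans (enormD_le _ _)).
rewrite ler_wsqrtr// lerD2l ler_wpM2l// lerXn2r ?nnegrE ?enorm_ge0 ?pi_ge0//.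
Qed.

Lemma gap_minorant_le0 xi : gap_minorant xi <= w 1 xi.
Proof.
by have := @gap_minorant_le xi 0; rewrite addr0 enorm0 pi_ge0; apply.
Qed.

Lemma integrable_gap_minorant : mu.-integrable setT (EFin \o gap_minorant).
Proof.
apply: (le_integrable _ _ _ (integrable_stable_symbol density_neq0 ltr01)) => //.
  apply/measurable_EFinP; apply: measurableT_comp; first exact: measurable_expR.
  apply: measurableT_comp; first exact: oppr_measurable.
  apply: (measurableT_comp (measurable_powR _)).
  apply: (measurableT_comp (continuous_measurable_fun (@sqrt_continuous R))).
  apply: measurable_funD => //; apply: measurable_funM => //.
  apply: measurable_funX; exact: measurable_enorm.
move=> xi _; rewrite lee_fin ger0_norm ?expR_ge0// ger0_norm ?expR_ge0//.
exact: gap_minorant_le0.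
Qed.

Lemma density_gap_gt0 : 0 < density_gap.
Proof.
rewrite /density_gap divr_gt0 ?(stable_density0_gt0 density_neq0)// mulr_gt0//.
  by rewrite invr_gt0 exprn_gt0// mulr_gt0// pi_gt0.
by apply: Rintegral_rV_gt0; [exact: integrable_gap_minorant|move=> x; exact: expR_gt0].
Qed.

(* Translating the frequency by v = pi x / |x|^2 turns 1 - cos into 1 + cos,
   and (1 - cos) w(xi) + (1 + cos) w(xi + v) >= 2 min(w(xi), w(xi + v)). *)
Lemma density_gap_le x : 1 <= enorm x -> density_gap <= 1 - p 1 x / p 1 0.
Proof.
move=> x1; have p0 := stable_density0_gt0 density_neq0 (@ltr01 R).
have -> : 1 - p 1 x / p 1 0 = (p 1 0 - p 1 x) / p 1 0.
  by rewrite mulrBl divff// gt_eqF.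
rewrite /density_gap ler_pM2r ?invr_gt0//.
have iw := integrable_stable_symbol density_neq0 (@ltr01 R).
have icw := integrable_cos_stable_symbol density_neq0 x (@ltr01 R).
rewrite (stable_density0E alpha) (stable_densityE alpha) -mulrBr -RintegralB//.
rewrite ler_wpM2l//; first by rewrite invr_ge0 exprn_ge0// mulr_ge0// pi_ge0.
pose f xi := w 1 xi - cos (dotmul x xi) * w 1 xi.
have intf : mu.-integrable setT (EFin \o f).
  rewrite (_ : _ \o _ = (EFin \o w 1) \-
      (EFin \o (fun xi => (cos (dotmul x xi) * w 1 xi)%R)))%E//.
  exact: integrableB.
pose v := (pi / enorm x ^+ 2) *: x.
have x0 : enorm x != 0 by rewrite gt_eqF// (lt_le_trans ltr01).
have xv : dotmul x v = pi by rewrite dotmulZr -enorm_sqr divfK// expf_neq0.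
have vpi : enorm v <= pi.
  rewrite enormZ ger0_norm; last by rewrite divr_ge0 ?pi_ge0// sqr_ge0.
  rewrite expr2 invfM -!mulrA mulVf// mulr1 ler_piMr ?pi_ge0// invf_le1//.
  exact: lt_le_trans x1.
have E := Rintegral_rV_affine v ltr01 intf.
rewrite expr1n invr1 mul1r in E.
have intfv : mu.-integrable setT (EFin \o (fun xi => f (1 *: xi + v))).
  exact: integrable_rV_affine.
rewrite -[leRHS]/(\int[mu]_xi f xi) -(ler_pM2l (@ltr0Sn R 1)).
rewrite [leRHS](_ : _ = \int[mu]_xi (f xi + f (1 *: xi + v))); last first.
  by rewrite mulr_natl mulr2n; apply/esym/(etrans (RintegralD _ intf intfv));
    [by []|exact: (congr1 (+%R _) E)].
rewrite -(RintegralZl 2 measurableT integrable_gap_minorant).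
apply: (le_Rintegral measurableT
  (integrableZl measurableT 2 integrable_gap_minorant)
  (integrableD measurableT intf intfv)) => xi _.
rewrite /f scale1r dotmulDr xv cosDpi.
have := cos_geN1 (dotmul x xi); have := cos_le1 (dotmul x xi).
have := gap_minorant_le0 xi; have := gap_minorant_le xi vpi.
move: (cos _) (gap_minorant _) (w _ _) (w _ _) => c m w0 w1 mw1 mw0 c1 cN1.
have := @mulr_ge0 _ (1 - c) (w0 - m); have := @mulr_ge0 _ (1 + c) (w1 - m).
rewrite !subr_ge0 mw1 mw0 c1 -lerBlDl sub0r cN1 => /(_ isT isT) + /(_ isT isT).
by clear -c; lra.
Qed.

End stable_density_gap.

(** * Mass, tails and moments of a self-similar convolution semigroup *)

Section self_similar_kernel.
Context {R : realType} {d : nat} (alpha : R).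
Hypothesis alpha_gt0 : 0 < alpha.
Local Notation mu := (lebesgue_rV R d).
Implicit Types (t s : R) (x y z : 'rV[R]_d).
Variables (p : R -> 'rV[R]_d -> R) (gap : R).
Hypothesis mp : forall t, measurable_fun setT (p t).
Hypothesis p_gt0 : forall t x, 0 < t -> 0 < p t x.
Hypothesis pN : forall t x, p t (- x) = p t x.
Hypothesis p_le0 : forall t x, 0 < t -> p t x <= p t 0.
Hypothesis p0_le : forall s t, 0 < s -> s <= t -> p t 0 <= p s 0.
Hypothesis p_scale : forall t a x, 0 < t -> 0 < a ->
  p (a `^ alpha * t) (a *: x) = a ^- d * p t x.
Hypothesis p_ray : forall t x, 0 < t -> continuous (fun r : R => p t (r *: x) : R).
Hypothesis gap_gt0 : 0 < gap.
Hypothesis gap_le : forall x, 1 <= enorm x -> gap <= 1 - p 1 x / p 1 0.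
Hypothesis chapman_kolmogorov : forall s r y, 0 < s -> 0 < r ->
  (\int[mu]_z (p s z * p r (y - z))%:E = (p (s + r) y)%:E)%E.

Let p_ge0 t x : 0 < t -> 0 <= p t x. Proof. by move=> t0; exact/ltW/p_gt0. Qed.
Let p_neq0 t x : 0 < t -> p t x != 0. Proof. by move=> t0; rewrite gt_eqF// p_gt0. Qed.

Lemma kernel_ratio t x : 0 < t ->
  p t x / p t 0 = p 1 (t `^ (- alpha^-1) *: x) / p 1 0.
Proof.
move=> t0; set a := t `^ (- alpha^-1).
have a0 : 0 < a by exact: powR_gt0.
have at1 : a `^ alpha * t = 1.
  by rewrite -powRrM mulNr mulVf ?gt_eqF// powR_inv1 ?(ltW t0)// mulVf ?gt_eqF.
have E y : p 1 (a *: y) = a ^- d * p t y.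
  by rewrite -(p_scale y t0 a0) at1.
have ad0 : a ^- d != 0 by rewrite invr_eq0 expf_neq0// gt_eqF.
have -> : p 1 0 = a ^- d * p t 0 by rewrite -E scaler0.
by rewrite E -mulf_div (divff ad0) [RHS]mul1r.
Qed.

Lemma kernel0_scale t : 0 < t -> p t 0 = t `^ (- (d%:R / alpha)) * p 1 0.
Proof.
move=> t0; have a0 : 0 < t `^ alpha^-1 by exact: powR_gt0.
have := p_scale 0 ltr01 a0.
rewrite scaler0 mulr1 -powRrM mulVf ?gt_eqF// powRr1 ?(ltW t0)// => ->.
by rewrite -powR_mulrn ?(ltW a0)// -powRrM -powRN (mulrC alpha^-1).
Qed.

(** Chapman-Kolmogorov at the origin, since p_t(z) = p_t(0 - z). *)
Lemma integral_kernel_ratio s t : 0 < s -> 0 < t ->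
  (\int[mu]_z (p s z * (p t z / p t 0))%:E = (p (s + t) 0 / p t 0)%:E)%E.
Proof.
move=> s0 t0; rewrite (_ : integral _ _ _ = (p t 0)^-1%:E *
    \int[mu]_z (p s z * p t (0 - z))%:E)%E.
  by rewrite chapman_kolmogorov// -EFinM mulrC.
rewrite -ge0_integralZl//; last 3 first.
- apply/measurable_EFinP; apply: measurable_funM.
    exact: mp.
  under eq_fun do rewrite sub0r pN.
  exact: mp.
- by move=> z _; rewrite lee_fin mulr_ge0 ?p_ge0.
- by rewrite lee_fin invr_ge0 p_ge0.
apply: eq_integral => z _; rewrite -EFinM sub0r pN.
by rewrite [in RHS]mulrC mulrA.
Qed.

(** Fourier inversion is avoided: p_n(z)/p_n(0) tends to 1 by scaling, the integral of p_s
    p_n/p_n(0) equals p_(s+n)(0)/p_n(0) <= 1, and Fatou's lemma passes to the limit. *)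
Lemma integral_kernel_le1 s : 0 < s ->
  (\int[mu]_z (p s z)%:E <= 1)%E.
Proof.
move=> s0.
pose f (n : nat) z : \bar R := (p s z * (p n.+1%:R z / p n.+1%:R 0))%:E.
have mf n : measurable_fun setT (f n).
  apply/measurable_EFinP; apply: measurable_funM.
    exact: mp.
  by apply: measurable_funM => //; exact: mp.
have f0 n z : (0 <= f n z)%E by rewrite lee_fin mulr_ge0 ?divr_ge0 ?p_ge0.
have If n : (\int[mu]_z f n z <= 1)%E.
  rewrite integral_kernel_ratio// lee_fin ler_pdivrMr ?p_gt0// mul1r.
  by apply: p0_le => //; rewrite lerDr ltW.
have fp z : f ^~ z @ \oo --> (p s z)%:E.
  rewrite -[p s z]mulr1; apply/cvg_EFin; first by apply: nearW.
  apply: cvgM; first exact: cvg_cst.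
  rewrite (_ : (fun n : nat => p n.+1%:R z / p n.+1%:R 0) =
    (fun n : nat => p 1 (n.+1%:R `^ (- alpha^-1) *: z) / p 1 0)); last first.
    by apply: funext => n; rewrite kernel_ratio.
  rewrite -[X in _ --> X](divff (p_neq0 0 (@ltr01 R))).
  apply: cvgM; last exact: cvg_cst.
  rewrite -[X in _ --> p 1 X](scale0r z).
  apply: (@cvg_comp _ _ _ (fun n : nat => n.+1%:R `^ (- alpha^-1) : R)
    (fun r : R => p 1 (r *: z)) _ (nbhs (0 : R))); last first.
    exact: (@p_ray 1 z ltr01 0).
  rewrite (_ : (fun n : nat => _) = (fun n : nat => (n.+1%:R^-1) `^ alpha^-1));
    last first.
    by apply: funext => n; rewrite -[n.+1%:R^-1]powR_inv1// -powRrM mulN1r.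
  have ia0 : 0 < alpha^-1 by rewrite invr_gt0.
  apply: (@cvg_comp _ _ _ (fun n : nat => n.+1%:R^-1 : R)
    (fun r : R => r `^ alpha^-1) _ (0^'+ : set_system R)); last exact: powR_cvg0.
  (* [powR_cvg0] is one-sided, so the convergence of 1/(n+1) to 0 is refined by its positivity. *)
  move=> A A0.
  have H : \forall n \near \oo, 0 < @harmonic R n -> A (@harmonic R n).
    exact: (@cvg_harmonic R _ A0).
  by apply: (@filterS _ \oo _ _ _ _ H) => n; apply; rewrite /= invr_gt0.
have := fatou mu measurableT mf (fun n z _ => f0 n z).
under eq_integral => z _.
  rewrite (_ : limn_einf _ = (p s z)%:E); last first.
    by rewrite is_cvg_limn_einfE; [exact/cvg_lim|apply/cvg_ex; exists (p s z)%:E].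
  over.
move=> /le_trans; apply.
rewrite limn_einf_lim; apply: lime_le.
  exact: is_cvg_einfs.
apply: nearW => n; apply: le_trans (If n).
apply: ereal_inf_lbound; exists n => //=.
Qed.

(** By self-similarity the ratio is (1 + s/t)^(-d/alpha); the bound follows from e^y >= 1 + y and
    ln(1 + y) <= y. *)
Lemma kernel_ratio_ge s t : 0 < s -> 0 < t ->
  1 - p (s + t) 0 / p t 0 <= d%:R / alpha * (s / t).
Proof.
move=> s0 t0; have st0 : 0 < s + t by rewrite addr_gt0.
rewrite (kernel0_scale st0) (kernel0_scale t0).
rewrite -(mulf_div _ _ (p 1 0) (p 1 0)) divff ?p_neq0// mulr1.
set e := d%:R / alpha; have e0 : 0 <= e by rewrite divr_ge0// ltW.
rewrite /powR !gt_eqF// -expRN -expRD !mulNr opprK.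
have L : ln (s + t) - ln t <= s / t.
  rewrite -ln_div ?posrE// mulrDl divff ?gt_eqF// addrC.
  by apply: le_ln1Dx; rewrite (lt_le_trans (ltrN10 _))// divr_ge0// ltW.
have := expR_ge1Dx (- (e * ln (s + t)) + e * ln t).
have := ler_wpM2l e0 L; rewrite mulrBr.
move: (e * _) (e * _) (e * _) (expR _) => a b c f; lra.
Qed.

Lemma measurable_enorm_ge (rho : R) :
  measurable [set z : 'rV[R]_d | rho <= enorm z].
Proof.
rewrite (_ : mkset _ = (@enorm R d) @^-1` `[rho, +oo[).
  rewrite -[X in measurable X]setTI.
  exact: measurable_enorm.
by apply/seteqP; split => z; rewrite /= in_itv/= andbT.
Qed.

Lemma kernel_tail s rho : 0 < s -> 0 < rho ->
  (\int[mu]_z (\1_[set z | rho <= enorm z] z * p s z)%:E <=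
   (d%:R / alpha / gap *
     (s * rho `^ (- alpha)))%:E)%E.
Proof.
move=> s0 rho0; set D := [set z | _].
have mD : measurable D by exact: measurable_enorm_ge.
pose t := rho `^ alpha; have t0 : 0 < t by exact: powR_gt0.
have mr : measurable_fun setT (fun z => p t z / p t 0).
  exact: measurable_funM.
have r1 z : p t z / p t 0 <= 1.
  by rewrite ler_pdivrMr ?p_gt0// mul1r p_le0.
(* Moving the integral of the ratio to the left reduces this to the bound on the mass of p_s. *)
have A1 : (\int[mu]_z ((1 - p t z / p t 0) * p s z)%:E <=
    (1 - p (s + t) 0 / p t 0)%:E)%E.
  rewrite EFinB leeBrDr// -integral_kernel_ratio// -ge0_integralD//; last 4 first.
  - by move=> z _; rewrite lee_fin mulr_ge0 ?subr_ge0 ?p_ge0.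
  - by apply/measurable_EFinP; apply: measurable_funM => //; exact: measurable_funB.
  - by move=> z _; rewrite lee_fin mulr_ge0 ?divr_ge0 ?p_ge0.
  - by apply/measurable_EFinP; exact: measurable_funM.
  apply: le_trans (integral_kernel_le1 s0).
  by under eq_integral do rewrite -EFinD mulrBl mul1r [X in _ - X]mulrC subrK.
have A2 : (gap%:E * \int[mu]_z (\1_D z * p s z)%:E <=
    \int[mu]_z ((1 - p t z / p t 0) * p s z)%:E)%E.
  rewrite -ge0_integralZl//; last 3 first.
  - by apply/measurable_EFinP; exact: measurable_funM.
  - by move=> z _; rewrite lee_fin mulr_ge0 ?p_ge0.
  - by rewrite lee_fin ltW.
  apply: ge0_le_integral => //.
  - by move=> z _; rewrite -EFinM lee_fin !mulr_ge0 ?p_ge0// ltW.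
  - by apply/measurable_EFinP; apply: measurable_funM => //; exact: measurable_funM.
  - by apply/measurable_EFinP; apply: measurable_funM => //; exact: measurable_funB.
  move=> z _; rewrite -EFinM lee_fin mulrA ler_wpM2r ?p_ge0// indicE.
  have [|_] := boolP (z \in D); last by rewrite mulr0 subr_ge0.
  (* Since t = rho^alpha, the ratio at time t and point z is the ratio at time 1 and point z/rho,
     whose norm is at least 1. *)
  rewrite inE /D/= mulr1 => zrho; rewrite kernel_ratio//.
  apply: gap_le => //; rewrite enormZ ger0_norm ?powR_ge0//.
  by rewrite -powRrM mulrN divff ?gt_eqF// powR_inv1 ?(ltW rho0)// mulrC ler_pdivlMr// mul1r.
have := le_trans A2 A1 => /le_trans /(_ (_ : _ <= (d%:R / alpha * (s / t))%:E)%E).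
rewrite lee_fin => /(_ (kernel_ratio_ge s0 t0)).
rewrite muleC -lee_pdivlMr// => /le_trans; apply.
rewrite -EFinM lee_fin powRN -/t; clear.
by rewrite mulrAC.
Qed.

Variable gamma : R.
Hypotheses (gamma_gt0 : 0 < gamma) (gamma_lt : gamma < alpha).

(** Doubling the radius multiplies |z|^gamma by 2^gamma and the tail bound by 2^(-alpha); the dyadic
    series converges because gamma < alpha. *)
Let ratio : R := 2 `^ (gamma - alpha).

Let ratio_gt0 : 0 < ratio. Proof. exact: powR_gt0. Qed.

Let ratio_lt1 : ratio < 1.
Proof.
rewrite /ratio /powR gt_eqF// -[ltRHS]expR0 ltr_expR.
rewrite nmulr_rlt0 ?subr_lt0//. by rewrite ln_gt0// ltr1n.
Qed.

(** The term 1 comes from the ball |z| < s^(1/alpha), the fraction from the sum of the dyadic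
    series; 2^gamma appears because |z|^gamma is bounded by the outer radius of each shell. *)
Definition kernel_moment_const : R :=
  1 + d%:R / alpha / gap * 2 `^ gamma / (1 - ratio).

Lemma kernel_moment_const_gt0 : 0 < kernel_moment_const.
Proof.
rewrite /kernel_moment_const ltr_wpDr// divr_ge0 ?subr_ge0 ?(ltW ratio_lt1)//.
by rewrite mulr_ge0 ?powR_ge0// !divr_ge0// ltW.
Qed.

Lemma geometric_nneseries_le (a : R) : 0 <= a ->
  (\sum_(0 <= k <oo) (a * ratio ^+ k)%:E <= (a / (1 - ratio))%:E)%E.
Proof.
move=> a0; apply: lime_le.
  apply: is_cvg_nneseries => k _ _.
  by rewrite lee_fin mulr_ge0// exprn_ge0// ltW.
apply: nearW => n; rewrite sumEFin lee_fin.
have -> : \sum_(0 <= k < n) a * ratio ^+ k = series (geometric a ratio) n by [].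
rewrite geometric_seriesE ?lt_eqF//= ler_wpM2r ?invr_ge0 ?subr_ge0 ?(ltW ratio_lt1)//.
by rewrite ler_piMr// gerBl exprn_ge0// ltW.
Qed.

(** If |z| >= sigma, some shell 2^k sigma <= |z| < 2^(k+1) sigma contains z, and the k-th term alone
    dominates. The indicators are those of complements of balls, not of shells, to match
    [kernel_tail]. *)
Lemma powR_enorm_le_nneseries (sigma : R) z : 0 < sigma ->
  ((enorm z `^ gamma)%:E <= (sigma `^ gamma)%:E +
   \sum_(0 <= k <oo) ((2 ^+ k.+1 * sigma) `^ gamma *
     \1_[set z | (2 ^+ k * sigma <= enorm z)%R] z)%:E)%E.
Proof.
move=> sigma0.
pose u k : \bar R := ((2 ^+ k.+1 * sigma) `^ gamma *
  \1_[set z : 'rV[R]_d | (2 ^+ k * sigma <= enorm z)%R] z)%:E.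
have u0 k : (0 <= u k)%E by rewrite lee_fin mulr_ge0 ?powR_ge0.
have [zs|sz] := ltP (enorm z) sigma.
  apply: (@le_trans _ _ (sigma `^ gamma)%:E); last first.
    by apply: leeDl; apply: nneseries_ge0 => k _ _; exact: u0.
  by rewrite lee_fin ge0_ler_powR ?nnegrE ?enorm_ge0 ?(ltW gamma_gt0) ?ltW.
have exP : exists n, enorm z < 2 ^+ n * sigma.
  exists (Num.truncn (enorm z / sigma)).+1.
  rewrite -ltr_pdivrMr//; apply: lt_le_trans (truncnS_gt _) _.
  by rewrite -natrX ler_nat ltnW// ltn_expl.
case: (ex_minnP exP) => -[|k]; first by rewrite expr0 mul1r ltNge sz.
move=> zk kmin.
have kz : 2 ^+ k * sigma <= enorm z.
  by rewrite leNgt; apply/negP => /kmin; rewrite ltnn.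
apply: (@le_trans _ _ (u k)).
  rewrite lee_fin indicE mem_set// mulr1 ge0_ler_powR ?nnegrE ?enorm_ge0 ?(ltW gamma_gt0)//.
    by rewrite mulr_ge0// ?exprn_ge0// ltW.
  exact: ltW.
apply: (@le_trans _ _ (\sum_(0 <= k <oo) u k)%E); last first.
  by apply: leeDr; rewrite lee_fin powR_ge0.
apply: le_trans (nneseries_lim_ge k.+1 _) => //.
by rewrite big_nat_recr//= leeDr// sume_ge0.
Qed.

Lemma kernel_moment s : 0 < s ->
  (\int[mu]_z (enorm z `^ gamma * p s z)%:E <=
   (kernel_moment_const * s `^ (gamma / alpha))%:E)%E.
Proof.
(* The natural length at time s: s sigma^(-alpha) = 1, so the tail bound beyond 2^k sigma is a
   multiple of 2^(-k alpha), free of s. *)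
move=> s0; pose sigma := s `^ alpha^-1.
have sigma0 : 0 < sigma by exact: powR_gt0.
have sa : sigma `^ alpha = s by rewrite -powRrM mulVf ?gt_eqF// powRr1// ltW.
have sg : s `^ (gamma / alpha) = sigma `^ gamma by rewrite mulrC powRrM.
pose c k := (2 ^+ k.+1 * sigma) `^ gamma.
pose u (k : nat) z : \bar R :=
  ((c k)%:E * (\1_[set z : 'rV[R]_d | (2 ^+ k * sigma <= enorm z)%R] z * p s z)%:E)%E.
have u0 k z : (0 <= u k z)%E.
  by rewrite mule_ge0// lee_fin ?powR_ge0// mulr_ge0// p_ge0.
have mup k : measurable_fun setT (fun z =>
    (\1_[set z | (2 ^+ k * sigma <= enorm z)%R] z * p s z)%:E).
  apply/measurable_EFinP; apply: measurable_funM => //.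
  by apply: measurable_indic; exact: measurable_enorm_ge.
have mu_ k : measurable_fun setT (u k) by exact: measurable_funeM.
have msp : measurable_fun setT (fun z => (sigma `^ gamma)%:E * (p s z)%:E)%E.
  by apply: measurable_funeM; apply/measurable_EFinP.
apply: (@le_trans _ _ (\int[mu]_z ((sigma `^ gamma)%:E * (p s z)%:E +
    \sum_(0 <= k <oo) u k z))%E).
  apply: ge0_le_integral => //.
  - by move=> z _; rewrite lee_fin mulr_ge0 ?powR_ge0// p_ge0.
  - apply/measurable_EFinP; apply: measurable_funM => //.
    exact: (measurableT_comp (measurable_powR _) measurable_enorm).
  - apply: emeasurable_funD => //.
    apply: ge0_emeasurable_sum => //.
  move=> z _; rewrite EFinM.
  have pz0 : (0 <= (p s z)%:E)%E by rewrite lee_fin p_ge0.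
  apply: le_trans (lee_wpmul2r pz0 (powR_enorm_le_nneseries z sigma0)) _.
  rewrite ge0_muleDl ?lee_fin ?powR_ge0 ?nneseries_ge0//; last first.
    by move=> k _ _; rewrite lee_fin mulr_ge0 ?powR_ge0.
  rewrite [X in (_ + X <= _)%E]muleC -nneseriesZl; last first.
    by move=> k _; rewrite lee_fin mulr_ge0 ?powR_ge0.
  rewrite leeD2l// le_eqVlt; apply/orP; left; apply/eqP.
  by apply: eq_eseriesr => k _; rewrite /u -!EFinM; congr EFin; rewrite mulrC mulrA.
rewrite ge0_integralD//; last 3 first.
- by move=> z _; rewrite mule_ge0// lee_fin ?powR_ge0// p_ge0.
- by move=> z _; exact: nneseries_ge0.
- by apply: ge0_emeasurable_sum.
rewrite ge0_integralZl//; last 3 first.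
- by apply/measurable_EFinP.
- by move=> z _; rewrite lee_fin p_ge0.
- by rewrite lee_fin powR_ge0.
rewrite integral_nneseries//.
have K0 : 0 <= d%:R / alpha / gap by rewrite !divr_ge0// ltW.
have Iu k : (\int[mu]_z u k z <=
    (d%:R / alpha / gap * 2 `^ gamma * sigma `^ gamma * ratio ^+ k)%:E)%E.
  rewrite ge0_integralZl//; last 2 first.
  - by move=> z _; rewrite lee_fin mulr_ge0// p_ge0.
  - by rewrite lee_fin powR_ge0.
  have k0 : 0 < 2 ^+ k * sigma by rewrite mulr_gt0// exprn_gt0.
  have c0 : (0 <= (c k)%:E)%E by rewrite lee_fin powR_ge0.
  apply: le_trans (lee_wpmul2l c0 (kernel_tail s0 k0)) _.
  rewrite -EFinM lee_fin le_eqVlt; apply/orP; left; apply/eqP.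
  pose A : R := 2 ^+ k; have A0 : 0 <= A by rewrite exprn_ge0.
  have h1 : A `^ gamma * A `^ (- alpha) = ratio ^+ k.
    rewrite -powRD; last by rewrite expf_neq0// implybT.
    have -> : A = 2 `^ k%:R by rewrite powR_mulrn.
    by rewrite -powRrM mulrC powRrM powR_mulrn ?powR_ge0.
  have h2 : s * sigma `^ (- alpha) = 1 by rewrite powRN sa divff// gt_eqF.
  rewrite /c exprS -mulrA !powRM ?mulr_ge0 ?(ltW sigma0)// -/A -h1.
  rewrite -[RHS]mulr1 -h2; ring.
apply: (@le_trans _ _ ((sigma `^ gamma)%:E * 1 + \sum_(0 <= k <oo)
   (d%:R / alpha / gap * 2 `^ gamma * sigma `^ gamma * ratio ^+ k)%:E)%E).
  apply: leeD.
    by rewrite lee_wpmul2l ?lee_fin ?powR_ge0// integral_kernel_le1.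
  apply: lee_nneseries => k _; last exact: Iu.
  by move=> _; apply: integral_ge0 => z _; exact: u0.
rewrite mule1 (le_trans (leeD2l _ (geometric_nneseries_le _)))//.
  by rewrite mulr_ge0 ?powR_ge0// mulr_ge0 ?powR_ge0.
rewrite -EFinD lee_fin sg /kernel_moment_const mulrDl mul1r lerD2l.
by rewrite mulrAC.
Qed.

Lemma loop_moment r t : 0 < r < t ->
  (\int[mu]_z (enorm z `^ gamma * (p r z * p (t - r) z))%:E <=
   (2 `^ (d%:R / alpha) * kernel_moment_const * t `^ (gamma / alpha) * p t 0)%:E)%E.
Proof.
have half u v : 0 < u -> 0 < v -> u <= v ->
    (\int[mu]_z (enorm z `^ gamma * (p u z * p v z))%:E <=
     (2 `^ (d%:R / alpha) * kernel_moment_const * (u + v) `^ (gamma / alpha) *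
        p (u + v) 0)%:E)%E.
  move=> u0 v0 uv; have uv0 : 0 < u + v by rewrite addr_gt0.
  (* The longer time v is at least (u + v)/2, and halving the time multiplies the value at the
     origin by 2^(d/alpha). *)
  have hv z : p v z <= 2 `^ (d%:R / alpha) * p (u + v) 0.
    apply: (le_trans (p_le0 z v0)).
    have -> : 2 `^ (d%:R / alpha) * p (u + v) 0 = p ((u + v) / 2) 0.
      rewrite (kernel0_scale uv0) (@kernel0_scale ((u + v) / 2)) ?divr_gt0//.
      rewrite powRM ?(ltW uv0)// mulrCA mulrA; congr (_ * _ * _).
      by rewrite -[2^-1]powR_inv1// -powRrM mulN1r opprK.
    by apply: p0_le; rewrite ?divr_gt0//; lra.
  apply: (@le_trans _ _ (\int[mu]_z ((2 `^ (d%:R / alpha) * p (u + v) 0)%:E *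
      (enorm z `^ gamma * p u z)%:E))%E).
    have mg : measurable_fun setT (fun z : 'rV[R]_d => enorm z `^ gamma).
      exact: (measurableT_comp (measurable_powR _) measurable_enorm).
    apply: ge0_le_integral => //.
    - by move=> z _; rewrite lee_fin mulr_ge0 ?powR_ge0// mulr_ge0// p_ge0.
    - apply/measurable_EFinP; apply: measurable_funM => //.
      exact: measurable_funM.
    - apply: measurable_funeM; apply/measurable_EFinP.
      exact: measurable_funM.
    move=> z _; rewrite -EFinM lee_fin mulrA mulrC ler_wpM2r ?hv//.
    by rewrite mulr_ge0 ?powR_ge0// p_ge0.
  have mg : measurable_fun setT (fun z : 'rV[R]_d => (enorm z `^ gamma * p u z)%:E).
    apply/measurable_EFinP; apply: measurable_funM => //.
    exact: (measurableT_comp (measurable_powR _) measurable_enorm).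
  have c0 : 0 <= 2 `^ (d%:R / alpha) * p (u + v) 0.
    by rewrite mulr_ge0 ?powR_ge0// p_ge0.
  rewrite ge0_integralZl//; last first.
    by move=> z _; rewrite lee_fin mulr_ge0 ?powR_ge0// p_ge0.
  have {}c0' : (0 <= (2 `^ (d%:R / alpha) * p (u + v) 0)%:E)%E by rewrite lee_fin.
  apply: le_trans (lee_wpmul2l c0' (kernel_moment u0)) _.
  rewrite -EFinM lee_fin.
  rewrite -mulrA -mulrA -mulrA ler_wpM2l ?powR_ge0//.
  rewrite mulrCA ler_wpM2l ?(ltW kernel_moment_const_gt0)//.
  rewrite mulrC ler_wpM2r ?p_ge0// ge0_ler_powR ?nnegrE ?(ltW u0) ?(ltW uv0)//.
    by rewrite divr_ge0// ltW.
  by rewrite lerDl ltW.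
move=> /andP[r0 rt]; have tr0 : 0 < t - r by rewrite subr_gt0.
have [h|h] := leP r (t - r).
  by have := half _ _ r0 tr0 h; rewrite subrKC.
have := half _ _ tr0 r0 (ltW h); rewrite subrK.
by under eq_integral do rewrite [p (t - r) _ * _]mulrC.
Qed.

End self_similar_kernel.

(* Layer cake: both sides equal \int_0^oo nu(psi o Y > u) du. *)
Lemma ge0_integral_density (R : realType) d1 d2 (S : measurableType d1)
    (T : measurableType d2) (P : {sigma_finite_measure set S -> \bar R})
    (mu : {sigma_finite_measure set T -> \bar R}) (Y : S -> T) (g : T -> R) :
  measurable_fun setT Y -> measurable_fun setT g -> (forall z, 0 <= g z) ->
  (forall A, measurable A ->
    P [set w | A (Y w)] = (\int[mu]_(z in A) (g z)%:E)%E) ->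
  forall psi : T -> R, measurable_fun setT psi -> (forall z, 0 <= psi z) ->
  (\int[P]_w (psi (Y w))%:E = \int[mu]_z (psi z * g z)%:E)%E.
Proof.
move=> mY mg g0 YP psi mpsi psi0.
pose B : set (T * R) := [set q | 0 <= q.2 < psi q.1].
have mB : measurable B.
  rewrite (_ : B = [set q | 0 <= q.2] `&` [set q | q.2 < psi q.1]); last first.
    by apply/seteqP; split => q /= => [/andP[]//|[q0 q1]]; apply/andP.
  apply: measurableI.
    rewrite (_ : mkset _ = snd @^-1` `[0, +oo[); last first.
      by apply/seteqP; split => q /=; rewrite in_itv/= andbT.
    by rewrite -[X in measurable X]setTI; exact: measurable_snd.
  have m2 : measurable_fun setT (fun q : T * R => psi q.1 - q.2).
    by apply: measurable_funB => //; exact: measurableT_comp.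
  rewrite (_ : mkset _ = (fun q : T * R => psi q.1 - q.2) @^-1` `]0, +oo[).
    by rewrite -[X in measurable X]setTI; exact: m2.
  by apply/seteqP; split => q /=; rewrite in_itv/= andbT subr_gt0.
pose chi q : \bar R := (\1_B q)%:E.
have mchi : measurable_fun setT chi by apply/measurable_EFinP; exact: measurable_indic.
have chi0 q : (0 <= chi q)%E by rewrite lee_fin.
have psiE z : ((psi z)%:E = \int[@lebesgue_measure R]_u chi (z, u))%E.
  rewrite (_ : (fun u => chi (z, u)) = EFin \o \1_(`[0, psi z[%classic : set R)).
    rewrite integral_indic//= setIT lebesgue_measure_itv/= lte_fin.
    case: ltgtP (psi0 z) => // [_ _|<- _]; last by [].
    by rewrite -EFinB subr0.
  apply: funext => u; rewrite /chi /= !indicE.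
  suff -> : ((z, u) \in B) = (u \in (`[0, psi z[%classic : set R)) by [].
  by apply/idP/idP; rewrite !inE /B /= ?in_itv.
have mYR : measurable_fun setT (fun q : S * R => (Y q.1, q.2)).
  by apply: measurable_fun_pair => //; exact: measurableT_comp.
under eq_integral do rewrite psiE.
rewrite (fubini_tonelli (m1 := P) (m2 := @lebesgue_measure R)
  (fun q : S * R => chi (Y q.1, q.2)))//; last exact: measurableT_comp.
transitivity (\int[@lebesgue_measure R]_u \int[mu]_z (chi (z, u) * (g z)%:E))%E.
  apply: eq_integral => u _.
  have mBu : measurable [set z | B (z, u)].
    have := measurable_ysection u mB; rewrite /ysection.
    by rewrite (_ : mkset _ = [set z | B (z, u)])//; apply/seteqP; split => z /=; rewrite inE.
  rewrite (_ : (fun w => chi (Y w, u)) = EFin \o \1_[set w | B (Y w, u)]); last first.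
    apply: funext => w; rewrite /chi /= !indicE.
    suff -> : ((Y w, u) \in B) = (w \in [set w | B (Y w, u)]) by [].
    by apply/idP/idP; rewrite !inE.
  rewrite integral_indic//; last first.
    rewrite -[X in measurable X]setTI.
    exact: (mY measurableT [set z | B (z, u)] mBu).
  rewrite setIT; apply: (etrans (YP [set z | B (z, u)] mBu)).
  rewrite integral_mkcond.
  apply: eq_integral => z _; rewrite patchE /chi indicE.
  have -> : (z \in [set z | B (z, u)]) = ((z, u) \in B) by apply/idP/idP; rewrite !inE.
  by case: ifPn => _; rewrite ?mul1e ?mul0e.
have mgchi : measurable_fun setT (fun q : T * R => chi q * (g q.1)%:E)%E.
  by apply: emeasurable_funM => //; apply/measurable_EFinP; exact: measurableT_comp.
rewrite -(fubini_tonelli (m1 := mu) (m2 := @lebesgue_measure R) _ mgchi); last first.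
  by move=> q; rewrite mule_ge0// lee_fin.
apply: eq_integral => z _; rewrite EFinM psiE /= ge0_integralZr ?lee_fin//.
exact: (measurableT_comp mchi (measurable_pair1 z)).
Qed.

(** * What the finite-dimensional laws of the bridges say about the density *)

Section stable_bridge.
Context {R : realType} {d : nat} (alpha : R).
Context disp (Omega : measurableType disp).
Variables (P : R -> 'rV[R]_d -> 'rV[R]_d -> probability Omega R)
  (X : R -> Omega -> 'rV[R]_d).
Hypothesis bridge : forall t x y, 0 < t -> is_stable_bridge alpha (P t x y) X t x y.
Local Notation mu := (lebesgue_rV R d).
Local Notation p := (@stable_density R d alpha).
Implicit Types (t s : R) (x y z : 'rV[R]_d).

Lemma bridge_density_nil t x y : bridge_density alpha t x y [tuple] [tuple] =
  (p t (x - y))^-1 * p t (y - x).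
Proof.
rewrite /bridge_density /stable_kernel; move: (stable_density alpha) => q.
by rewrite big_ord_recl big_ord0 mulr1 /= subr0.
Qed.

Lemma bridge_density1 t x y s z : bridge_density alpha t x y [tuple s] [tuple z] =
  (p t (x - y))^-1 * (p s (z - x) * p (t - s) (y - z)).
Proof.
rewrite /bridge_density /stable_kernel; move: (stable_density alpha) => q.
by rewrite !big_ord_recl big_ord0 mulr1 /= subr0.
Qed.

Lemma bridge_density2 t x y u s z1 z2 :
  bridge_density alpha t x y [tuple u; s] [tuple z1; z2] =
  (p t (x - y))^-1 * (p u (z1 - x) * (p (s - u) (z2 - z1) * p (t - s) (y - z2))).
Proof.
rewrite /bridge_density /stable_kernel; move: (stable_density alpha) => q.
by rewrite !big_ord_recl big_ord0 mulr1 /= subr0.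
Qed.

(** For k = 0 the law of the bridge equates the total mass 1 with the bridge density on a one-point
    space. Its prefactor is the inverse of [p t x], and the inverse of 0 is 0, so a zero of the
    density would give mass 0. *)
Lemma stable_bridge_density_neq0 t x : 0 < t -> p t x != 0.
Proof.
move=> t0; apply/eqP => px0.
have [_ _ _ /(_ 0%N [tuple])] := bridge x 0 t0.
rewrite /= t0 => /(_ isT setT measurableT).
rewrite (_ : [set w | _] = setT); last by apply/seteqP; split.
rewrite probability_setT.
rewrite integral0_eq => [/eqP|z _]; first by rewrite onee_eq0.
by rewrite (tuple0 z) bridge_density_nil subr0 px0 invr0 mul0r.
Qed.

Let p_neq0 := stable_bridge_density_neq0.
Let p_gt0 t x : 0 < t -> 0 < p t x. Proof. exact: (stable_density_gt0 p_neq0). Qed.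
Let p_ge0 t x : 0 < t -> 0 <= p t x. Proof. by move=> t0; exact/ltW/p_gt0. Qed.

Let measurable_p_shift t dd (T : measurableType dd) (f g : T -> 'rV[R]_d) :
  measurable_fun setT f -> measurable_fun setT g ->
  measurable_fun setT (fun w => p t (f w - g w)).
Proof.
move=> mf mg; apply: (measurableT_comp (measurable_stable_density1 alpha t)).
exact: measurable_funB_rV.
Qed.

(** The law at k = 1 is given on sets of 1-tuples; [ge0_integral_density] carries it to functions,
    and [ge0_integral_tuple1] removes the tuple. *)
Lemma stable_bridge_expectation1 t x y s (psi : 'rV[R]_d -> R) : 0 < s < t ->
  measurable_fun setT psi -> (forall z, 0 <= psi z) ->
  (\int[P t x y]_w (psi (X s w))%:E = \int[mu]_z
    (psi z * ((p t (x - y))^-1 * (p s (z - x) * p (t - s) (y - z))))%:E)%E.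
Proof.
move=> /andP[s0 st] mpsi psi0; have t0 : 0 < t by exact: lt_trans st.
have ts0 : 0 < t - s by rewrite subr_gt0.
have [mX _ _ fdd] := bridge x y t0.
have mXs : measurable_fun setT (X s) by apply: mX; rewrite !ltW.
pose Y w : 1.-tuple 'rV[R]_d := [tuple X s w].
have mY : measurable_fun setT Y.
  by apply: measurable_cons => //; exact: measurable_cst.
pose g (z : 1.-tuple 'rV[R]_d) := bridge_density alpha t x y [tuple s] z.
have gE v : g v = (p t (x - y))^-1 * (p s (tnth v ord0 - x) * p (t - s) (y - tnth v ord0)).
  rewrite /g -bridge_density1; congr bridge_density.
  by apply: eq_from_tnth => i; rewrite ord1.
have mt : measurable_fun setT (fun z : 1.-tuple 'rV[R]_d => tnth z ord0).
  exact: measurable_tnth.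
have mg : measurable_fun setT g.
  rewrite (funext gE); apply: measurable_funM => //.
  by apply: measurable_funM; exact: measurable_p_shift.
have g0 v : 0 <= g v.
  by rewrite gE mulr_ge0 ?invr_ge0 ?p_ge0// mulr_ge0 ?p_ge0.
have mpt : measurable_fun setT (fun z : 1.-tuple 'rV[R]_d => psi (tnth z ord0)).
  exact: measurableT_comp.
have YP A : measurable A -> P t x y [set w | A (Y w)] =
    (\int[tuple_measure mu 1]_(v in A) (g v)%:E)%E.
  move=> mA; rewrite -(fdd 1%N [tuple s] _ A mA); last by rewrite /= s0 st.
  congr (P t x y _); apply: funext => w; congr A.
  by apply: eq_from_tnth => i; rewrite tnth_mktuple ord1.
have := ge0_integral_density mY mg g0 YP mpt (fun _ => psi0 _).
rewrite ge0_integral_tuple1//.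
- by move=> ->; apply: eq_integral => z _; rewrite gE.
- by apply/measurable_EFinP; exact: measurable_funM.
- by move=> v; rewrite lee_fin mulr_ge0.
Qed.

Lemma stable_bridge_expectation2 t x y u s (psi : 'rV[R]_d * 'rV[R]_d -> R) :
  0 < u -> u < s -> s < t ->
  measurable_fun setT psi -> (forall q, 0 <= psi q) ->
  (\int[P t x y]_w (psi (X u w, X s w))%:E = \int[mu]_z1 \int[mu]_z2
    (psi (z1, z2) * ((p t (x - y))^-1 *
      (p u (z1 - x) * (p (s - u) (z2 - z1) * p (t - s) (y - z2)))))%:E)%E.
Proof.
move=> u0 us st mpsi psi0.
have s0 : 0 < s by exact: lt_trans us.
have t0 : 0 < t by exact: lt_trans st.
have ts0 : 0 < t - s by rewrite subr_gt0.
have su0 : 0 < s - u by rewrite subr_gt0.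
have [mX _ _ fdd] := bridge x y t0.
have mXs : measurable_fun setT (X s) by apply: mX; rewrite !ltW.
have mXu : measurable_fun setT (X u) by apply: mX; rewrite !ltW// (lt_trans us).
pose Y w : 2.-tuple 'rV[R]_d := [tuple X u w; X s w].
have mY : measurable_fun setT Y.
  apply: (measurable_cons mXu (g := fun w => [tuple X s w])).
  by apply: measurable_cons => //; exact: measurable_cst.
pose g (z : 2.-tuple 'rV[R]_d) := bridge_density alpha t x y [tuple u; s] z.
pose i1 : 'I_2 := lift ord0 ord0.
have gE v : g v = (p t (x - y))^-1 * (p u (tnth v ord0 - x) *
    (p (s - u) (tnth v i1 - tnth v ord0) * p (t - s) (y - tnth v i1))).
  rewrite /g -bridge_density2; congr bridge_density.
  apply: eq_from_tnth => i; have [j ->|->] := unliftP ord0 i => //.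
  by rewrite ord1.
have mt i : measurable_fun setT (fun z : 2.-tuple 'rV[R]_d => tnth z i).
  exact: measurable_tnth.
have mg : measurable_fun setT g.
  rewrite (funext gE); apply: measurable_funM => //.
  apply: measurable_funM; first exact: measurable_p_shift.
  by apply: measurable_funM; exact: measurable_p_shift.
have g0 v : 0 <= g v.
  rewrite gE mulr_ge0 ?invr_ge0 ?p_ge0// mulr_ge0 ?p_ge0//.
  by rewrite mulr_ge0 ?p_ge0.
have mpt : measurable_fun setT (fun z : 2.-tuple 'rV[R]_d => psi (tnth z ord0, tnth z i1)).
  by apply: (measurableT_comp mpsi); exact: measurable_fun_pair.
have YP A : measurable A -> P t x y [set w | A (Y w)] =
    (\int[tuple_measure mu 2]_(v in A) (g v)%:E)%E.
  move=> mA; rewrite -(fdd 2%N [tuple u; s] _ A mA); last by rewrite /= u0 us st.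
  congr (P t x y _); apply: funext => w; congr A.
  apply: eq_from_tnth => i; rewrite tnth_mktuple.
  by have [j ->|->] := unliftP ord0 i => //; rewrite ord1.
have := ge0_integral_density mY mg g0 YP mpt (fun _ => psi0 _).
rewrite ge0_integral_tuple2//.
- move=> ->; apply: eq_integral => z1 _; apply: eq_integral => z2 _.
  by rewrite gE.
- by apply/measurable_EFinP; exact: measurable_funM.
- by move=> v; rewrite lee_fin mulr_ge0.
Qed.

(** The bridge of length s + r from 0 to y has a one-time law of total mass 1 at time s; clearing
    the denominator p_(s+r)(y) gives the identity. *)
Lemma stable_chapman_kolmogorov s r y : 0 < s -> 0 < r ->
  (\int[mu]_z (p s z * p r (y - z))%:E = (p (s + r) y)%:E)%E.
Proof.
move=> s0 r0; have sr0 : 0 < s + r by rewrite addr_gt0.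
have ssr : 0 < s < s + r by rewrite s0 ltrDl.
have := @stable_bridge_expectation1 (s + r) 0 y s (cst 1) ssr.
move=> /(_ (measurable_cst _) (fun=> ler01)).
have I1 : (\int[P (s + r) 0 y]_w (1 : R)%:E = 1)%E.
  by rewrite integral_cst //= probability_setT mule1.
rewrite {}I1 sub0r stable_densityN.
under eq_integral do rewrite mul1r subr0 [s + r - s]addrAC subrr add0r EFinM.
rewrite ge0_integralZl//.
- move=> /(congr1 (mule (p (s + r) y)%:E)).
  by rewrite mule1 muleA -EFinM divff ?p_neq0// mul1e => ->.
- apply/measurable_EFinP; apply: measurable_funM.
    exact: measurable_stable_density1.
  exact: measurable_p_shift.
- by move=> z _; rewrite lee_fin mulr_ge0 ?p_ge0.
- by rewrite lee_fin invr_ge0 p_ge0.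
Qed.

End stable_bridge.

(** In the tail of the series, |x|^(k+3)/(k+3)! <= |x|^3 |x|^k/k!; partial sums are compared and
    then passed to the limit. *)
Lemma expR_taylor2 (R : realType) (x : R) :
  `|expR x - (1 + x + x ^+ 2 / 2)| <= `|x| ^+ 3 * expR `|x|.
Proof.
have cv (y : R) : series (exp_coeff y) @ \oo --> expR y.
  exact: (is_cvg_series_exp_coeff y).
have E (y : R) : series (exp_coeff y) 3 = 1 + y + y ^+ 2 / 2.
  rewrite /series/= !big_nat_recr//= big_geq// add0r /exp_coeff/=.
  by rewrite expr0 expr1 divr1 divr1.
have cvS : (fun n => `|series (exp_coeff x) (n + 3)%N - series (exp_coeff x) 3|)
    @ \oo --> `|expR x - series (exp_coeff x) 3|.
  apply: cvg_norm; apply: cvgB; last exact: cvg_cst.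
  by have := cv x; rewrite -(cvg_shiftn 3%N).
have partial n : series (exp_coeff `|x|) n <= expR `|x|.
  apply: (cvgr_to_ge (cv `|x|)); near=> m.
  rewrite -subr_ge0 sub_series_geq ?sumr_ge0// => [k _|].
    exact: exp_coeff_ge0.
  by near: m; exact: nbhs_infty_ge.
rewrite -E; apply: (cvgr_to_le cvS); apply: nearW => n.
rewrite sub_series_geq ?leq_addl//.
rewrite (big_addn 0 (n + 3)%N 3) addnK (le_trans (ler_norm_sum _ _ _))//.
apply: (@le_trans _ _ (`|x| ^+ 3 * series (exp_coeff `|x|) n)); last first.
  by rewrite ler_wpM2l ?exprn_ge0.
rewrite /series/= mulr_sumr; apply: ler_sum => k _.
rewrite /exp_coeff/= normrM normrX normfV (ger0_norm (ler0n _ _)).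
rewrite exprD [_ ^+ k * _]mulrC -mulrA ler_wpM2l ?exprn_ge0//.
rewrite ler_wpM2l ?exprn_ge0// lef_pV2 ?posrE ?ltr0n ?fact_gt0//.
by rewrite ler_nat leq_fact// leq_addr.
Unshelve. all: by end_near. Qed.

(** * Joint measurability of right-continuous processes *)

Section right_continuous.
Context {R : realType} disp (T : measurableType disp) (f : R -> T -> R).
Hypothesis mf : forall s, 0 <= s -> measurable_fun setT (f s).
Hypothesis rcf : forall w s, 0 <= s -> f u w @[u --> s^'+] --> f s w.

(** The time is rounded up to a multiple of 1/(n+1): each approximation is measurable as a countable
    gluing of fixed-time maps, and right continuity gives the pointwise limit. *)
Lemma measurable_right_continuous :
  measurable_fun setT (fun q : R * T => f (Num.max 0 q.1) q.2).
Proof.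
pose k n (s : R) : nat := Num.truncn (n.+1%:R * Num.max 0 s).
(* The successor puts [h n s] strictly above [Num.max 0 s], even at grid points, as convergence
   along the right filter demands. *)
pose h n (s : R) : R := (k n s).+1%:R / n.+1%:R.
pose fn n (q : R * T) : R := f (h n q.1) q.2.
have max0 (s : R) : 0 <= Num.max 0 s by rewrite le_max lexx.
apply: (measurable_fun_cvg (h := fn)).
  move=> n _ Y mY; rewrite setTI.
  rewrite (_ : fn n @^-1` Y = \bigcup_m ([set q : R * T | k n q.1 = m] `&`
    [set q | Y (f (m.+1%:R / n.+1%:R) q.2)])); last first.
    apply/seteqP; split => q /=; first by move=> Yq; exists (k n q.1).
    by move=> [m _ /= [<-]].
  apply: bigcupT_measurable => m; apply: measurableI.
    have mk : measurable_fun setT (fun q : R * T => n.+1%:R * Num.max 0 q.1).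
      by apply: measurable_funM => //; apply: measurable_maxr => //; exact: measurable_fst.
    rewrite (_ : mkset _ = (fun q : R * T => n.+1%:R * Num.max 0 q.1) @^-1`
      `[m%:R, m.+1%:R[); first by rewrite -[X in measurable X]setTI; exact: mk.
    apply/seteqP; split => q /=; rewrite in_itv/= => /eqP.
      by rewrite /k truncn_eq// mulr_ge0.
    by move=> /eqP; rewrite -truncn_eq ?mulr_ge0// => /eqP.
  have m2 : measurable_fun setT (fun q : R * T => f (m.+1%:R / n.+1%:R) q.2).
    by apply: measurableT_comp => //; apply: mf; rewrite divr_ge0.
  by rewrite -[X in measurable X]setTI; exact: m2.
move=> [s w] _ /=; apply: (@cvg_comp _ _ _ (fun n => h n s) (f ^~ w) _
  ((Num.max 0 s)^'+ : set_system R)); last exact: rcf.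
move=> A [e /= e0 eA].
have : \forall n \near \oo, n.+1%:R^-1 < e by exact: (near_infty_natSinv_lt (PosNum e0)).
apply: filterS => n ne.
have /andP[k1 k2] := @truncn_itv R (n.+1%:R * Num.max 0 s) (mulr_ge0 (ler0n _ _) (max0 s)).
have n0 : 0 < n.+1%:R :> R by [].
have h1 : Num.max 0 s < h n s by rewrite /h ltr_pdivlMr// mulrC.
apply: eA => //=; rewrite distrC ger0_norm ?subr_ge0 ?(ltW h1)//.
apply: le_lt_trans ne; rewrite lerBlDr /h ler_pdivrMr// mulrDl mulVf ?gt_eqF//.
by rewrite -natr1 addrC lerD2l mulrC.
Qed.

End right_continuous.

Lemma bounded_integrable (R : realType) dd (T : measurableType dd)
    (m : {finite_measure set T -> \bar R}) (f : T -> R) (b : R) :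
  measurable_fun setT f -> (forall x, `|f x| <= b) ->
  m.-integrable setT (EFin \o f).
Proof.
move=> mf fb; apply: (@le_integrable _ _ _ m setT measurableT _ (cst b%:E)).
- exact/measurable_EFinP.
- by move=> x _; rewrite lee_fin (le_trans (fb x))// ler_norm.
- exact: finite_measure_integrable_cst.
Qed.

(** * Second order expansion of the expectation of an exponential functional *)

Section exponential_expansion.
Context {R : realType} dS (S : measurableType dS)
  (nu : {finite_measure set S -> \bar R}) (N : R).
Let t := fine (nu setT).

(** Bounds |A|^2 e^|A| when |A| <= tN. The third factor |A| of the Taylor remainder is kept as the
    integral of |f|, which later produces the L^1 norm of V. *)
Definition taylor_const : R := t ^+ 2 * N ^+ 2 * expR (t * N).

Let t_ge0 : 0 <= t. Proof. by rewrite fine_ge0. Qed.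

Lemma expR_integral_expansion (f : S -> R) :
  measurable_fun setT f -> (forall x, `|f x| <= N) ->
  `|expR (- \int[nu]_s f s) - 1 + \int[nu]_s f s - t / 2 * \int[nu]_s (f s ^+ 2)
    + (\int[nu]_s \int[nu]_u (f s - f u) ^+ 2) / 4|
  <= taylor_const * \int[nu]_s `|f s|.
Proof.
move=> mf fN.
have intf := bounded_integrable nu mf fN.
have intn : nu.-integrable setT (EFin \o (fun s => `|f s|)).
  apply: (@bounded_integrable _ _ _ nu _ N) => [|s]; last by rewrite normr_id.
  exact: measurableT_comp.
have mq : measurable_fun setT (fun s => f s ^+ 2) by exact: measurable_funX.
have intq : nu.-integrable setT (EFin \o (fun s => f s ^+ 2)).
  apply: (@bounded_integrable _ _ _ nu _ (N ^+ 2)) => // s.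
  by rewrite normrX lerXn2r ?nnegrE// (le_trans _ (fN s)).
set A := \int[nu]_s f s; set Q := \int[nu]_s (f s ^+ 2).
set B := \int[nu]_s `|f s|.
have intc c : nu.-integrable setT (EFin \o (fun=> c)).
  exact: finite_measure_integrable_cst.
have inner s : \int[nu]_u (f s - f u) ^+ 2 = t * f s ^+ 2 - 2 * A * f s + Q.
  transitivity (\int[nu]_u (f s ^+ 2 + (f u ^+ 2 - (2 * f s) * f u))).
    by apply: eq_Rintegral => u _; rewrite sqrrB; ring.
  have i1 : nu.-integrable setT (EFin \o (fun u => 2 * f s * f u)).
    exact: (integrableZl measurableT (2 * f s) intf).
  rewrite (RintegralD measurableT (intc _) (integrableB measurableT intq i1)).
  rewrite (RintegralB measurableT intq i1) (RintegralZl _ measurableT intf).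
  by rewrite Rintegral_cst// -/t -/A -/Q; ring.
(* Variance identity: A^2/2 = tQ/2 minus a quarter of this double integral, whence the factor
   1/4. *)
have -> : \int[nu]_s \int[nu]_u (f s - f u) ^+ 2 = 2 * t * Q - 2 * A ^+ 2.
  transitivity (\int[nu]_s ((t * f s ^+ 2 - 2 * A * f s) + Q)).
    by apply: eq_Rintegral => s _; rewrite inner.
  have i1 : nu.-integrable setT (EFin \o (fun u => t * f u ^+ 2)).
    exact: (integrableZl measurableT t intq).
  have i2 : nu.-integrable setT (EFin \o (fun u => 2 * A * f u)).
    exact: (integrableZl measurableT (2 * A) intf).
  rewrite (RintegralD measurableT (integrableB measurableT i1 i2) (intc _)).
  rewrite (RintegralB measurableT i1 i2) !(RintegralZl _ measurableT)//.
  by rewrite Rintegral_cst// -/t -/A -/Q; ring.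
have AB : `|A| <= B by exact: le_normr_Rintegral.
have BtN : B <= t * N.
  rewrite mulrC -Rintegral_cst//; apply: le_Rintegral => //; exact: intc.
have B0 : 0 <= B by exact: le_trans AB.
rewrite (_ : _ + _ = expR (- A) - (1 + (- A) + (- A) ^+ 2 / 2)); last first.
  by rewrite sqrrN; field.
apply: (le_trans (expR_taylor2 _)); rewrite normrN /taylor_const.
have AtN := le_trans AB BtN.
have tN0 : 0 <= t * N by exact: le_trans AtN.
have A2 : `|A| ^+ 2 <= t ^+ 2 * N ^+ 2 by rewrite -exprMn lerXn2r ?nnegrE.
rewrite exprSr -mulrA [`|A| * expR _]mulrC mulrA ler_pM//.
by rewrite ler_pM ?expR_ge0 ?exprn_ge0 ?ler_expR.
Qed.

Context dO (Omega : measurableType dO) (P : probability Omega R)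
  (v : S * Omega -> R).
Hypotheses (mv : measurable_fun setT v) (vN : forall q, `|v q| <= N).

(* [- r + t / 2 * r ^+ 2] is split into two nonnegative parts so that only Tonelli's
   theorem is needed, whatever the integrability of the expectation. *)
Definition incr_part (r : R) : R := Num.max (- r) 0 + t / 2 * r ^+ 2.
Definition decr_part (r : R) : R := Num.max r 0.

Lemma incr_part_ge0 r : 0 <= incr_part r.
Proof.
by rewrite addr_ge0 ?le_max ?lexx ?orbT// mulr_ge0 ?sqr_ge0// divr_ge0.
Qed.

Lemma decr_part_ge0 r : 0 <= decr_part r.
Proof. by rewrite le_max lexx orbT. Qed.

Lemma incr_decr_part r : incr_part r - decr_part r = - r + t / 2 * r ^+ 2.
Proof.
rewrite /incr_part /decr_part addrAC; congr (_ + _).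
by case: (ltP (- r) 0); case: (ltP r 0); lra.
Qed.

Lemma measurable_incr_part : measurable_fun setT incr_part.
Proof.
apply: measurable_funD.
  by apply: measurable_maxr => //; exact: oppr_measurable.
by apply: measurable_funM => //; exact: measurable_funX.
Qed.

Lemma measurable_decr_part : measurable_fun setT decr_part.
Proof. by apply: measurable_maxr. Qed.

Let mvw w : measurable_fun setT (fun s => v (s, w)).
Proof. exact: (measurableT_comp mv (measurable_pair2 w)). Qed.

Let mvs s : measurable_fun setT (fun w => v (s, w)).
Proof. exact: (measurableT_comp mv (measurable_pair1 s)). Qed.

(** The bound on [F] makes the inner time integrals finite, so that [fine] does not alter them. *)
Let tonelli (F : S * Omega -> R) (b : R) :
  measurable_fun setT F -> (forall q, 0 <= F q <= b) ->
  (\int[P]_w (\int[nu]_s F (s, w))%:E = \int[nu]_s \int[P]_w (F (s, w))%:E)%E.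
Proof.
move=> mF F0b; have F0 q : 0 <= F q by have /andP[] := F0b q.
have mFE : measurable_fun setT (EFin \o F) by exact/measurable_EFinP.
rewrite (fubini_tonelli (m1 := nu) (m2 := P) (EFin \o F) mFE); last first.
  by move=> q; rewrite lee_fin.
apply: eq_integral => w _; rewrite /Rintegral fineK//.
apply: (integrable_fin_num measurableT).
apply: (@bounded_integrable _ _ _ nu (fun s => F (s, w)) b) => [|s].
  exact: (measurableT_comp mF (measurable_pair2 w)).
by have /andP[? ?] := F0b (s, w); rewrite ger0_norm.
Qed.

Let A w := \int[nu]_s v (s, w).
Let K := taylor_const.

Let measurable_swap_Rintegral (F : S * Omega -> R) : measurable_fun setT F ->
  measurable_fun setT (fun w => \int[nu]_s F (s, w)).
Proof.
move=> mF; apply: (@measurable_fun_Rintegral _ _ _ Omega S nu (fun q => F (q.2, q.1))).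
apply: (measurableT_comp mF); apply: measurable_fun_pair => //.
Qed.

Let Ia w := \int[nu]_s incr_part (v (s, w)).
Let Ib w := \int[nu]_s decr_part (v (s, w)).
Let Iv w := \int[nu]_s `|v (s, w)|.
Let D w := \int[nu]_s \int[nu]_u (v (s, w) - v (u, w)) ^+ 2.

Let bound_incr q : 0 <= incr_part (v q) <= N + t / 2 * N ^+ 2.
Proof.
rewrite incr_part_ge0/= lerD//.
  have := vN q; have := le_trans (normr_ge0 _) (vN q); rewrite ler_norml.
  by move=> N0 /andP[? ?]; rewrite ge_max N0 andbT; lra.
rewrite ler_wpM2l ?divr_ge0// -[leLHS]ger0_norm ?sqr_ge0// normrX.
by rewrite lerXn2r ?nnegrE ?vN// (le_trans _ (vN q)).
Qed.

Let bound_decr q : 0 <= decr_part (v q) <= N.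
Proof.
rewrite decr_part_ge0/= ge_max (le_trans (ler_norm _) (vN q))/=.
exact: le_trans (normr_ge0 _) (vN q).
Qed.

Let intv w : nu.-integrable setT (EFin \o (fun s => v (s, w))).
Proof. exact: bounded_integrable (mvw w) (fun s => vN (s, w)). Qed.

Let Ia_Ib w : Ia w - Ib w = - A w + t / 2 * \int[nu]_s (v (s, w) ^+ 2).
Proof.
have ia : nu.-integrable setT (EFin \o (fun s => incr_part (v (s, w)))).
  apply: (@bounded_integrable _ _ _ nu _ (N + t / 2 * N ^+ 2)) => [|s].
    exact: (measurableT_comp measurable_incr_part (mvw w)).
  by have /andP[? ?] := bound_incr (s, w); rewrite ger0_norm.
have ib : nu.-integrable setT (EFin \o (fun s => decr_part (v (s, w)))).
  apply: (@bounded_integrable _ _ _ nu _ N) => [|s].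
    exact: (measurableT_comp measurable_decr_part (mvw w)).
  by have /andP[? ?] := bound_decr (s, w); rewrite ger0_norm.
have iq : nu.-integrable setT (EFin \o (fun s => v (s, w) ^+ 2)).
  apply: (@bounded_integrable _ _ _ nu _ (N ^+ 2)) => [|s]; first exact: measurable_funX.
  by rewrite normrX lerXn2r ?nnegrE// (le_trans _ (vN (s, w))).
rewrite -(RintegralB measurableT ia ib) -(RintegralZl _ measurableT iq).
have inv : nu.-integrable setT (EFin \o (fun s => -1 * v (s, w))).
  exact: (integrableZl measurableT (-1) (intv w)).
have -> : - A w = \int[nu]_s (-1 * v (s, w)).
  by rewrite (RintegralZl _ measurableT (intv w)) mulN1r.
rewrite -(RintegralD measurableT inv (integrableZl measurableT (t / 2) iq)).
by apply: eq_Rintegral => s _; rewrite incr_decr_part mulN1r.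
Qed.

Let D_ge0 w : 0 <= D w.
Proof.
by apply: Rintegral_ge0 => s _; apply: Rintegral_ge0 => u _; exact: sqr_ge0.
Qed.

Let expansion w : `|expR (- A w) - 1 - (Ia w - Ib w) + D w / 4| <= K * Iv w.
Proof.
have := expR_integral_expansion (mvw w) (fun s => vN (s, w)).
by rewrite Ia_Ib opprD opprK addrA.
Qed.

Let mA : measurable_fun setT (fun w => (expR (- A w))%:E).
Proof.
apply/measurable_EFinP; apply: measurableT_comp; first exact: measurable_expR.
apply: measurableT_comp; first exact: oppr_measurable.
exact: measurable_swap_Rintegral.
Qed.

Let K_ge0 : 0 <= K.
Proof. by rewrite /K /taylor_const mulr_ge0 ?expR_ge0// mulr_ge0// sqr_ge0. Qed.

Let mIa : measurable_fun setT (fun w => (Ia w)%:E).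
Proof.
apply/measurable_EFinP.
apply: (@measurable_swap_Rintegral (fun q => incr_part (v q))).
exact: (measurableT_comp measurable_incr_part mv).
Qed.

Let mIb : measurable_fun setT (fun w => (Ib w)%:E).
Proof.
apply/measurable_EFinP.
apply: (@measurable_swap_Rintegral (fun q => decr_part (v q))).
exact: (measurableT_comp measurable_decr_part mv).
Qed.

Let mIv : measurable_fun setT (fun w => (Iv w)%:E).
Proof.
apply/measurable_EFinP.
apply: (@measurable_swap_Rintegral (fun q => `|v q|)).
exact: measurableT_comp.
Qed.

Let mincr2 : measurable_fun setT (fun q : (S * Omega) * S =>
  (v q.1 - v (q.2, q.1.2)) ^+ 2).
Proof.
apply: measurable_funX; apply: measurable_funB; first exact: measurableT_comp.
apply: (measurableT_comp mv); apply: measurable_fun_pair => //.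
exact: measurableT_comp.
Qed.

Let mDs : measurable_fun setT
  (fun q : S * Omega => \int[nu]_u (v q - v (u, q.2)) ^+ 2).
Proof. exact: (@measurable_fun_Rintegral _ _ _ _ _ nu _ mincr2). Qed.

Let mD : measurable_fun setT (fun w => (D w)%:E).
Proof. by apply/measurable_EFinP; exact: (measurable_swap_Rintegral mDs). Qed.

Let IaE : (\int[P]_w (Ia w)%:E =
  \int[nu]_s \int[P]_w (incr_part (v (s, w)))%:E)%E.
Proof.
apply: (@tonelli (fun q => incr_part (v q))) bound_incr.
exact: (measurableT_comp measurable_incr_part mv).
Qed.

Let IbE : (\int[P]_w (Ib w)%:E =
  \int[nu]_s \int[P]_w (decr_part (v (s, w)))%:E)%E.
Proof.
apply: (@tonelli (fun q => decr_part (v q))) bound_decr.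
exact: (measurableT_comp measurable_decr_part mv).
Qed.

Let IvE : (\int[P]_w (Iv w)%:E = \int[nu]_s \int[P]_w (`|v (s, w)|)%:E)%E.
Proof.
apply: (@tonelli (fun q => `|v q|) N); first exact: measurableT_comp.
by move=> q; rewrite normr_ge0 vN.
Qed.

Let sqr_le q q' : 0 <= (v q - v q') ^+ 2 <= (N + N) ^+ 2.
Proof.
rewrite sqr_ge0/= -[leLHS]ger0_norm ?sqr_ge0// normrX lerXn2r ?nnegrE//.
  by rewrite addr_ge0// (le_trans _ (vN q)).
by rewrite (le_trans (ler_normB _ _))// lerD.
Qed.

Let DE : (\int[P]_w (D w)%:E = \int[nu]_s \int[nu]_u \int[P]_w
  ((v (s, w) - v (u, w)) ^+ 2)%:E)%E.
Proof.
rewrite (@tonelli (fun q : S * Omega => \int[nu]_u (v q - v (u, q.2)) ^+ 2)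
  ((N + N) ^+ 2 * t) mDs); last first.
  move=> q; rewrite Rintegral_ge0/=; last by move=> u _; exact: sqr_ge0.
  rewrite -Rintegral_cst//; apply: le_Rintegral => //.
  - apply: (@bounded_integrable _ _ _ nu _ ((N + N) ^+ 2)) => [|u].
      exact: (measurableT_comp mincr2 (measurable_pair1 q)).
    by have /andP[? ?] := sqr_le q (u, q.2); rewrite ger0_norm.
  - exact: finite_measure_integrable_cst.
  - by move=> u _; have /andP[] := sqr_le q (u, q.2).
apply: eq_integral => s _.
apply: (@tonelli (fun q => (v (s, q.2) - v q) ^+ 2) ((N + N) ^+ 2)) => [|q //].
apply: measurable_funX; apply: measurable_funB => //.
exact: (measurableT_comp (mvs s) measurable_snd).
Qed.

Let Ia_ge0 w : (0 <= (Ia w)%:E)%E.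
Proof. by rewrite lee_fin Rintegral_ge0// => s _; exact: incr_part_ge0. Qed.
Let Ib_ge0 w : (0 <= (Ib w)%:E)%E.
Proof. by rewrite lee_fin Rintegral_ge0// => s _; exact: decr_part_ge0. Qed.
Let Iv_ge0 w : (0 <= (Iv w)%:E)%E.
Proof. by rewrite lee_fin Rintegral_ge0. Qed.

Let P1 : (\int[P]_w (1 : R)%:E = 1)%E.
Proof. by rewrite integral_cst//= probability_setT mule1. Qed.

(** The double integral of squared increments enters the expansion with a favourable sign and is
    dropped. Every term is moved to the side where it is nonnegative, so no difference of infinite
    values can occur. *)
Lemma expectation_expR_upper :
  (\int[P]_w (expR (- \int[nu]_s v (s, w)))%:E +
     \int[nu]_s \int[P]_w (decr_part (v (s, w)))%:E <=
   1 + \int[nu]_s \int[P]_w (incr_part (v (s, w)))%:E +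
     taylor_const%:E * \int[nu]_s \int[P]_w (`|v (s, w)|)%:E)%E.
Proof.
have mKIv : measurable_fun setT (fun w => K%:E * (Iv w)%:E)%E by exact: measurable_funeM.
have KIv0 w : (0 <= K%:E * (Iv w)%:E)%E by apply: mule_ge0.
rewrite -IaE -IbE -IvE -P1 -ge0_integralD//.
rewrite -ge0_integralZl//.
rewrite -ge0_integralD//.
rewrite -ge0_integralD//; last 2 first.
- by move=> w _; rewrite adde_ge0// lee_fin.
- by apply: emeasurable_funD.
apply: ge0_le_integral => //.
- by move=> w _; rewrite adde_ge0// lee_fin expR_ge0.
- exact: emeasurable_funD.
- by apply: emeasurable_funD => //; exact: emeasurable_funD.
move=> w _; rewrite -EFinM -!EFinD lee_fin.
have := expansion w; have := D_ge0 w; rewrite ler_norml.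
by move: (expR _) (Ia w) (Ib w) (D w) (K * Iv w) => e a b dd k d0 /andP[_]; lra.
Qed.

(** Here the double integral has the unfavourable sign and remains in the bound. *)
Lemma expectation_expR_lower :
  (1 + \int[nu]_s \int[P]_w (incr_part (v (s, w)))%:E <=
   \int[P]_w (expR (- \int[nu]_s v (s, w)))%:E +
     \int[nu]_s \int[P]_w (decr_part (v (s, w)))%:E +
     (taylor_const%:E * \int[nu]_s \int[P]_w (`|v (s, w)|)%:E +
     4^-1%:E * \int[nu]_s \int[nu]_u \int[P]_w
       ((v (s, w) - v (u, w)) ^+ 2)%:E))%E.
Proof.
have mKIv : measurable_fun setT (fun w => K%:E * (Iv w)%:E)%E by exact: measurable_funeM.
have KIv0 w : (0 <= K%:E * (Iv w)%:E)%E by apply: mule_ge0.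
have D0 w : (0 <= (D w)%:E)%E by rewrite lee_fin.
have mD4 : measurable_fun setT (fun w => 4^-1%:E * (D w)%:E)%E by exact: measurable_funeM.
have D40 w : (0 <= 4^-1%:E * (D w)%:E)%E by rewrite mule_ge0// lee_fin.
rewrite -IaE -IbE -IvE -DE -P1 -ge0_integralD//.
rewrite -ge0_integralZl// -[X in (_ + (_ + X))%E]ge0_integralZl//.
rewrite -[X in (_ <= X + _)%E]ge0_integralD//.
rewrite -[X in (_ <= _ + X)%E]ge0_integralD//.
rewrite -[X in (_ <= X)%E]ge0_integralD//; last 4 first.
- by move=> w _; rewrite adde_ge0// lee_fin expR_ge0.
- exact: emeasurable_funD.
- by move=> w _; rewrite adde_ge0.
- exact: emeasurable_funD.
apply: ge0_le_integral => //.
- by move=> w _; rewrite adde_ge0// lee_fin.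
- exact: emeasurable_funD.
- by apply: emeasurable_funD; exact: emeasurable_funD.
move=> w _; rewrite -!EFinM -!EFinD lee_fin.
have := expansion w; rewrite ler_norml.
by move: (expR _) (Ia w) (Ib w) (D w) (K * Iv w) => e a b dd k /andP[+ _]; lra.
Qed.

End exponential_expansion.

(** * Comparison of integrals without measurability; restriction of a measure *)

Section sandwich.
Context {R : realType} dd (T : measurableType dd) (m : {measure set T -> \bar R}).
Import HBNNSimple.

(* The integral of a nonnegative function is a supremum over simple functions
   below it, hence monotone without any measurability. *)
Lemma ge0_le_integral_any (f g : T -> \bar R) :
  (forall x, (0 <= f x)%E) -> (forall x, (f x <= g x)%E) ->
  (\int[m]_x f x <= \int[m]_x g x)%E.
Proof.
move=> f0 fg; have g0 x : (0 <= g x)%E by exact: le_trans (f0 x) (fg x).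
rewrite !ge0_integralTE//; apply: ereal_sup_le => _ /= [h hf <-].
by exists h => // x; exact: le_trans (hf x) (fg x).
Qed.

Lemma le_integral_any (f g : T -> \bar R) : (forall x, (f x <= g x)%E) ->
  (\int[m]_x f x <= \int[m]_x g x)%E.
Proof.
move=> fg; rewrite integralE [leRHS]integralE.
have fgT : {in setT, forall x, (f x <= g x)%E} by move=> x _.
apply: leeB; apply: ge0_le_integral_any => // x.
  exact: (funepos_le fgT (in_setT x)).
exact: (funeneg_le fgT (in_setT x)).
Qed.

(** Meant for [f] the trace integrand, whose measurability in x is unknown. The enclosure also shows
    that the extended integral of [f] is finite, without which [fine] would return a meaningless
    0. *)
Lemma Rintegral_sandwich (f g : T -> R) (h : T -> \bar R) :
  m.-integrable setT (EFin \o g) -> measurable_fun setT h ->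
  (forall x, (0 <= h x)%E) -> (\int[m]_x h x < +oo)%E ->
  (forall x, ((f x)%:E <= (g x)%:E + h x)%E) ->
  (forall x, ((g x)%:E <= (f x)%:E + h x)%E) ->
  `|\int[m]_x f x - \int[m]_x g x| <= fine (\int[m]_x h x)%E.
Proof.
move=> intg mh h0 hoo fgh gfh.
have inth : m.-integrable setT h.
  apply/integrableP; split => //.
  by under eq_integral do rewrite gee0_abs//.
have Ih : (\int[m]_x h x)%E \is a fin_num by exact: integrable_fin_num.
have Ig : (\int[m]_x (g x)%:E)%E \is a fin_num by exact: integrable_fin_num.
have up : (\int[m]_x (f x)%:E <= \int[m]_x (g x)%:E + \int[m]_x h x)%E.
  rewrite -integralD//; exact: le_integral_any.
have low : (\int[m]_x (g x)%:E - \int[m]_x h x <= \int[m]_x (f x)%:E)%E.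
  rewrite -integralB//; apply: le_integral_any => x.
  have := gfh x; have := h0 x; case: (h x) => [r| |]//= _; last by rewrite addeNy leNye.
  by rewrite -!EFinD !lee_fin lerBlDr.
have If : (\int[m]_x (f x)%:E)%E \is a fin_num.
  rewrite fin_numE; apply/andP; split.
    apply/eqP => E; move: low; rewrite E leeNy_eq => /eqP E'.
    have : (\int[m]_x (g x)%:E - \int[m]_x h x)%E \is a fin_num by rewrite fin_numB Ih Ig.
    by rewrite E'.
  apply/eqP => E; move: up; rewrite E leye_eq => /eqP E'.
  have : (\int[m]_x (g x)%:E + \int[m]_x h x)%E \is a fin_num by rewrite fin_numD Ih Ig.
  by rewrite E'.
move: up low; rewrite /Rintegral.
rewrite -(fineK If) -(fineK Ig) -(fineK Ih) -EFinD -EFinB !lee_fin/= => up low.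
by rewrite ler_norml; apply/andP; split; lra.
Qed.

End sandwich.

Section restricted_measure.
Context {R : realType} dd (T : measurableType dd) (m : {measure set T -> \bar R})
  (J : set T) (mJ : measurable J) (Joo : (m J < +oo)%E).

(** A finite measure on the whole type: time integrals over [J] become integrals over [setT], the
    form that Tonelli and the exponential expansion take. *)
Definition restricted_measure : {finite_measure set T -> \bar R} := mfrestr mJ Joo.

Lemma restricted_measureT : restricted_measure setT = m J.
Proof. by rewrite /restricted_measure /= /mfrestr /mrestr setTI. Qed.

Lemma ge0_integral_restricted (f : T -> \bar R) : measurable_fun setT f ->
  (forall x, (0 <= f x)%E) ->
  (\int[restricted_measure]_x f x = \int[m]_(x in J) f x)%E.
Proof.
move=> mf f0.
rewrite (@ge0_negligible_integral _ _ _ restricted_measure setT (~` J))//;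
  last 2 first.
- exact: measurableC.
- by rewrite /= /mfrestr /mrestr setICl measure0.
rewrite setTD setCK; apply: eq_measure_integral => A mA AJ.
by rewrite /= /mfrestr /mrestr setIidl.
Qed.

Lemma Rintegral_restricted (f : T -> R) : measurable_fun setT f ->
  \int[restricted_measure]_x f x = \int[m]_(x in J) f x.
Proof.
move=> /measurable_EFinP mf; rewrite /Rintegral integralE [in RHS]integralE.
rewrite ge0_integral_restricted//; last exact: measurable_funepos.
by rewrite ge0_integral_restricted//; exact: measurable_funeneg.
Qed.

Lemma ge0_eq_integral_restricted (f g : T -> \bar R) :
  measurable_fun setT f -> measurable_fun setT g ->
  (forall x, (0 <= f x)%E) -> (forall x, (0 <= g x)%E) ->
  (forall x, J x -> f x = g x) ->
  (\int[restricted_measure]_x f x = \int[restricted_measure]_x g x)%E.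
Proof.
move=> mf mg f0 g0 fg; rewrite !ge0_integral_restricted//.
by apply: eq_integral => x /set_mem Jx; exact: fg.
Qed.

Lemma ge0_le_integral_restricted (f g : T -> \bar R) :
  measurable_fun setT f -> measurable_fun setT g ->
  (forall x, (0 <= f x)%E) -> (forall x, (0 <= g x)%E) ->
  (forall x, J x -> (f x <= g x)%E) ->
  (\int[restricted_measure]_x f x <= \int[restricted_measure]_x g x)%E.
Proof.
move=> mf mg f0 g0 fg; rewrite !ge0_integral_restricted//.
by apply: ge0_le_integral => //; exact: measurable_funTS.
Qed.

End restricted_measure.

Section hoelder_continuous.
Context {R : realType} {d : nat} (V : 'rV[R]_d -> R) (M gamma : R).
Hypotheses (d_gt0 : (0 < d)%N) (gamma_gt0 : 0 < gamma) (M_gt0 : 0 < M).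
Hypothesis VH : forall x y, `|V x - V y| <= M * enorm (x - y) `^ gamma.
Local Notation mu := (lebesgue_rV R d).

(* V is continuous and nonempty open boxes have positive measure. *)
Lemma hoelder_ess_bound (N : R) : {ae mu, forall x, `|V x| <= N} ->
  forall x, `|V x| <= N.
Proof.
move=> [B [mB B0 VB]] x; rewrite leNgt; apply/negP => Nx.
(* If |x - y| < delta^(1/gamma), then V differs at x and y by less than |V x| - N, so |V y| > N. The
   box of half-side r, a d-th of that radius, lies in this ball by [enorm_le_sum]. *)
pose delta := (`|V x| - N) / M.
have delta0 : 0 < delta by rewrite divr_gt0// subr_gt0.
pose r := delta `^ gamma^-1 / d%:R.
have r0 : 0 < r by rewrite divr_gt0 ?powR_gt0// ltr0n.
have := lebesgue_rV_box_gt0 x r0; rewrite ltNge => /negP; apply.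
rewrite -B0; apply: le_measure; rewrite ?inE//.
  exact: measurable_rV_box.
move=> y yx; apply: VB => /= Vy.
have e : enorm (x - y) < delta `^ gamma^-1.
  apply: (le_lt_trans (enorm_le_sum _)).
  rewrite (_ : delta `^ gamma^-1 = \sum_(i < d) r); last first.
    by rewrite sumr_const card_ord -[RHS]mulr_natr divfK// pnatr_eq0 gt_eqF.
  apply: ltr_sum => [|i _]; last by rewrite !mxE distrC; exact: yx.
  by apply/hasP; exists (Ordinal d_gt0) => //; rewrite mem_index_enum.
have : M * enorm (x - y) `^ gamma < `|V x| - N.
  rewrite mulrC -ltr_pdivlMr// -[ltRHS]/delta.
  have -> : delta = (delta `^ gamma^-1) `^ gamma.
    by rewrite -powRrM mulVf ?gt_eqF// powRr1// ltW.
  by rewrite gt0_ltr_powR// nnegrE ?enorm_ge0// powR_ge0.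
move=> /(le_lt_trans (VH x y)).
have := lerB_dist (V x) (V y); lra.
Qed.

End hoelder_continuous.

Ltac measurable_proj :=
  first [ exact: measurable_id | exact: measurable_fst | exact: measurable_snd
        | apply: (measurableT_comp measurable_fst); measurable_proj
        | apply: (measurableT_comp measurable_snd); measurable_proj ].

(** * Loops averaged over their base point *)

Section loop_process.
Context {R : realType} {d : nat} (t : R).
Hypothesis t_gt0 : 0 < t.
Local Notation mu := (lebesgue_rV R d).
Implicit Types (s u : R) (x y z : 'rV[R]_d).
Variable p : R -> 'rV[R]_d -> R.
Hypothesis mp : measurable_fun setT (fun q : R * 'rV[R]_d => p q.1 q.2).
Hypothesis p_gt0 : forall s x, 0 < s -> 0 < p s x.
Hypothesis pN : forall s x, p s (- x) = p s x.
Hypothesis chapman_kolmogorov : forall s r y, 0 < s -> 0 < r ->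
  (\int[mu]_z (p s z * p r (y - z))%:E = (p (s + r) y)%:E)%E.

Let p_ge0 s x : 0 < s -> 0 <= p s x. Proof. by move=> s0; exact/ltW/p_gt0. Qed.
Let p0_gt0 : 0 < p t 0. Proof. exact: p_gt0. Qed.

(** Open at both ends, because the marginal densities are available only for 0 < s < t. *)
Let J : set (measurableTypeR R) := `]0, t[%classic.
Let mJ : measurable J. Proof. exact: measurable_itv. Qed.
Let JE : lebesgue_measure J = t%:E.
Proof. by rewrite /J lebesgue_measure_itv/= lte_fin t_gt0 -EFinB subr0. Qed.
Let Joo : (lebesgue_measure J < +oo)%E. Proof. by rewrite JE ltry. Qed.

Definition time_measure : {finite_measure set (measurableTypeR R) -> \bar R} :=
  restricted_measure mJ Joo.
Local Notation nu := time_measure.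

Lemma time_measureT : nu setT = t%:E.
Proof. exact: (etrans (restricted_measureT mJ Joo) JE). Qed.

Let measurable_p_comp dd (T : measurableType dd) (f : T -> R) (g : T -> 'rV[R]_d) :
  measurable_fun setT f -> measurable_fun setT g ->
  measurable_fun setT (fun w => p (f w) (g w)).
Proof.
move=> mf mg; have mfg : measurable_fun setT (fun w => (f w, g w)).
  exact: measurable_fun_pair.
exact: (measurableT_comp mp mfg).
Qed.

(** This and [loop_density2] are the bridge densities at one and two times in the case y = x. *)
Definition loop_density1 s x z : R :=
  (p t 0)^-1 * (p s (z - x) * p (t - s) (x - z)).

Definition loop_density2 u s x z1 z2 : R :=
  (p t 0)^-1 * (p u (z1 - x) * (p (s - u) (z2 - z1) * p (t - s) (x - z2))).

Lemma loop_density1_ge0 s x z : 0 < s < t -> 0 <= loop_density1 s x z.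
Proof.
move=> /andP[s0 st]; rewrite mulr_ge0 ?invr_ge0 ?p_ge0// mulr_ge0// p_ge0//.
by rewrite subr_gt0.
Qed.

(** The integration is over the base point x, not over z: translated by z it is the convolution of
    p_s and p_(t-s) at 0, that is p_t(0). *)
Lemma integral_loop_density1 s z : 0 < s < t ->
  (\int[mu]_x (loop_density1 s x z)%:E = 1)%E.
Proof.
move=> /[dup] st /andP[s0 s_t]; have ts0 : 0 < t - s by rewrite subr_gt0.
have mk : measurable_fun setT (fun x => (loop_density1 s x z)%:E).
  apply/measurable_EFinP; apply: measurable_funM => //.
  by apply: measurable_funM; apply: measurable_p_comp => //;
    apply: measurable_funB_rV.
rewrite -(ge0_integral_rVD z mk); last first.
  by move=> x; rewrite lee_fin loop_density1_ge0.
have mq : measurable_fun setT (fun x => (p s x * p (t - s) (0 - x))%:E).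
  apply/measurable_EFinP; apply: measurable_funM; apply: measurable_p_comp => //.
  exact: measurable_funB_rV.
rewrite (_ : integral _ _ _ = (p t 0)^-1%:E *
    \int[mu]_x (p s x * p (t - s) (0 - x))%:E)%E.
  rewrite (chapman_kolmogorov 0 s0 ts0) addrC subrK -EFinM mulVf//.
  by rewrite gt_eqF.
rewrite -ge0_integralZl//; last 2 first.
- by move=> x _; rewrite lee_fin mulr_ge0 ?p_ge0.
- by rewrite lee_fin invr_ge0 ltW.
apply: eq_integral => x _; rewrite -EFinM /loop_density1.
by rewrite addrK opprD addrCA subrr addr0 pN sub0r pN.
Qed.

Let mk1 : measurable_fun setT (fun q : ('rV[R]_d * R) * 'rV[R]_d =>
  loop_density1 q.1.2 q.1.1 q.2).
Proof.
apply: measurable_funM => //; apply: measurable_funM; apply: measurable_p_comp.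
- measurable_proj.
- by apply: measurable_funB_rV; measurable_proj.
- by apply: measurable_funB => //; measurable_proj.
- by apply: measurable_funB_rV; measurable_proj.
Qed.

Context disp (Omega : measurableType disp).
Variables (P : 'rV[R]_d -> probability Omega R) (X : R -> Omega -> 'rV[R]_d).
(* [Num.max 0] because the paths are only right continuous on [0, +oo[. *)
Hypothesis mX : measurable_fun setT (fun q : R * Omega => X (Num.max 0 q.1) q.2).
Hypothesis marginal1 : forall x s (psi : 'rV[R]_d -> R), 0 < s < t ->
  measurable_fun setT psi -> (forall z, 0 <= psi z) ->
  (\int[P x]_w (psi (X s w))%:E =
   \int[mu]_z (psi z * loop_density1 s x z)%:E)%E.
Hypothesis marginal2 : forall x u s (psi : 'rV[R]_d * 'rV[R]_d -> R),
  0 < u -> u < s -> s < t ->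
  measurable_fun setT psi -> (forall q, 0 <= psi q) ->
  (\int[P x]_w (psi (X u w, X s w))%:E =
   \int[mu]_z1 \int[mu]_z2 (psi (z1, z2) * loop_density2 u s x z1 z2)%:E)%E.

Let J_max s : J s -> Num.max 0 s = s.
Proof. by rewrite /J/= in_itv/= => /andP[s0 _]; apply/max_r/ltW. Qed.

Section marginal.
Variable psi : 'rV[R]_d -> R.
Hypotheses (mpsi : measurable_fun setT psi) (psi0 : forall z, 0 <= psi z).

(** The absolute value gives nonnegativity at all real times, as Tonelli over the whole type asks;
    inside [J] it changes nothing. *)
Let f1 (q : ('rV[R]_d * R) * 'rV[R]_d) : \bar R :=
  (psi q.2 * `|loop_density1 q.1.2 q.1.1 q.2|)%:E.

Let mf1 : measurable_fun setT f1.
Proof.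
apply/measurable_EFinP; apply: measurable_funM.
  by apply: (measurableT_comp mpsi); measurable_proj.
exact: measurableT_comp.
Qed.

Let f1_ge0 q : (0 <= f1 q)%E. Proof. by rewrite lee_fin mulr_ge0. Qed.

Let G (q : 'rV[R]_d * R) : \bar R := (\int[mu]_z f1 (q, z))%E.

Let mG : measurable_fun setT G.
Proof. exact: (measurable_fun_fubini_tonelli_F (m2 := mu) f1). Qed.

Let G_ge0 q : (0 <= G q)%E. Proof. exact: integral_ge0. Qed.

(** Equals the time integral of the expectation of psi(X_s) under [P x], but is written with the
    density alone and is therefore measurable in x. *)
Definition time_marginal x : \bar R := (\int[nu]_s G (x, s))%E.

Lemma measurable_time_marginal : measurable_fun setT time_marginal.
Proof.
by apply: (measurable_fun_fubini_tonelli_F (T2 := measurableTypeR R) (m2 := nu) G).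
Qed.

Lemma time_marginal_ge0 x : (0 <= time_marginal x)%E.
Proof. exact: integral_ge0. Qed.

Lemma time_marginalE x :
  (\int[nu]_s \int[P x]_w (psi (X (Num.max 0 s) w))%:E = time_marginal x)%E.
Proof.
apply: (ge0_eq_integral_restricted mJ Joo).
- apply: (measurable_fun_fubini_tonelli_F (T1 := measurableTypeR R) (m2 := P x)
    (fun q => (psi (X (Num.max 0 q.1) q.2))%:E)).
    by apply/measurable_EFinP; exact: (measurableT_comp mpsi mX).
  by move=> q; rewrite lee_fin.
- exact: (measurableT_comp mG (measurable_pair1 x)).
- by move=> s; apply: integral_ge0 => w _; rewrite lee_fin.
- by move=> s; exact: G_ge0.
move=> s Js; rewrite (J_max Js); have := Js; rewrite /J/= in_itv/= => s0t.
rewrite (marginal1 _ s0t mpsi psi0); apply: eq_integral => z _.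
by rewrite /f1/= ger0_norm// loop_density1_ge0.
Qed.

Lemma integral_time_marginal :
  (\int[mu]_x time_marginal x = t%:E * \int[mu]_z (psi z)%:E)%E.
Proof.
rewrite /time_marginal.
rewrite (fubini_tonelli (T2 := measurableTypeR R) (m1 := mu) (m2 := nu) G mG G_ge0).
transitivity (\int[nu]_s (\int[mu]_z (psi z)%:E))%E; last first.
  rewrite integral_cst//.
  by rewrite [X in (_ * X)%E]time_measureT muleC.
apply: (ge0_eq_integral_restricted mJ Joo).
- exact: (measurable_fun_fubini_tonelli_G (T2 := measurableTypeR R) (m1 := mu) G).
- exact: measurable_cst.
- by move=> s; exact: integral_ge0.
- by move=> s; apply: integral_ge0 => z _; rewrite lee_fin.
move=> s; rewrite /J/= in_itv/= => s0t.
pose g (q : 'rV[R]_d * 'rV[R]_d) : \bar R := f1 (q.1, s, q.2).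
have mg : measurable_fun setT g.
  apply: (measurableT_comp mf1); apply: measurable_fun_pair; last by measurable_proj.
  by apply: measurable_fun_pair; [measurable_proj|exact: measurable_cst].
rewrite (fubini_tonelli (m1 := mu) (m2 := mu) g mg); last by move=> q; exact: f1_ge0.
apply: eq_integral => z _; rewrite /g /f1/=.
rewrite -[RHS]mule1 -(integral_loop_density1 z s0t) -ge0_integralZl//.
- by apply: eq_integral => x _; rewrite -EFinM ger0_norm// loop_density1_ge0.
- have mxsz : measurable_fun setT (fun x : 'rV[R]_d => ((x, s), z)).
    by apply: measurable_fun_pair => //; exact: measurable_fun_pair.
  by apply/measurable_EFinP; exact: (measurableT_comp mk1 mxsz).
- by move=> x _; rewrite lee_fin loop_density1_ge0.
- by rewrite lee_fin.
Qed.

End marginal.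

Variables (V : 'rV[R]_d -> R) (M gamma L N1 : R).
Hypotheses (mV : measurable_fun setT V) (gamma_gt0 : 0 < gamma) (M_gt0 : 0 < M).
Hypothesis VH : forall x y, `|V x - V y| <= M * enorm (x - y) `^ gamma.
Hypothesis N1E : (\int[mu]_z (`|V z|)%:E = N1%:E)%E.
Hypothesis loop_bound : forall r, 0 < r < t ->
  (\int[mu]_z (enorm z `^ gamma * (p r z * p (t - r) z))%:E <= L%:E)%E.

Let menorm_powR : measurable_fun setT (fun z : 'rV[R]_d => enorm z `^ gamma).
Proof. exact: (measurableT_comp (measurable_powR _) measurable_enorm). Qed.

Let mabsV : measurable_fun setT (fun z => `|V z|).
Proof. exact: measurableT_comp. Qed.

(** The two summands contribute equally by Tonelli and the symmetry of k, and each factorizes by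
    translation invariance. *)
Lemma integral_symmetric_convolution (k : 'rV[R]_d -> R) :
  measurable_fun setT k -> (forall y, 0 <= k y) -> (forall y, k (- y) = k y) ->
  (\int[mu]_z1 \int[mu]_z2 ((`|V z1| + `|V z2|) * k (z1 - z2))%:E =
   (2 * N1)%:E * \int[mu]_y (k y)%:E)%E.
Proof.
move=> mk k0 kN.
have mkD : measurable_fun setT (fun q : 'rV[R]_d * 'rV[R]_d => k (q.1 - q.2)).
  by apply: (measurableT_comp mk); apply: measurable_funB_rV; measurable_proj.
have mF : measurable_fun setT
    (fun q : 'rV[R]_d * 'rV[R]_d => (`|V q.1| * k (q.1 - q.2))%:E).
  apply/measurable_EFinP; apply: measurable_funM => //.
  by apply: (measurableT_comp mabsV); measurable_proj.
have F0 (q : 'rV[R]_d * 'rV[R]_d) : (0 <= (`|V q.1| * k (q.1 - q.2))%:E)%E.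
  by rewrite lee_fin mulr_ge0.
have mF2 : measurable_fun setT
    (fun q : 'rV[R]_d * 'rV[R]_d => (`|V q.2| * k (q.1 - q.2))%:E).
  apply/measurable_EFinP; apply: measurable_funM => //.
  by apply: (measurableT_comp mabsV); measurable_proj.
have F20 (q : 'rV[R]_d * 'rV[R]_d) : (0 <= (`|V q.2| * k (q.1 - q.2))%:E)%E.
  by rewrite lee_fin mulr_ge0.
have mEk : measurable_fun setT (EFin \o k) by exact/measurable_EFinP.
have shiftk y : (\int[mu]_z (k (y - z))%:E = \int[mu]_z (k z)%:E)%E.
  rewrite -[RHS](ge0_integral_rVD (- y) mEk); last by move=> z; rewrite lee_fin.
  by apply: eq_integral => z _; rewrite /= -kN opprB.
have A1 : (\int[mu]_z1 \int[mu]_z2 (`|V z1| * k (z1 - z2))%:E =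
    N1%:E * \int[mu]_y (k y)%:E)%E.
  have mVE : measurable_fun setT (fun z => (`|V z|)%:E) by exact/measurable_EFinP.
  have Ik0 : (0 <= \int[mu]_z (k z)%:E)%E.
    by apply: integral_ge0 => z _; rewrite lee_fin.
  rewrite -N1E -ge0_integralZr//.
  apply: eq_integral => z1 _; rewrite -(shiftk z1) -ge0_integralZl//.
  - by apply/measurable_EFinP; exact: (measurableT_comp mkD (measurable_pair1 z1)).
  - by move=> z _; rewrite lee_fin.
have A2 : (\int[mu]_z1 \int[mu]_z2 (`|V z2| * k (z1 - z2))%:E =
    N1%:E * \int[mu]_y (k y)%:E)%E.
  rewrite (fubini_tonelli (m1 := mu) (m2 := mu) _ mF2 F20) -A1.
  apply: eq_integral => z1 _; apply: eq_integral => z2 _.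
  by rewrite /= -kN opprB.
rewrite mulr_natl mulr2n EFinD ge0_muleDl ?lee_fin; last 2 first.
- by rewrite -lee_fin -N1E integral_ge0// => z _; rewrite lee_fin.
- by rewrite -lee_fin -N1E integral_ge0// => z _; rewrite lee_fin.
rewrite -{1}A1 -A2 -ge0_integralD//.
- apply: eq_integral => z1 _.
  rewrite -(@ge0_integralD _ _ _ mu setT measurableT
    (fun z2 => (`|V z1| * k (z1 - z2))%:E) (fun z2 => (`|V z2| * k (z1 - z2))%:E)
    (fun z2 _ => F0 (z1, z2)) (measurableT_comp mF (measurable_pair1 z1))
    (fun z2 _ => F20 (z1, z2)) (measurableT_comp mF2 (measurable_pair1 z1))).
  by apply: eq_integral => z2 _; rewrite -EFinD mulrDl.
- by move=> z1 _; apply: integral_ge0 => z2 _; exact: (F0 (z1, z2)).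
- exact: (measurable_fun_fubini_tonelli_F (m2 := mu) _ mF).
- by move=> z1 _; apply: integral_ge0 => z2 _; exact: (F20 (z1, z2)).
- exact: (measurable_fun_fubini_tonelli_F (m2 := mu) _ mF2).
Qed.

Let W z1 z2 : R := M * enorm (z1 - z2) `^ gamma * (`|V z1| + `|V z2|).

Let W_ge0 z1 z2 : 0 <= W z1 z2.
Proof. by rewrite mulr_ge0 ?addr_ge0// mulr_ge0 ?powR_ge0// ltW. Qed.

Let sqr_increment_le z1 z2 : (V z1 - V z2) ^+ 2 <= W z1 z2.
Proof.
rewrite -real_normK ?num_real// expr2 ler_pM// ?VH//.
exact: ler_normB.
Qed.

Let mW : measurable_fun setT (fun q : 'rV[R]_d * 'rV[R]_d => W q.1 q.2).
Proof.
apply: measurable_funM.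
  apply: measurable_funM => //; apply: (measurableT_comp menorm_powR).
  by apply: measurable_funB_rV; measurable_proj.
by apply: measurable_funD; apply: (measurableT_comp mabsV); measurable_proj.
Qed.

Let mld2 dd (T : measurableType dd) (fu fs : T -> R) (fx f1 f2 : T -> 'rV[R]_d) :
  measurable_fun setT fu -> measurable_fun setT fs -> measurable_fun setT fx ->
  measurable_fun setT f1 -> measurable_fun setT f2 ->
  measurable_fun setT (fun w => loop_density2 (fu w) (fs w) (fx w) (f1 w) (f2 w)).
Proof.
move=> mfu mfs mfx mf1 mf2; apply: measurable_funM => //.
apply: measurable_funM.
  by apply: measurable_p_comp => //; exact: measurable_funB_rV.
apply: measurable_funM; apply: measurable_p_comp.
- exact: measurable_funB.
- exact: measurable_funB_rV.
- exact: measurable_funB.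
- exact: measurable_funB_rV.
Qed.

Lemma loop_density2_ge0 u s x z1 z2 : 0 < u -> u < s -> s < t ->
  0 <= loop_density2 u s x z1 z2.
Proof.
move=> u0 us st; rewrite mulr_ge0 ?invr_ge0 ?p_ge0// mulr_ge0 ?p_ge0//.
by rewrite mulr_ge0 ?p_ge0// subr_gt0.
Qed.

Lemma integral_loop_density2 u s : 0 < u -> u < s -> s < t ->
  (\int[mu]_x \int[mu]_z1 \int[mu]_z2 (W z1 z2 * loop_density2 u s x z1 z2)%:E <=
   (2 * N1 * (M / p t 0 * L))%:E)%E.
Proof.
move=> u0 us st; have ts0 : 0 < t - s by rewrite subr_gt0.
have rt : 0 < s - u < t by rewrite subr_gt0 us/=; lra.
have su0 : 0 < s - u by rewrite subr_gt0.
pose F (q : ('rV[R]_d * 'rV[R]_d) * 'rV[R]_d) : \bar R :=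
  (W q.1.2 q.2 * loop_density2 u s q.1.1 q.1.2 q.2)%:E.
have mF : measurable_fun setT F.
  apply/measurable_EFinP; apply: measurable_funM; last first.
    by apply: mld2 => //; measurable_proj.
  have m2 : measurable_fun setT
      (fun q : ('rV[R]_d * 'rV[R]_d) * 'rV[R]_d => (q.1.2, q.2)).
    by apply: measurable_fun_pair; measurable_proj.
  exact: (measurableT_comp mW m2).
have F0 q : (0 <= F q)%E by rewrite lee_fin mulr_ge0// loop_density2_ge0.
pose G (q : 'rV[R]_d * 'rV[R]_d) : \bar R := (\int[mu]_z2 F (q, z2))%E.
have mG : measurable_fun setT G.
  exact: (measurable_fun_fubini_tonelli_F (m2 := mu) F mF F0).
have G0 q : (0 <= G q)%E by exact: integral_ge0.
rewrite (fubini_tonelli (m1 := mu) (m2 := mu) G mG G0) /G.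
pose k y := M / p t 0 * (enorm y `^ gamma * (p (s - u) y * p (t - (s - u)) y)).
have mp1 r : measurable_fun setT (p r) by apply: measurable_p_comp.
have mk0 : measurable_fun setT (fun y =>
    enorm y `^ gamma * (p (s - u) y * p (t - (s - u)) y)).
  by apply: measurable_funM => //; exact: measurable_funM.
have mk : measurable_fun setT k by exact: measurable_funM.
have k00 y : 0 <= enorm y `^ gamma * (p (s - u) y * p (t - (s - u)) y).
  by rewrite mulr_ge0 ?powR_ge0// mulr_ge0 ?p_ge0// subr_gt0; case/andP: rt.
have c0 : 0 <= M / p t 0 by rewrite divr_ge0 ?p_ge0// ltW.
have k0 y : 0 <= k y by rewrite mulr_ge0.
have kN y : k (- y) = k y by rewrite /k enormN !pN.
have N10 : 0 <= N1 by rewrite -lee_fin -N1E integral_ge0// => z _; rewrite lee_fin.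
rewrite (_ : integral _ _ _ =
    \int[mu]_z1 \int[mu]_z2 ((`|V z1| + `|V z2|) * k (z1 - z2))%:E)%E.
  rewrite (integral_symmetric_convolution mk k0 kN) [leRHS]EFinM.
  rewrite lee_wpmul2l ?lee_fin ?mulr_ge0// /k EFinM.
  under eq_integral do rewrite EFinM.
  rewrite ge0_integralZl//; [|exact/measurable_EFinP|by move=> y _; rewrite lee_fin].
  by rewrite lee_wpmul2l ?lee_fin// loop_bound.
apply: eq_integral => z1 _.
have mF1 : measurable_fun setT (fun q : 'rV[R]_d * 'rV[R]_d => F (q.1, z1, q.2)).
  apply: (measurableT_comp mF); apply: measurable_fun_pair; last by measurable_proj.
  by apply: measurable_fun_pair; [measurable_proj|exact: measurable_cst].
rewrite (fubini_tonelli (m1 := mu) (m2 := mu) _ mF1 (fun _ => F0 _)).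
apply: eq_integral => z2 _; rewrite /F/=.
pose g x := p u (z1 - x) * p (t - s) (x - z2).
have mg : measurable_fun setT g.
  by apply: measurable_funM; apply: measurable_p_comp => //; exact: measurable_funB_rV.
have g0 x : (0 <= (g x)%:E)%E by rewrite lee_fin mulr_ge0 ?p_ge0.
have mgE : measurable_fun setT (EFin \o g) by exact/measurable_EFinP.
(* Integrating out the base point joins the arcs before u and after s into one arc of length t - (s
   - u); what remains depends on z1 - z2 only. *)
have Ig : (\int[mu]_x (g x)%:E = (p (t - s + u) (z1 - z2))%:E)%E.
  rewrite -chapman_kolmogorov// -(ge0_integral_rVD z2 mgE g0).
  apply: eq_integral => x _; rewrite /g/= addrK mulrC.
  by rewrite opprD addrA addrAC.
pose c := W z1 z2 * (p t 0)^-1 * p (s - u) (z2 - z1).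
have c1 : 0 <= c by rewrite mulr_ge0 ?p_ge0// mulr_ge0// invr_ge0 p_ge0.
transitivity (\int[mu]_x (c%:E * (g x)%:E))%E.
  apply: (@eq_integral _ _ _ mu) => x _; rewrite -EFinM; apply: (congr1 EFin).
  rewrite /g /loop_density2 /c/=.
  by move: (W _ _) (p t 0) (p u _) (p (s - u) _) (p (t - s) _) => a1 a2 a3 a4 a5; ring.
rewrite ge0_integralZl ?lee_fin//.
rewrite Ig -EFinM; congr EFin; rewrite /c /W /k.
have -> : p (s - u) (z2 - z1) = p (s - u) (z1 - z2) by rewrite -pN opprB.
have -> : t - (s - u) = t - s + u by ring.
by move: (p _ _) (p _ _) (p _ _) => a1 a2 a3; ring.
Qed.

(** At equal times the middle kernel would be taken at time 0, whereas the increment is 0 there; the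
    diagonal is given the value 0. *)
Let offdiag : set (R * R) := ~` ((fun q => q.1 - q.2) @^-1` [set 0]).

Let moffdiag : measurable offdiag.
Proof.
apply: measurableC; rewrite -[X in measurable X]setTI.
have m : measurable_fun setT (fun q : R * R => q.1 - q.2).
  by apply: measurable_funB; measurable_proj.
by apply: m => //; exact: measurable_set1.
Qed.

(* The indicator and the absolute value make [phi] nonnegative everywhere; they only
   act at the times where [loop_density2] is not a density. *)
Let phi (r : (('rV[R]_d * (R * R)) * 'rV[R]_d) * 'rV[R]_d) : \bar R :=
  (\1_offdiag r.1.1.2 * (W r.1.2 r.2 *
    `|loop_density2 (Num.min r.1.1.2.1 r.1.1.2.2) (Num.max r.1.1.2.1 r.1.1.2.2)
       r.1.1.1 r.1.2 r.2|))%:E.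

Let mphi : measurable_fun setT phi.
Proof.
apply/measurable_EFinP; apply: measurable_funM.
  apply: (measurableT_comp (measurable_indic moffdiag)); measurable_proj.
apply: measurable_funM.
  have m2 : measurable_fun setT
      (fun q : (('rV[R]_d * (R * R)) * 'rV[R]_d) * 'rV[R]_d => (q.1.2, q.2)).
    by apply: measurable_fun_pair; measurable_proj.
  exact: (measurableT_comp mW m2).
apply: measurableT_comp => //; apply: mld2.
- by apply: measurable_minr; measurable_proj.
- by apply: measurable_maxr; measurable_proj.
- measurable_proj.
- measurable_proj.
- measurable_proj.
Qed.

Let phi_ge0 r : (0 <= phi r)%E. Proof. by rewrite lee_fin mulr_ge0// mulr_ge0. Qed.

Let phi1 q : \bar R := (\int[mu]_z2 phi (q, z2))%E.
Let mphi1 : measurable_fun setT phi1.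
Proof. exact: (measurable_fun_fubini_tonelli_F (m2 := mu) phi mphi phi_ge0). Qed.
Let phi1_ge0 q : (0 <= phi1 q)%E. Proof. exact: integral_ge0. Qed.

Let phi2 q : \bar R := (\int[mu]_z1 phi1 (q, z1))%E.
Let mphi2 : measurable_fun setT phi2.
Proof. exact: (measurable_fun_fubini_tonelli_F (m2 := mu) phi1 mphi1 phi1_ge0). Qed.
Let phi2_ge0 q : (0 <= phi2 q)%E. Proof. exact: integral_ge0. Qed.

Let mphi2' : measurable_fun setT (fun q : ('rV[R]_d * R) * R =>
  phi2 (q.1.1, (q.1.2, q.2))).
Proof.
apply: (measurableT_comp mphi2); apply: measurable_fun_pair; first measurable_proj.
by apply: measurable_fun_pair; measurable_proj.
Qed.

Let phi3 (q : 'rV[R]_d * R) : \bar R := (\int[nu]_u phi2 (q.1, (q.2, u)))%E.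
Let mphi3 : measurable_fun setT phi3.
Proof.
exact: (measurable_fun_fubini_tonelli_F (T2 := measurableTypeR R) (m2 := nu) _
  mphi2' (fun _ => phi2_ge0 _)).
Qed.
Let phi3_ge0 q : (0 <= phi3 q)%E. Proof. exact: integral_ge0. Qed.

(** Plays for pairs of times the role of [time_marginal]: a majorant measurable in x. It is
    controlled after integration in x and may be infinite at some points. *)
Definition increment_bound x : \bar R := (\int[nu]_s phi3 (x, s))%E.

Lemma measurable_increment_bound : measurable_fun setT increment_bound.
Proof.
exact: (measurable_fun_fubini_tonelli_F (T2 := measurableTypeR R) (m2 := nu) phi3
  mphi3 phi3_ge0).
Qed.

Lemma increment_bound_ge0 x : (0 <= increment_bound x)%E.
Proof. exact: integral_ge0. Qed.

Let phi2_lt u s x : 0 < u -> u < s -> s < t ->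
  (phi2 (x, (u, s)) = \int[mu]_z1 \int[mu]_z2
    (W z1 z2 * loop_density2 u s x z1 z2)%:E)%E.
Proof.
move=> u0 us st; apply: eq_integral => z1 _; apply: eq_integral => z2 _.
rewrite /phi/= indicE mem_set ?mul1r; last first.
  by rewrite /offdiag/= => /eqP; rewrite subr_eq0 lt_eqF.
by rewrite min_l ?max_r ?(ltW us)// ger0_norm// loop_density2_ge0.
Qed.

Let phi2_gt u s x : 0 < u -> u < s -> s < t -> phi2 (x, (s, u)) = phi2 (x, (u, s)).
Proof.
move=> u0 us st; apply: eq_integral => z1 _; apply: eq_integral => z2 _.
rewrite /phi/= minC maxC !indicE; congr ((_ %:R * _)%:E).
by rewrite !mem_set// /offdiag/= => /eqP; rewrite subr_eq0 ?(lt_eqF us) ?(gt_eqF us).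
Qed.

Let psi (q : 'rV[R]_d * 'rV[R]_d) := (V q.1 - V q.2) ^+ 2.

Let mpsi : measurable_fun setT psi.
Proof.
apply: measurable_funX; apply: measurable_funB;
  by apply: (measurableT_comp mV); measurable_proj.
Qed.

Let increment_le x u s : 0 < u -> u < s -> s < t ->
  (\int[P x]_w ((V (X u w) - V (X s w)) ^+ 2)%:E <= phi2 (x, (u, s)))%E.
Proof.
move=> u0 us st; rewrite phi2_lt//.
have := marginal2 x u0 us st mpsi (fun _ => sqr_ge0 _); rewrite /psi/= => ->.
have l0 z1 z2 : 0 <= loop_density2 u s x z1 z2 by exact: loop_density2_ge0.
apply: (ge0_le_integral_any mu) => z1.
  by apply: (@integral_ge0 _ _ _ mu) => z2 _; rewrite lee_fin mulr_ge0// sqr_ge0.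
apply: (ge0_le_integral_any mu) => z2; rewrite lee_fin; first by rewrite mulr_ge0// sqr_ge0.
by rewrite ler_wpM2r.
Qed.

Lemma increment_bound_le x :
  (\int[nu]_s \int[nu]_u \int[P x]_w
     ((V (X (Num.max 0 s) w) - V (X (Num.max 0 u) w)) ^+ 2)%:E <=
   increment_bound x)%E.
Proof.
pose E (q : R * R) : \bar R := (\int[P x]_w
     ((V (X (Num.max 0 q.1) w) - V (X (Num.max 0 q.2) w)) ^+ 2)%:E)%E.
have mE : measurable_fun setT E.
  apply: (measurable_fun_fubini_tonelli_F (T1 := (R * R)%type) (m2 := P x)
    (fun q => ((V (X (Num.max 0 q.1.1) q.2) - V (X (Num.max 0 q.1.2) q.2)) ^+ 2)%:E)).
    apply/measurable_EFinP; apply: measurable_funX; apply: measurable_funB.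
      have m1 : measurable_fun setT (fun q : (R * R) * Omega => (q.1.1, q.2)).
        by apply: measurable_fun_pair; measurable_proj.
      exact: (measurableT_comp mV (measurableT_comp mX m1)).
    have m1 : measurable_fun setT (fun q : (R * R) * Omega => (q.1.2, q.2)).
      by apply: measurable_fun_pair; measurable_proj.
    exact: (measurableT_comp mV (measurableT_comp mX m1)).
  by move=> q; rewrite lee_fin sqr_ge0.
have E0 q : (0 <= E q)%E by apply: integral_ge0 => w _; rewrite lee_fin sqr_ge0.
apply: (ge0_le_integral_restricted mJ Joo).
- exact: (measurable_fun_fubini_tonelli_F (T1 := measurableTypeR R)
    (T2 := measurableTypeR R) (m2 := nu) E mE E0).
- exact: (measurableT_comp mphi3 (measurable_pair1 x)).
- by move=> s; apply: integral_ge0 => u _; exact: (E0 (s, u)).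
- by move=> s; exact: phi3_ge0.
move=> s Js; apply: (ge0_le_integral_restricted mJ Joo).
- exact: (measurableT_comp mE (measurable_pair1 s)).
- exact: (measurableT_comp mphi2' (measurable_pair1 (x, s))).
- by move=> u; exact: (E0 (s, u)).
- by move=> u; exact: phi2_ge0.
move=> u Ju; rewrite (J_max Js) (J_max Ju).
have := Js; have := Ju; rewrite /J/= !in_itv/= => /andP[u0 ut] /andP[s0 st].
have [su|us|->] := ltgtP s u.
- exact: increment_le.
- rewrite phi2_gt//; apply: le_trans (increment_le x u0 us st).
  rewrite le_eqVlt; apply/orP; left; apply/eqP; apply: eq_integral => w _.
  by rewrite -sqrrN opprB.
- by rewrite integral0_eq ?phi2_ge0// => w _; rewrite subrr expr0n.
Qed.

Lemma integral_increment_bound :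
  (\int[mu]_x increment_bound x <=
   (2 * N1 * (M / p t 0 * L) * t ^+ 2)%:E)%E.
Proof.
set c := 2 * N1 * (M / p t 0 * L).
have c0 : 0 <= c.
  (* An interior time, at which [loop_bound] shows that [L] is nonnegative. *)
  have t2 : 0 < t / 2 < t.
    by rewrite divr_gt0// ltr_pdivrMr// ltr_pMr// ltr1n.
  have L0 : 0 <= L.
    rewrite -lee_fin; apply: le_trans (loop_bound t2); apply: integral_ge0 => z _.
    by case/andP: t2 => t20 t21; rewrite lee_fin mulr_ge0 ?powR_ge0// mulr_ge0 ?p_ge0// subr_gt0.
  have N10 : 0 <= N1 by rewrite -lee_fin -N1E integral_ge0// => z _; rewrite lee_fin.
  have Mp : 0 <= M / p t 0 by rewrite divr_ge0 ?p_ge0// ltW.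
  by apply: mulr_ge0; apply: mulr_ge0.
rewrite (fubini_tonelli (T2 := measurableTypeR R) (m1 := mu) (m2 := nu) phi3 mphi3 phi3_ge0).
apply: (@le_trans _ _ (\int[nu]_s (c * t)%:E)%E); last first.
  by rewrite integral_cst// [X in (_ * X)%E]time_measureT -EFinM -mulrA -expr2.
apply: (ge0_le_integral_restricted mJ Joo).
- exact: (measurable_fun_fubini_tonelli_G (T2 := measurableTypeR R) (m1 := mu)
    phi3 mphi3 phi3_ge0).
- exact: measurable_cst.
- by move=> s; exact: integral_ge0.
- by move=> s; rewrite lee_fin mulr_ge0// ltW.
move=> s Js.
have mphi2s : measurable_fun setT (fun q : 'rV[R]_d * R => phi2 (q.1, (s, q.2))).
  apply: (measurableT_comp mphi2); apply: measurable_fun_pair; first measurable_proj.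
  by apply: measurable_fun_pair; [exact: measurable_cst|measurable_proj].
rewrite (fubini_tonelli (T2 := measurableTypeR R) (m1 := mu) (m2 := nu) _ mphi2s
  (fun _ => phi2_ge0 _)).
apply: (@le_trans _ _ (\int[nu]_s c%:E)%E); last first.
  by rewrite integral_cst// [X in (_ * X)%E]time_measureT -EFinM.
apply: (ge0_le_integral_restricted mJ Joo).
- exact: (measurable_fun_fubini_tonelli_G (T2 := measurableTypeR R) (m1 := mu)
    _ mphi2s (fun _ => phi2_ge0 _)).
- exact: measurable_cst.
- by move=> u; exact: integral_ge0.
- by move=> u; rewrite lee_fin.
move=> u Ju.
have := Js; have := Ju; rewrite /J/= !in_itv/= => /andP[u0 ut] /andP[s0 st].
have [su|us|->] := ltgtP s u.
- rewrite (eq_integral (mu := mu) _ _ (fun x _ => phi2_lt x s0 su ut)).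
  exact: integral_loop_density2.
- rewrite (eq_integral (mu := mu) _ _ (fun x _ => etrans (phi2_gt x u0 us st)
    (phi2_lt x u0 us st))).
  exact: integral_loop_density2.
- rewrite (@integral0_eq _ _ _ mu) ?lee_fin// => x _.
  apply: integral0_eq => z1 _; apply: integral0_eq => z2 _.
  rewrite /phi/= indicE memNset ?mul0r// /offdiag/=.
  by apply; rewrite subrr.
Qed.

Variable N : R.
Hypothesis VN : forall z, `|V z| <= N.

Let nuT : fine (nu setT) = t. Proof. by rewrite time_measureT. Qed.

Let incr := incr_part nu.
Let vpath (q : measurableTypeR R * Omega) := V (X (Num.max 0 q.1) q.2).
Let mvpath : measurable_fun setT vpath. Proof. exact: (measurableT_comp mV mX). Qed.
Let N_ge0 : 0 <= N. Proof. exact: le_trans (VN 0). Qed.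

Let time_marginal_fin (psi1 : 'rV[R]_d -> R) b x : measurable_fun setT psi1 ->
  (forall z, 0 <= psi1 z <= b) -> time_marginal psi1 x \is a fin_num.
Proof.
move=> mpsi1 psib.
have psi1_ge0 z : 0 <= psi1 z by case/andP: (psib z).
rewrite ge0_fin_numE ?time_marginal_ge0// -time_marginalE//.
apply: (@le_lt_trans _ _ (\int[nu]_s b%:E)%E).
  apply: ge0_le_integral_any => s; first by apply: integral_ge0 => w _; rewrite lee_fin.
  apply: (@le_trans _ _ (\int[P x]_w b%:E)%E).
    apply: ge0_le_integral_any => w; rewrite lee_fin//.
    by case/andP: (psib (X (Num.max 0 s) w)).
  by rewrite integral_cst// [X in (_ * X)%E](probability_setT (P x)) mule1.
by rewrite integral_cst// [X in (_ * X)%E]time_measureT -EFinM ltry.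
Qed.

Let mdecr : measurable_fun setT (fun z => decr_part (V z)).
Proof. exact: (measurableT_comp measurable_decr_part mV). Qed.
Let mincr : measurable_fun setT (fun z => incr (V z)).
Proof. exact: (measurableT_comp (measurable_incr_part nu) mV). Qed.

Let decr_bound z : 0 <= decr_part (V z) <= `|V z|.
Proof. by rewrite decr_part_ge0 ge_max ler_norm normr_ge0. Qed.

Let incr_bound z : 0 <= incr (V z) <= (1 + t / 2 * N) * `|V z|.
Proof.
rewrite incr_part_ge0/= /incr /incr_part nuT mulrDl mul1r lerD//.
  by rewrite ge_max normr_ge0 -normrN ler_norm.
rewrite -[leRHS]mulrA ler_wpM2l ?divr_ge0 ?(ltW t_gt0)//.
by rewrite -real_normK ?num_real// expr2 ler_wpM2r.
Qed.

Let intabsV : mu.-integrable setT (fun z => (`|V z|)%:E).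
Proof.
apply/integrableP; split; first exact/measurable_EFinP.
by under eq_integral do rewrite abse_EFin normr_id; rewrite N1E ltry.
Qed.

Let intV : mu.-integrable setT (EFin \o V).
Proof.
apply: le_integrable intabsV => //; first exact/measurable_EFinP.
by move=> z _; rewrite /= normr_id.
Qed.

Let int_decr : mu.-integrable setT (fun z => (decr_part (V z))%:E).
Proof.
apply: le_integrable intabsV => //; first exact/measurable_EFinP.
by move=> z _; have /andP[d0 dV] := decr_bound z; rewrite /= lee_fin normr_id ger0_norm.
Qed.

Let int_incr : mu.-integrable setT (fun z => (incr (V z))%:E).
Proof.
apply: le_integrable (integrableZl measurableT (1 + t / 2 * N) intabsV) => //.
  exact/measurable_EFinP.
move=> z _; have /andP[i0 iV] := incr_bound z.
by rewrite -EFinM /= lee_fin (ger0_norm i0); apply: le_trans iV (ler_norm _).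
Qed.

Let int_sqrV : mu.-integrable setT (fun z => (V z ^+ 2)%:E).
Proof.
apply: le_integrable (integrableZl measurableT N intabsV) => //.
  by apply/measurable_EFinP; exact: measurable_funX.
move=> z _; rewrite -EFinM /= lee_fin normrX [leRHS]ger0_norm ?mulr_ge0//.
by rewrite expr2 ler_wpM2r.
Qed.

Let Rint_incr_decr : \int[mu]_z incr (V z) - \int[mu]_z decr_part (V z) =
  - (\int[mu]_z V z) + t / 2 * \int[mu]_z V z ^+ 2.
Proof.
rewrite -RintegralB// -RintegralZl// [RHS]addrC -RintegralB//; last first.
  exact: (integrableZl measurableT (t / 2) int_sqrV).
apply: eq_Rintegral => z _; rewrite /incr incr_decr_part nuT addrC//.
Qed.

Let int_time_marginal (psi1 : 'rV[R]_d -> R) b : measurable_fun setT psi1 ->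
  (forall z, 0 <= psi1 z <= b) -> mu.-integrable setT (fun z => (psi1 z)%:E) ->
  mu.-integrable setT (EFin \o (fun x => fine (time_marginal psi1 x))) /\
  \int[mu]_x fine (time_marginal psi1 x) = t * \int[mu]_z psi1 z.
Proof.
move=> mpsi1 psib ipsi1.
have psi1_ge0 z : 0 <= psi1 z by case/andP: (psib z).
have tmE : EFin \o (fun x => fine (time_marginal psi1 x)) = time_marginal psi1.
  by apply: funext => x; rewrite /= fineK// (time_marginal_fin _ mpsi1 psib).
rewrite tmE.
have mtm := measurable_time_marginal mpsi1 psi1_ge0.
have psi1oo : (\int[mu]_z (psi1 z)%:E < +oo)%E.
  have /integrableP[_] := ipsi1.
  by under eq_integral do rewrite abse_EFin ger0_norm//.
have psi1f : (\int[mu]_z (psi1 z)%:E)%E \is a fin_num.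
  by rewrite ge0_fin_numE//; apply: integral_ge0 => z _; rewrite lee_fin.
have E := integral_time_marginal mpsi1 psi1_ge0.
have itm : mu.-integrable setT (time_marginal psi1).
  apply/integrableP; split => //.
  under eq_integral do rewrite gee0_abs ?time_marginal_ge0//.
  by rewrite E -(fineK psi1f) -EFinM ltry.
split => //; rewrite /Rintegral -[X in fine (integral _ _ X) = _]/(EFin \o _) tmE E.
by rewrite -[X in (_ * X)%E](fineK psi1f) -EFinM.
Qed.

Let K := t ^+ 2 * N ^+ 2 * expR (t * N).
Let K_ge0 : 0 <= K. Proof. by rewrite mulr_ge0 ?expR_ge0// mulr_ge0 ?sqr_ge0. Qed.

(** The half-width of the enclosure of the trace integrand at x, with values in [0, +oo]. *)
Let remainder x : \bar R := ((p t 0)%:E *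
  (K%:E * time_marginal (fun z => `|V z|%R) x + 4^-1%:E * increment_bound x))%E.

Let mremainder : measurable_fun setT remainder.
Proof.
apply: measurable_funeM; apply: emeasurable_funD; apply: measurable_funeM.
  exact: measurable_time_marginal.
exact: measurable_increment_bound.
Qed.

Let remainder_ge0 x : (0 <= remainder x)%E.
Proof.
rewrite mule_ge0 ?lee_fin ?p_ge0// adde_ge0// mule_ge0 ?lee_fin ?increment_bound_ge0//.
exact: time_marginal_ge0.
Qed.

Let integral_remainder : (\int[mu]_x remainder x <=
  (p t 0 * (K * (t * N1) + 4^-1 * (2 * N1 * (M / p t 0 * L) * t ^+ 2)))%:E)%E.
Proof.
have mtm := measurable_time_marginal mabsV (fun z => normr_ge0 (V z)).
have tm0 := time_marginal_ge0 (fun z => normr_ge0 (V z)).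
have mib := measurable_increment_bound.
have ib0 := increment_bound_ge0.
rewrite /remainder ge0_integralZl//; first last.
- by rewrite lee_fin p_ge0.
- by move=> x _; rewrite adde_ge0// mule_ge0 ?lee_fin.
- by apply: emeasurable_funD; exact: measurable_funeM.
rewrite [leRHS]EFinM lee_wpmul2l ?lee_fin ?p_ge0//.
rewrite ge0_integralD//; first last.
- exact: measurable_funeM.
- by move=> x _; rewrite mule_ge0 ?lee_fin.
- exact: measurable_funeM.
- by move=> x _; rewrite mule_ge0 ?lee_fin.
rewrite ge0_integralZl// ge0_integralZl// integral_time_marginal// N1E EFinD !EFinM.
by rewrite leeD2l// lee_wpmul2l ?lee_fin// -!EFinM integral_increment_bound.
Qed.

Lemma loop_expansion :
  `|\int[mu]_x (p t 0 * fine (\int[P x]_w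
        (expR (- \int[nu]_s V (X (Num.max 0 s) w)))%:E)%E - p t 0) -
    p t 0 * (- t * \int[mu]_x V x + t ^+ 2 / 2 * \int[mu]_x V x ^+ 2)| <=
  p t 0 * (t ^+ 2 * N ^+ 2 * expR (t * N) * (t * N1) +
           4^-1 * (2 * N1 * (M / p t 0 * L) * t ^+ 2)).
Proof.
have decr_le z : 0 <= decr_part (V z) <= N.
  by have /andP[-> h] := decr_bound z; exact: le_trans h (VN z).
have incr_le z : 0 <= incr (V z) <= (1 + t / 2 * N) * N.
  have /andP[-> h] := incr_bound z; apply: le_trans h _.
  by rewrite ler_wpM2l// addr_ge0// mulr_ge0// divr_ge0// ltW.
have [ia Ia] := int_time_marginal mincr incr_le int_incr.
have [ib Ib] := int_time_marginal mdecr decr_le int_decr.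
set a := time_marginal (fun z => incr (V z)) in ia Ia.
set b := time_marginal (fun z => decr_part (V z)) in ib Ib.
(* The centre of the enclosure. Its integral is exactly the pair of main terms, since averaging over
   x turns each time marginal into t times a Lebesgue integral. *)
pose g x := p t 0 * (fine (a x) - fine (b x)).
have iab : mu.-integrable setT (EFin \o (fun x => fine (a x) - fine (b x))).
  have := integrableB measurableT ia ib.
  by congr (integrable _ _ _); apply: funext => x; rewrite /= EFinB.
have ig : mu.-integrable setT (EFin \o g).
  have := integrableZl measurableT (p t 0) iab.
  by congr (integrable _ _ _); apply: funext => x; rewrite /g /= -EFinM.
have Ig : \int[mu]_x g x =
    p t 0 * (- t * \int[mu]_x V x + t ^+ 2 / 2 * \int[mu]_x V x ^+ 2).
  rewrite /g RintegralZl//.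
  rewrite (RintegralB measurableT ia ib) Ia Ib -mulrBr Rint_incr_decr.
  by congr (_ * _); move: (Rintegral _ _ _) (Rintegral _ _ _) => i1 i2; field.
rewrite -Ig; apply: (@le_trans _ _ (fine (\int[mu]_x remainder x)%E)); last first.
  rewrite -lee_fin fineK ?integral_remainder//.
  rewrite ge0_fin_numE; first exact: le_lt_trans integral_remainder (ltry _).
  exact: integral_ge0.
pose c := time_marginal (fun z => `|V z|).
have absV_le z : 0 <= `|V z| <= N by rewrite normr_ge0 VN.
have aE x : (fine (a x))%:E = a x := fineK (time_marginal_fin x mincr incr_le).
have bE x : (fine (b x))%:E = b x := fineK (time_marginal_fin x mdecr decr_le).
have cE x : (fine (c x))%:E = c x := fineK (time_marginal_fin x mabsV absV_le).
have vN q : `|vpath q| <= N by exact: VN.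
have KE : taylor_const nu N = K by rewrite /taylor_const nuT.
have tmV x := time_marginalE mabsV (fun z => normr_ge0 (V z)) x.
have tma x := time_marginalE mincr (fun z => incr_part_ge0 nu (V z)) x.
have tmb x := time_marginalE mdecr (fun z => decr_part_ge0 (V z)) x.
pose U x := (\int[P x]_w (expR (- \int[nu]_s V (X (Num.max 0 s) w)))%:E)%E.
have upper x : (U x + b x <= 1 + a x + K%:E * c x)%E.
  have := expectation_expR_upper nu (P x) mvpath vN.
  by rewrite /vpath/= tmV tma tmb KE.
have lower x : (1 + a x <= U x + b x + (K%:E * c x + 4^-1%:E * increment_bound x))%E.
  have := expectation_expR_lower nu (P x) mvpath vN.
  rewrite /vpath/= tmV tma tmb KE => /le_trans; apply.
  apply: leeD2l; apply: leeD2l; apply: lee_wpmul2l; first by rewrite lee_fin.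
  exact: increment_bound_le.
have UE x : U x = (fine (U x))%:E.
  have U0 : (0 <= U x)%E by apply: integral_ge0 => w _; rewrite lee_fin expR_ge0.
  rewrite fineK// ge0_fin_numE//.
  have := upper x; rewrite -aE -bE -cE -EFinM -!EFinD.
  by case: (U x) U0 => // r _; rewrite ltry.
(* Where the remainder is infinite both inequalities of the enclosure are trivial; elsewhere all
   terms are real numbers. *)
have rE x : remainder x = +oo%E \/ exists2 D, increment_bound x = D%:E &
    remainder x = (p t 0 * (K * fine (c x) + 4^-1 * D))%:E.
  rewrite /remainder -/(c x) -cE.
  have := increment_bound_ge0 x; case: (increment_bound x) => // [D _|_].
    by right; exists D; rewrite // -!EFinM.
  by left; rewrite gt0_muley ?lte_fin ?invr_gt0// addey// gt0_muley ?lte_fin.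
have scale_le (q u1 a1 b1 e : R) : 0 <= q -> u1 + b1 <= 1 + a1 + e ->
    q * u1 - q <= q * (a1 - b1) + q * e.
  move=> q0 h; rewrite -subr_ge0 (_ : _ - _ = q * (1 + a1 + e - (u1 + b1))); last by ring.
  by rewrite mulr_ge0// subr_ge0.
have scale_ge (q u1 a1 b1 e : R) : 0 <= q -> 1 + a1 <= u1 + b1 + e ->
    q * (a1 - b1) <= q * u1 - q + q * e.
  move=> q0 h; rewrite -subr_ge0 (_ : _ - _ = q * (u1 + b1 + e - (1 + a1))); last by ring.
  by rewrite mulr_ge0// subr_ge0.
have q0 : 0 <= p t 0 := ltW p0_gt0.
apply: Rintegral_sandwich => //.
- exact: le_lt_trans integral_remainder (ltry _).
- move=> x; have [->|[D DE ->]] := rE x; first by rewrite addey// leey.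
  have := upper x; have := increment_bound_ge0 x.
  rewrite UE -aE -bE -cE DE -EFinM -!EFinD !lee_fin => D0 h.
  apply: scale_le q0 (le_trans h _); rewrite lerD2l lerDl; exact: mulr_ge0.
- move=> x; have [->|[D DE ->]] := rE x; first by rewrite addey// leey.
  have := lower x; rewrite UE -aE -bE -cE DE -!EFinM -!EFinD !lee_fin => h.
  exact: scale_ge q0 h.
Qed.

End loop_process.

(** Measurability and right continuity at time s are read off from a bridge of length s + 1, because
    a bridge of length t gives right continuity only before t. *)
Lemma measurable_bridge_process (R : realType) (d : nat) (alpha : R)
    disp (Omega : measurableType disp)
    (P : R -> 'rV[R]_d -> 'rV[R]_d -> probability Omega R)
    (X : R -> Omega -> 'rV[R]_d) :
  (forall t x y, 0 < t -> is_stable_bridge alpha (P t x y) X t x y) ->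
  measurable_fun setT (fun q : R * Omega => X (Num.max 0 q.1) q.2).
Proof.
move=> bridge; have s1_gt0 (s : R) : 0 <= s -> 0 < s + 1 by move=> s0; rewrite ltr_wpDl.
apply: measurable_fun_rV => i.
apply: (measurable_right_continuous (f := fun s w => X s w ord0 i)) => [s s0|w s s0].
  have [mX _ _ _] := bridge _ 0 0 (s1_gt0 s s0).
  apply: (measurableT_comp (measurable_coord i)).
  by apply: mX; rewrite s0 lerDl ler01.
have [_ cX _ _] := bridge _ 0 0 (s1_gt0 s s0); have [rc _] := cX w.
have rcs : X u w @[u --> s^'+] --> X s w by apply: rc; rewrite s0 ltrDl ltr01.
exact: cvg_comp rcs (@coord_continuous R 1 d ord0 i (X s w)).
Qed.

(** * From norms to pointwise bounds and integrals *)

Section Lfun_bounds.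
Context {R : realType} {d : nat} (V : 'rV[R]_d -> R).
Local Notation mu := (lebesgue_rV R d).

Lemma Lfun_measurable r : V \in Lfun mu r -> measurable_fun setT V.
Proof. by move=> /sub_Lfun_mfun; rewrite inE. Qed.

Lemma Lfun_finite_norm r : V \in Lfun mu r -> ('N[mu]_r[EFin \o V] < +oo)%E.
Proof. by move=> /sub_Lfun_finLfun; rewrite inE. Qed.

Lemma Lfun1_norm : V \in Lfun mu 1%E ->
  (\int[mu]_z (`|V z|)%:E = (fine 'N[mu]_1[EFin \o V])%:E)%E.
Proof.
move=> /Lfun_finite_norm; rewrite Lnorm1 => Voo; rewrite fineK//.
by rewrite ge0_fin_numE// integral_ge0.
Qed.

Lemma Linfty_ae_le : V \in Lfun mu +oo%E ->
  {ae mu, forall x, `|V x| <= fine 'N[mu]_+oo[EFin \o V]%E}.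
Proof.
(* The L^oo norm unfolds to an essential supremum only on a space of positive measure. *)
move=> /Lfun_finite_norm; rewrite unlock lebesgue_rV_setT_gt0 => Voo.
have := ess_sup_ge mu (abse \o (EFin \o V)); apply: filterS => x /= Vx.
rewrite -lee_fin fineK// fin_real// Voo andbT.
by apply: lt_le_trans Vx; rewrite ltNyr.
Qed.

End Lfun_bounds.

(** Links the open interval of the marginals with the closed one of the Feynman-Kac functional; the
    bound on f gives the integrability needed to add the endpoints. *)
Lemma Rintegral_time_measure (R : realType) (t : R) (t_gt0 : 0 < t)
    (f : measurableTypeR R -> R) (b : R) :
  measurable_fun setT f -> (forall s, `|f s| <= b) ->
  \int[time_measure t_gt0]_s f s = \int[lebesgue_measure]_(s in `[0, t]) f s.
Proof.
move=> mf fb.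
have int_f (A : set (measurableTypeR R)) : measurable A ->
    (lebesgue_measure A < +oo)%E -> lebesgue_measure.-integrable A (EFin \o f).
  move=> mA Aoo; apply: measurable_bounded_integrable => //.
    exact: measurable_funTS.
  exists b; split; first exact: num_real.
  by move=> x bx s _; exact: le_trans (fb s) (ltW bx).
rewrite /time_measure Rintegral_restricted//.
rewrite -Rintegral_itv_obnd_cbnd; last first.
  apply: int_f => //; rewrite lebesgue_measure_itv/= lte_fin t_gt0.
  by rewrite -EFinB ltry.
rewrite -Rintegral_itv_bndo_bndc//.
apply: int_f => //; rewrite lebesgue_measure_itv/= lte_fin t_gt0.
by rewrite -EFinB ltry.
Qed.

(** * The trace estimate for stable loops and the final bounds *)

Section trace_estimate.
Context {R : realType} {d : nat} (alpha gamma : R).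
Hypotheses (d_gt0 : (0 < d)%N) (alpha_gt0 : 0 < alpha).
Hypotheses (gamma_gt0 : 0 < gamma) (gamma_lt : gamma < alpha).
Local Notation mu := (lebesgue_rV R d).

(** The factor 2^(d/alpha) is p_(t/2)(0)/p_t(0). *)
Definition loop_const : R :=
  2 `^ (d%:R / alpha) * @kernel_moment_const R d alpha (@density_gap R d alpha) gamma.

Context disp (Omega : measurableType disp).
Variables (P : R -> 'rV[R]_d -> 'rV[R]_d -> probability Omega R)
  (X : R -> Omega -> 'rV[R]_d).
Hypothesis bridge : forall t x y, 0 < t -> is_stable_bridge alpha (P t x y) X t x y.

Local Notation p0 t := (stable_density alpha t (0 : 'rV[R]_d)).
Let density_neq0 := stable_bridge_density_neq0 bridge.

Lemma loop_const_ge0 : 0 <= loop_const.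
Proof.
rewrite mulr_ge0 ?powR_ge0// ltW// kernel_moment_const_gt0//.
exact: density_gap_gt0.
Qed.

Lemma stable_loop_moment r t : 0 < r < t ->
  (\int[mu]_z (enorm z `^ gamma *
     (stable_density alpha r z * stable_density alpha (t - r) z))%:E <=
   (loop_const * t `^ (gamma / alpha) * stable_density alpha t (0 : 'rV[R]_d))%:E)%E.
Proof.
move=> rt; exact: (@loop_moment R d alpha alpha_gt0 (stable_density alpha)
  (@density_gap R d alpha) (@measurable_stable_density1 R d alpha)
  (stable_density_gt0 density_neq0) (@stable_densityN R d alpha)
  (stable_density_le0 density_neq0) (le_stable_density0 density_neq0)
  (stable_density_scale density_neq0) (continuous_stable_density_ray density_neq0)
  (density_gap_gt0 alpha_gt0 density_neq0) (density_gap_le alpha_gt0 density_neq0)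
  (stable_chapman_kolmogorov bridge) gamma gamma_gt0 gamma_lt r t rt).
Qed.

Variables (V : 'rV[R]_d -> R) (M N N1 : R).
Hypotheses (mV : measurable_fun setT V) (VN : forall z, `|V z| <= N) (M_gt0 : 0 < M).
Hypothesis VH : forall x y, `|V x - V y| <= M * enorm (x - y) `^ gamma.
Hypothesis N1E : (\int[mu]_z (`|V z|)%:E = N1%:E)%E.

Lemma trace_estimate t : 0 < t ->
  `|trace_difference alpha P X V t -
    p0 t * (- t * \int[mu]_x V x + t ^+ 2 / 2 * \int[mu]_x V x ^+ 2)| <=
  p0 t * (t ^+ 2 * N ^+ 2 * expR (t * N) * (t * N1) +
        4^-1 * (2 * N1 * (M / p0 t * (loop_const * t `^ (gamma / alpha) * p0 t)) * t ^+ 2)).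
Proof.
move=> t0.
have mX := measurable_bridge_process bridge.
have marginal1 x s (psi : 'rV[R]_d -> R) : 0 < s < t ->
    measurable_fun setT psi -> (forall z, 0 <= psi z) ->
    (\int[P t x x]_w (psi (X s w))%:E =
     \int[mu]_z (psi z * loop_density1 t (stable_density alpha) s x z)%:E)%E.
  move=> st mpsi psi0; rewrite (stable_bridge_expectation1 bridge _ _ st mpsi psi0).
  by rewrite subrr.
have marginal2 x u s (psi : 'rV[R]_d * 'rV[R]_d -> R) : 0 < u -> u < s -> s < t ->
    measurable_fun setT psi -> (forall q, 0 <= psi q) ->
    (\int[P t x x]_w (psi (X u w, X s w))%:E =
     \int[mu]_z1 \int[mu]_z2
       (psi (z1, z2) * loop_density2 t (stable_density alpha) u s x z1 z2)%:E)%E.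
  move=> u0 us st mpsi psi0.
  rewrite (stable_bridge_expectation2 bridge _ _ u0 us st mpsi psi0).
  by rewrite subrr.
have AE : (fun w => expR (- \int[lebesgue_measure]_(s in `[0, t]) V (X s w))) =
    (fun w => expR (- \int[time_measure t0]_s V (X (Num.max 0 s) w))).
  apply: funext => w; congr (expR (- _)).
  have mVX : measurable_fun setT
      (fun s : measurableTypeR R => V (X (Num.max 0 s) w)).
    exact: (measurableT_comp mV (measurableT_comp mX (measurable_pair2 w))).
  rewrite (Rintegral_time_measure t0 mVX (fun s => VN _)).
  apply: eq_Rintegral => s; rewrite inE/= in_itv/= => /andP[s0 _].
  by rewrite max_r.
have TrE : trace_difference alpha P X V t = \int[mu]_x (p0 t *
    fine (\int[P t x x]_w (expR (- \int[time_measure t0]_s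
       V (X (Num.max 0 s) w)))%:E)%E - p0 t).
  rewrite /trace_difference; apply: eq_Rintegral => x _.
  by rewrite /schrodinger_kernel /stable_kernel subrr AE unlock.
rewrite TrE.
exact: (loop_expansion t0 (@measurable_stable_density R d alpha)
  (stable_density_gt0 density_neq0) (@stable_densityN R d alpha)
  (stable_chapman_kolmogorov bridge) mX marginal1 marginal2 mV M_gt0 VH N1E
  (fun r => @stable_loop_moment r t) VN).
Qed.

End trace_estimate.

(** The factor q cancels inside M/q * (c T q), and the difference of the two sides is q N1 (c n^2 e
    t^3 + (1 + c/2) M T t^2). *)
Lemma remainder_le (R : realType) (q t n e N1 M c T : R) :
  0 < q -> 0 <= t -> 0 <= e -> 0 <= N1 -> 0 <= M -> 0 <= T -> 0 <= c ->
  q * (t ^+ 2 * n ^+ 2 * e * (t * N1) +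
       4^-1 * (2 * N1 * (M / q * (c * T * q)) * t ^+ 2)) <=
  (1 + `|c|) * N1 * q * (n ^+ 2 * e * t ^+ 3 + M * (T * t ^+ 2)).
Proof.
move=> q0 t0 e0 N10 M0 T0 c0; rewrite (ger0_norm c0) -subr_ge0.
rewrite (_ : _ - _ = q * N1 * (c * (n ^+ 2 * e * t ^+ 3) +
  (1 + 2^-1 * c) * (M * (T * t ^+ 2)))); last by field; rewrite gt_eqF.
have ne : 0 <= n ^+ 2 * e * t ^+ 3
  by apply: mulr_ge0; [apply: mulr_ge0 => //; exact: sqr_ge0|exact: exprn_ge0].
have MT : 0 <= M * (T * t ^+ 2).
  by apply: mulr_ge0 => //; apply: mulr_ge0 => //; exact: sqr_ge0.
apply: mulr_ge0; first exact: mulr_ge0 (ltW q0) N10.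
by apply: addr_ge0; apply: mulr_ge0 => //; rewrite addr_ge0// mulr_ge0.
Qed.

(** As a < 1, the cubic term is at most t^(a+2) for t <= 1, and its exponential factor is at most
    e^n. *)
Lemma powR_small_bigO (R : realType) (r : R -> R) (a C1 n M : R) :
  a < 1 -> 0 <= n -> 0 <= M -> 0 <= C1 ->
  (forall t, 0 < t -> `|r t| <=
     C1 * (n ^+ 2 * expR (t * n) * t ^+ 3 + M * t `^ (a + 2))) ->
  r =O_ (0^'+) (fun t => t `^ (a + 2)).
Proof.
move=> a1 n0 M0 C10 rC; apply/eqO_exP.
exists (C1 * (n ^+ 2 * expR n + M) + 1).
  by rewrite ltr_wpDl// !(mulr_ge0, addr_ge0, expR_ge0, sqr_ge0).
near=> t.
have t0 : 0 < t by [].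
have t1 : t <= 1 by near: t; exact: nbhs_right_le.
rewrite (ger0_norm (powR_ge0 _ _)); apply: le_trans (rC t t0) _.
have t3 : t ^+ 3 <= t `^ (a + 2).
  rewrite -powR_mulrn ?(ltW t0)//; apply: ger_powR; first by rewrite t0.
  lra.
have en : expR (t * n) <= expR n by rewrite ler_expR ler_piMl.
have h : n ^+ 2 * expR (t * n) * t ^+ 3 <= n ^+ 2 * expR n * t `^ (a + 2).
  apply: ler_pM => //; rewrite ?mulr_ge0 ?sqr_ge0 ?expR_ge0 ?exprn_ge0 ?(ltW t0)//.
  by rewrite ler_wpM2l ?sqr_ge0.
apply: (@le_trans _ _ (C1 * ((n ^+ 2 * expR n + M) * t `^ (a + 2)))).
  by apply: ler_wpM2l => //; rewrite mulrDl lerD2r.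
by rewrite mulrA [leRHS]mulrDl lerDl mul1r powR_ge0.
Unshelve. all: by end_near.
Qed.
Theorem theorem2p2 (R : realType) (d : nat) (alpha gamma : R)
    (hd : (0 < d)%N) (halpha : 0 < alpha < 2) (hgamma : 0 < gamma)
    (hgamma_le1 : alpha <= 1 -> gamma < Num.min alpha 1)
    (hgamma_gt1 : 1 < alpha -> gamma <= 1) :
  exists2 C : R, 0 < C &
    forall (disp : measure_display) (Omega : measurableType disp)
      (P : R -> 'rV[R]_d -> 'rV[R]_d -> probability Omega R)
      (X : R -> Omega -> 'rV[R]_d),
    (forall t x y, 0 < t -> is_stable_bridge alpha (P t x y) X t x y) ->
    forall (V : 'rV[R]_d -> R) (M : R),
    V \in Lfun (lebesgue_rV R d) 1%E ->
    V \in Lfun (lebesgue_rV R d) +oo%E ->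
    0 < M ->
    (forall x y, `|V x - V y| <= M * enorm (x - y) `^ gamma) ->
    let p0 t := stable_density alpha t (0 : 'rV[R]_d) in
    let Tr := trace_difference alpha P X V in
    let intV := \int[lebesgue_rV R d]_x V x in
    let intV2 := \int[lebesgue_rV R d]_x `|V x| ^+ 2 in
    let N1 := fine 'N[lebesgue_rV R d]_1%E[EFin \o V]%E in
    let Noo := fine 'N[lebesgue_rV R d]_+oo%E[EFin \o V]%E in
    (forall t, 0 < t ->
      `|Tr t + p0 t * t * intV - p0 t * (1 / 2 * t ^+ 2) * intV2|
      <= C * N1 * p0 t *
         (Noo ^+ 2 * expR (t * Noo) * t ^+ 3 + M * t `^ (gamma / alpha + 2)))
    /\
    (exists2 r : R -> R, r =O_ (0^'+) (fun t => t `^ (gamma / alpha + 2)) &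
      forall t, 0 < t ->
        Tr t = p0 t * (- t * intV + 1 / 2 * t ^+ 2 * intV2 + r t)).
Proof.
have alpha_gt0 : 0 < alpha by case/andP: halpha.
have gamma_lt : gamma < alpha.
  have [a1|a1] := leP alpha 1; last exact: le_lt_trans (hgamma_gt1 a1) a1.
  by apply: lt_le_trans (hgamma_le1 a1) _; rewrite ge_min lexx.
(* The sign of [loop_const] is known only once bridges are at hand; the absolute value makes the
   constant positive beforehand. *)
exists (1 + `|@loop_const R d alpha gamma|); first by rewrite ltr_wpDr.
move=> disp Omega P X bridge V M V1 Voo M_gt0 VH p0 Tr intV intV2 N1 Noo.
have mV := Lfun_measurable V1.
have N1E : (\int[lebesgue_rV R d]_z (`|V z|)%:E = N1%:E)%E := Lfun1_norm V1.
have VN : forall z, `|V z| <= Noo := hoelder_ess_bound hd hgamma M_gt0 VH (Linfty_ae_le Voo).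
have p0_gt0 t : 0 < t -> 0 < p0 t.
  by move=> t0; exact: stable_density0_gt0 (stable_bridge_density_neq0 bridge) t t0.
have N1_ge0 : 0 <= N1.
  by rewrite -lee_fin -N1E; apply: integral_ge0 => z _; rewrite lee_fin.
have Noo_ge0 : 0 <= Noo := le_trans (normr_ge0 _) (VN 0).
have c_ge0 := loop_const_ge0 alpha_gt0 gamma_lt bridge.
have intV2E : intV2 = \int[lebesgue_rV R d]_x V x ^+ 2.
  by apply: eq_Rintegral => x _; rewrite real_normK// num_real.
have est t : 0 < t -> `|Tr t + p0 t * t * intV - p0 t * (1 / 2 * t ^+ 2) * intV2| <=
    (1 + `|@loop_const R d alpha gamma|) * N1 * p0 t *
    (Noo ^+ 2 * expR (t * Noo) * t ^+ 3 + M * t `^ (gamma / alpha + 2)).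
  move=> t0; have := trace_estimate alpha_gt0 hgamma gamma_lt bridge mV VN M_gt0 VH N1E t0.
  rewrite -/(Tr t) -/(p0 t) -intV2E -/intV powRD ?(gt_eqF t0) ?implybT// (powR_mulrn 2 (ltW t0)).
  move=> h; have {h} := le_trans h (remainder_le Noo (p0_gt0 t t0) (ltW t0)
    (expR_ge0 (t * Noo)) N1_ge0 (ltW M_gt0) (powR_ge0 t (gamma / alpha)) c_ge0).
  apply: le_trans; rewrite le_eqVlt; apply/orP; left; apply/eqP; congr `|_|.
  by clearbody p0 Tr; move: (p0 t) (Tr t) => q T; field.
split; first exact: est.
(* The expansion solved for its error term; the estimate divided by [p0 t] bounds it. *)
exists (fun t => Tr t / p0 t + t * intV - 1 / 2 * t ^+ 2 * intV2); last first.
  move=> t t0; have := p0_gt0 t t0.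
  by clearbody p0 Tr; move: (p0 t) (Tr t) => q T q0; field; rewrite gt_eqF.
apply: (@powR_small_bigO R _ (gamma / alpha)
  ((1 + `|@loop_const R d alpha gamma|) * N1) Noo M) => //.
- by rewrite ltr_pdivrMr// mul1r.
- exact: ltW.
- by rewrite mulr_ge0// addr_ge0.
move=> t t0; have q0 := p0_gt0 t t0.
rewrite -(ler_pM2l q0) -{1}(gtr0_norm q0) -normrM.
apply: le_trans (le_trans _ (est t t0)) _; last first.
  by rewrite le_eqVlt; apply/orP; left; apply/eqP; ring.
rewrite le_eqVlt; apply/orP; left; apply/eqP; congr `|_|.
by clearbody p0 Tr; move: q0; move: (p0 t) (Tr t) => q T q0; field; rewrite gt_eqF.
Qed.
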